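(* Let $\mathcal S=\{S_1\cup S_2\cup\dots\cup S_k\}$ be any configuration of unit spheres, each passing through the origin of $\mathbb R^3$. Then there exist a sequence of real numbers $\varepsilon_n\to 0^+$, smooth functions $\tilde g_n:\partial\mathcal D\to\mathbb R^3$, and a sequence of maps $u_n:\mathcal D\to\mathbb R^3$ of the form $$u_n=\sum_{i=1}^k P\mathcal Q_i\,\delta_{\mu_i,\,\xi^{(i)},\,a_i,\,p_i}+w$$ (where $\mathcal Q_i\in SO(3)$, $\mu_i>0$, $\xi^{(i)},a_i,p_i\in\mathbb R^2$ for all $i$, and $w$ is a perturbation term, all of these depending on $n$), such that $u_n$ solves the $H$-system on the unit disk $\mathcal D$ with boundary datum $\varepsilon_n\tilde g_n$, $$\Delta u_n=2\,(u_n)_x\wedge (u_n)_y\ \text{ in }\mathcal D,\qquad u_n=\varepsilon_n\tilde g_n\ \text{ on }\partial\mathcal D,$$ and such that the image of $u_n$ converges to $\mathcal S$ in the Hausdorff sense.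
   Context: $k$ is a positive integer. $\mathcal D\subset\mathbb R^2$ is the unit disk, with coordinates $(x,y)$; $\wedge$ is the cross product in $\mathbb R^3$; subscripts $x,y$ denote partial derivatives. Points $z=(x,y)\in\mathbb R^2$ are identified with complex numbers $x+iy$. Stereographic projection: $\pi(x,y)=\frac{1}{1+x^2+y^2}(2x,2y,x^2+y^2-1)\in\mathbb S^2\subset\mathbb R^3$. Degree 2 bubbles: for $\mu>0$ and $\xi,a,p\in\mathbb R^2\cong\mathbb C$, $$\delta_{\mu,\xi,a,p}(z)=\pi\left(\frac{\left(\frac{z-\xi}{\mu}-a\left|\frac{z-\xi}{\mu}\right|^2\right)^2}{\left(1-2a\cdot\frac{z-\xi}{\mu}+|a|^2\left|\frac{z-\xi}{\mu}\right|^2\right)^2}+p\right),$$ where the square in the numerator is the square of a complex number and $a\cdot\frac{z-\xi}{\mu}$ is the real inner product in $\mathbb R^2$. These are degree 2 solutions of $\Delta u=2u_x\wedge u_y$ in $\mathbb R^2$. Projection: for a map $f$ on $\overline{\mathcal D}$, $Pf=f-f_0$, where $f_0$ is the harmonic function in $\mathcal D$ with $f_0=f$ on $\partial\mathcal D$; $P\mathcal Q\delta$ denotes $P(\mathcal Q\delta)$, which vanishes on $\partial\mathcal D$. The statement describes $w$ only as ''a perturbation term'', with no further specification. *)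

(* Defs.v *)
From HB Require Import structures.
From mathcomp Require Import all_boot all_order all_algebra.
From mathcomp Require Import all_classical all_reals all_analysis.

Set Implicit Arguments.
Unset Strict Implicit.
Unset Printing Implicit Defensive.

Import Order.TTheory GRing.Theory Num.Theory.
Import numFieldNormedType.Exports.

Local Open Scope classical_set_scope.
Local Open Scope ring_scope.

(* The plane is R * R and space is 'cV[R]_3. The norms and balls which the
   library puts on these types are sup-norms; they are used for the topology
   only, and every metric notion below is Euclidean. *)

Section Plane.
Variable R : realType.
Implicit Types z v : R * R.

Definition dot2 v z : R := v.1 * z.1 + v.2 * z.2.

Definition sqn2 z : R := dot2 z z.

(* The square of the complex number z.1 + i z.2. *)
Definition csqr z : R * R := (z.1 ^+ 2 - z.2 ^+ 2, 2 * z.1 * z.2).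

Definition disk : set (R * R) := [set z | sqn2 z < 1].
Definition closed_disk : set (R * R) := [set z | sqn2 z <= 1].
Definition circle : set (R * R) := [set z | sqn2 z = 1].

Definition circle_pt (t : R) : R * R := (cos t, sin t).

End Plane.

Section Space.
Variable R : realType.
Implicit Types v w : 'cV[R]_3.

Definition col3 (a b c : R) : 'cV[R]_3 := \col_i nth 0 [:: a; b; c] i.

Definition cross v w : 'cV[R]_3 :=
  let e1 : 'I_3 := inord 0 in let e2 : 'I_3 := inord 1 in
  let e3 : 'I_3 := inord 2 in
  col3 (v e2 0 * w e3 0 - v e3 0 * w e2 0)
       (v e3 0 * w e1 0 - v e1 0 * w e3 0)
       (v e1 0 * w e2 0 - v e2 0 * w e1 0).

Definition enorm v : R := Num.sqrt (\sum_i v i 0 ^+ 2).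

Definition unit_sphere (c : 'cV[R]_3) : set 'cV[R]_3 :=
  [set v | enorm (v - c) = 1].

Definition in_SO3 (Q : 'M[R]_3) : Prop := Q *m Q^T = 1%:M /\ \det Q = 1.

Local Open Scope ereal_scope.

Definition dist_to_set (A : set 'cV[R]_3) v : \bar R :=
  ereal_inf [set (enorm (v - a))%:E | a in A].

Definition hausdorff_dist (A B : set 'cV[R]_3) : \bar R :=
  maxe (ereal_sup [set dist_to_set B a | a in A])
       (ereal_sup [set dist_to_set A b | b in B]).

End Space.

Section Maps.
Variable R : realType.
Implicit Types (A : set (R * R)) (f u v : R * R -> 'cV[R]_3).

Definition dx u : R * R -> 'cV[R]_3 := 'D_((1, 0) : R * R) u.
Definition dy u : R * R -> 'cV[R]_3 := 'D_((0, 1) : R * R) u.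

Definition laplacian u : R * R -> 'cV[R]_3 :=
  fun z => dx (dx u) z + dy (dy u) z.

(* 'D_e is a total operator, so existence of the partial derivatives has to be
   required separately. Meant for open A. *)
Definition C1_on A u : Prop :=
  (forall z, A z -> derivable u z (1, 0) /\ derivable u z (0, 1)) /\
  (forall z, A z -> {for z, continuous (dx u)} /\ {for z, continuous (dy u)}).

Definition C2_on A u : Prop := [/\ C1_on A u, C1_on A (dx u) & C1_on A (dy u)].

(* Only the values of g on the unit circle matter. The angle being a local
   chart of the circle, this is smoothness of g as a map on that manifold. *)
Definition smooth_on_circle (g : R * R -> 'cV[R]_3) : Prop :=
  forall (m : nat) (t : R), derivable (derive1n m (g \o @circle_pt R)) t 1.

Definition is_harmonic_extension f f0 : Prop :=
  [/\ {within @closed_disk R, continuous f0},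
      C2_on (@disk R) f0,
      forall z, disk z -> laplacian f0 z = 0 &
      forall z, circle z -> f0 z = f z].

(* v = P f on the closed disk; f0 is unique there by the maximum principle. *)
Definition is_projection f v : Prop :=
  exists2 f0, is_harmonic_extension f f0 &
    forall z, closed_disk z -> v z = f z - f0 z.

Definition solves_H_system u (phi : R * R -> 'cV[R]_3) : Prop :=
  [/\ {within @closed_disk R, continuous u},
      C2_on (@disk R) u,
      forall z, disk z -> laplacian u z = 2 *: cross (dx u z) (dy u z) &
      forall z, circle z -> u z = phi z].

End Maps.

Section Bubbles.
Variable R : realType.

Definition stereo (z : R * R) : 'cV[R]_3 :=
  (1 + sqn2 z)^-1 *: col3 (2 * z.1) (2 * z.2) (sqn2 z - 1).

(* With zeta = (z - xi) / mu, the quotient inside the stereographic projection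
   is the square of zeta / (1 - conj(a) zeta). At its pole zeta = a / |a|^2 the
   formula reads 0 / 0; the singularity is removable and the value of the
   bubble there is stereo(infinity) = (0, 0, 1). *)
Definition bubble (mu : R) (xi a p z : R * R) : 'cV[R]_3 :=
  let zeta := mu^-1 *: (z - xi) in
  let den := 1 - 2 * dot2 a zeta + sqn2 a * sqn2 zeta in
  if den == 0 then col3 0 0 1
  else stereo ((den ^+ 2)^-1 *: csqr (zeta - sqn2 zeta *: a) + p).

End Bubbles.

(* Main.v *)
(* The H-system is integrable: it has a Lax pair with spectral parameter m, and
   adding - Re m N to a solution u, where N is the Hopf image of a solution of
   the Lax pair, yields another solution. Starting from the vacuum (0, 0, 2 Re f)
   with f = i pi eps G, G holomorphic, and transforming twice with
   m1 = 1 + eps / sigma and m2 = 1 + eps / (sigma - 1) gives the explicit solution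
   u = (0, 0, 2 Re f) - Re m1 N1 - Re m2 N2. As eps -> 0, the two spinors have
   phases pi i sigma G and pi i (sigma - 1) G; they are linearly independent and
   then N2 -> - N1, so u -> 0, except where exp(2 pi i G) = 1, i.e. G is an
   integer. Where G takes an integer value n with multiplicity two, N2 performs a
   degree 2 bubble and u covers the sphere centered at - N1, whose direction is
   determined by sigma n. A suitable sigma makes these directions dense, and G can
   be chosen to be integer-valued at k prescribed points of the closed disk only,
   with prescribed integers. In the coordinate of the disk automorphism vanishing
   at such a point, the boundary values of the bubble are affine in the square of
   that coordinate, which gives P Q delta explicitly, and the remainder w is
   uniformly small by compactness of the closed disk. *)

Require Import Defs.
From HB Require Import structures.
From mathcomp Require Import all_boot all_order all_algebra.
From mathcomp Require Import all_classical all_reals all_analysis.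
From mathcomp Require Import complex ring lra.

Set Implicit Arguments.
Unset Strict Implicit.
Unset Printing Implicit Defensive.

Import Order.TTheory GRing.Theory Num.Theory.
Import numFieldNormedType.Exports.

Local Open Scope classical_set_scope.
Local Open Scope ring_scope.

(** * Elementary expressions of two variables and their derivatives *)

(** The form of the two spectral parameters is dictated by finite phases: since m1 - 1 = eps /
    sigma, the factor eps of f cancels in f / (m1 - 1). The two limiting phases differ by pi i G
    whatever sigma is, so the points of concentration depend on G alone and sigma is left free to
    steer the directions. Near such a point G = n + tau V, with tau the square of the disk
    coordinate, and the dressed spinor is eps times a multiple of the first spinor plus tau times a
    multiple of the orthogonal one. The ratio tau / eps is the variable of the bubble, whence its
    degree 2 and its scale sqrt eps. The obstacle is that one exact solution has to serve k centers.
    The directions are therefore only approximated, G must be an integer nowhere else on the closed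
    disk, and limits are taken jointly in the point and in eps, since tau and eps may tend to 0 at
    any relative rate. As the solution is explicit, every differential identity is reduced to
    symbolic differentiation followed by a rational identity. *)

Section Expressions.
Variable R : realType.

(** A deep embedding: partial derivatives are again expressions, and a differential identity becomes
    an identity between their values, within reach of [ring] and [field]. *)
Inductive ex :=
  | EC of R | EX | EY
  | EAdd of ex & ex | EMul of ex & ex | EInv of ex
  | EExp of ex | ECos of ex | ESin of ex | ELn of ex | EAtan of ex.

Implicit Types (e : ex) (z : R * R).

Fixpoint ev e z : R :=
  match e with
  | EC c => c | EX => z.1 | EY => z.2
  | EAdd a b => ev a z + ev b z
  | EMul a b => ev a z * ev b z
  | EInv a => (ev a z)^-1
  | EExp a => expR (ev a z)
  | ECos a => cos (ev a z)
  | ESin a => sin (ev a z)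
  | ELn a => ln (ev a z)
  | EAtan a => atan (ev a z)
  end.

(** Inversion and logarithm are total functions with default values; [ok] keeps [z] where every
    subexpression is smooth. *)
Fixpoint ok e z : Prop :=
  match e with
  | EC _ => True | EX => True | EY => True
  | EAdd a b => ok a z /\ ok b z
  | EMul a b => ok a z /\ ok b z
  | EInv a => ok a z /\ ev a z != 0
  | EExp a => ok a z
  | ECos a => ok a z
  | ESin a => ok a z
  | ELn a => ok a z /\ 0 < ev a z
  | EAtan a => ok a z
  end.

Definition EOpp a := EMul (EC (-1)) a.
Definition ESub a b := EAdd a (EOpp b).

(* Derivative along the vector field (p, q). *)
Fixpoint der (p q : ex) e : ex :=
  match e with
  | EC _ => EC 0 | EX => p | EY => q
  | EAdd a b => EAdd (der p q a) (der p q b)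
  | EMul a b => EAdd (EMul a (der p q b)) (EMul b (der p q a))
  | EInv a => EOpp (EMul (EMul (EInv a) (EInv a)) (der p q a))
  | EExp a => EMul (EExp a) (der p q a)
  | ECos a => EOpp (EMul (ESin a) (der p q a))
  | ESin a => EMul (ECos a) (der p q a)
  | ELn a => EMul (EInv a) (der p q a)
  | EAtan a => EMul (EInv (EAdd (EC 1) (EMul a a))) (der p q a)
  end.

Definition Dx := der (EC 1) (EC 0).
Definition Dy := der (EC 0) (EC 1).

Lemma sqr1_neq0 (x : R) : 1 + x * x != 0.
Proof. by apply: lt0r_neq0; rewrite ltr_pwDl // -expr2 sqr_ge0. Qed.

Lemma ok_der p q e z : ok p z -> ok q z -> ok e z -> ok (der p q e) z.
Proof.
move=> hp hq; elim: e => //=.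
- by move=> a ha b hb [/ha ? /hb ?].
- by move=> a ha b hb [? ?]; do !split; auto.
- by move=> a ha [? ?]; do !split; auto.
- by move=> a ha ?; do !split; auto.
- by move=> a ha ?; do !split; auto.
- by move=> a ha ?; do !split; auto.
- by move=> a ha [? ?]; do !split; auto; apply: lt0r_neq0.
- by move=> a ha ?; do !split; auto; exact: sqr1_neq0.
Qed.

Lemma ok_Dx e z : ok e z -> ok (Dx e) z. Proof. exact: ok_der. Qed.
Lemma ok_Dy e z : ok e z -> ok (Dy e) z. Proof. exact: ok_der. Qed.

(** Schwarz's theorem by structural induction: the mixed derivatives are different expressions with
    the same value. *)
Lemma DxDyC e z : ok e z -> ev (Dx (Dy e)) z = ev (Dy (Dx e)) z.
Proof.
rewrite /Dx /Dy; elim: e => //=.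
- by move=> a ha b hb [/ha -> /hb ->].
- by move=> a ha b hb [/ha -> /hb ->]; ring.
- by move=> a ha [/ha -> h]; field.
- by move=> a ha /ha ->; ring.
- by move=> a ha /ha ->; ring.
- by move=> a ha /ha ->; ring.
- by move=> a ha [/ha -> h]; field; apply: lt0r_neq0.
- by move=> a ha /ha ->; field; rewrite sqr1_neq0.
Qed.

(** The chain rule along a curve whose velocity is given by expressions: constants on straight
    lines, [(-y, x)] on the unit circle. *)
Lemma is_derive_ev p q (g1 g2 : R -> R) (t : R) e :
  is_derive t 1 g1 (ev p (g1 t, g2 t)) ->
  is_derive t 1 g2 (ev q (g1 t, g2 t)) ->
  ok e (g1 t, g2 t) ->
  is_derive t 1 (fun s => ev e (g1 s, g2 s)) (ev (der p q e) (g1 t, g2 t)).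
Proof.
move=> h1 h2; elim: e => [c|||a ha b hb|a ha b hb|a ha|a ha|a ha|a ha|a ha|a ha] /=.
- by move=> _; exact: is_derive_cst.
- by [].
- by [].
- by move=> [/ha da /hb db]; exact: (is_deriveD da db).
- by move=> [/ha da /hb db]; exact: (is_deriveM da db).
- move=> [/ha da na]; have dV := is_deriveV na da.
  apply: (@is_derive_eq _ _ _ _ _ _ _ _ dV).
  by rewrite /= -mulr_algr /GRing.scale /= expr2 invfM; ring.
- move=> /ha da; exact: (is_derive1_comp (is_derive_expR _) da).
- move=> /ha da; rewrite mulN1r -mulNr; exact: (is_derive1_comp (is_derive_cos _) da).
- move=> /ha da; exact: (is_derive1_comp (is_derive_sin _) da).
- move=> [/ha da na]; exact: (is_derive1_comp (is_derive1_ln na) da).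
- move=> /ha da; rewrite -expr2; exact: (is_derive1_comp (is_derive1_atan _) da).
Qed.

Lemma continuous_ev e z : ok e z -> {for z, continuous (ev e)}.
Proof.
elim: e => [c|||a ha b hb|a ha b hb|a ha|a ha|a ha|a ha|a ha|a ha] /=.
- by move=> _; exact: cvg_cst.
- by move=> _; exact: cvg_fst.
- by move=> _; exact: cvg_snd.
- by move=> [/ha da /hb db]; exact: cvgD.
- by move=> [/ha da /hb db]; exact: cvgM.
- by move=> [/ha da na]; exact: cvgV.
- by move=> /ha da; apply: continuous_comp => //; exact: continuous_expR.
- by move=> /ha da; apply: continuous_comp => //; exact: continuous_cos.
- by move=> /ha da; apply: continuous_comp => //; exact: continuous_sin.
- by move=> [/ha da na]; apply: continuous_comp => //; exact: continuous_ln.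
- by move=> /ha da; apply: continuous_comp => //; exact: continuous_atan.
Qed.

Lemma is_derive_ev_line e (z : R * R) (c d : R) : ok e z ->
  is_derive z (c, d) (ev e) (ev (der (EC c) (EC d) e) z).
Proof.
move=> oke.
have H : is_derive (0 : R) 1 (fun s => ev e (c * s + z.1, d * s + z.2))
   (ev (der (EC c) (EC d) e) (c * 0 + z.1, d * 0 + z.2)).
  have lin (u v : R) : is_derive (0 : R) 1 (fun s => u * s + v) u.
    have -> : (fun s : R => u * s + v) = (u *: id) + cst v by [].
    apply: is_derive_eq; rewrite addr0 scaler1 //.
  apply: is_derive_ev => /=; try exact: lin.
  by rewrite !mulr0 !add0r; case: z oke.
have Ez : (c * 0 + z.1, d * 0 + z.2) = z by rewrite !mulr0 !add0r; case: z {oke H}.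
rewrite Ez in H; case: H => H1 H2.
have E : (fun h : R => h^-1 *: (ev e (h *: (c, d) + z) - ev e z)) =
  (fun h : R => h^-1 *: ((fun s => ev e (c * s + z.1, d * s + z.2)) (h *: 1 + 0) -
     (fun s => ev e (c * s + z.1, d * s + z.2)) 0)).
  apply/funext => h; rewrite Ez; congr (_ *: (ev e _ - _)).
  by rewrite addr0 /GRing.scale /= mulr1 /GRing.add /= (mulrC c) (mulrC d).
split.
  by rewrite /derivable E.
by rewrite -H2 /derive E.
Qed.

Lemma is_derive_ev_x e z : ok e z -> is_derive z (1, 0) (ev e) (ev (Dx e) z).
Proof. exact: is_derive_ev_line. Qed.

Lemma is_derive_ev_y e z : ok e z -> is_derive z (0, 1) (ev e) (ev (Dy e) z).
Proof. exact: is_derive_ev_line. Qed.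

Lemma near_eq_is_derive (V : normedModType R) (f g : R * R -> V) z v d :
  (\forall y \near z, f y = g y) ->
  is_derive z v g d -> is_derive z v f d.
Proof.
move=> fg [dg <-].
have E : {near (0 : R)^', (fun h => h^-1 *: ((f \o shift z) (h *: v) - f z)) =1
   (fun h => h^-1 *: ((g \o shift z) (h *: v) - g z))}.
  have fgz := nbhs_singleton fg.
  have : (h *: v + z) @[h --> (0:R)] --> z.
    rewrite -[X in _ --> X]add0r -[X in _ --> X + _](scale0r v).
    by apply: cvgD; [apply: cvgZl; exact: cvg_id|exact: cvg_cst].
  move=> /(_ _ fg) /= H; apply: nbhs_dnbhs.
  by near=> h => /=; rewrite fgz; congr (_ *: (_ - _)); near: h.
have df : derivable f z v.
  apply: cvgP; apply: cvg_trans dg; apply: near_eq_cvg.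
  by move: E; apply: filterS => h /esym.
split => //; rewrite /derive; congr lim; apply/seteqP.
by split; apply: near_eq_cvg => //; near do apply/esym.
Unshelve. all: by end_near.
Qed.

(** Lets an equation valid on an open set be differentiated although its two sides are different
    expressions. *)
Lemma ev_der_ext (A : set (R * R)) a b z : open A ->
  (forall y, A y -> [/\ ok a y, ok b y & ev a y = ev b y]) ->
  A z -> ev (Dx a) z = ev (Dx b) z /\ ev (Dy a) z = ev (Dy b) z.
Proof.
move=> oA H Az; have [oka okb _] := H _ Az.
have N : \forall y \near z, ev a y = ev b y.
  have : nbhs z A by exact: open_nbhs_nbhs.
  by apply: filterS => y /H [].
have [_ <-] := is_derive_ev_x oka; have [_ <-] := is_derive_ev_y oka.
have [_ <-] := near_eq_is_derive N (is_derive_ev_x okb).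
by have [_ <-] := near_eq_is_derive N (is_derive_ev_y okb).
Qed.
End Expressions.

(** * Baecklund transformation of the H-system *)

Section Vectors.
Variable R : realType.
Implicit Types (u n : ex R * ex R * ex R) (A : set (R * R)).

Notation c1 u := u.1.1.
Notation c2 u := u.1.2.
Notation c3 u := u.2.

Definition ok3 u z := [/\ ok (c1 u) z, ok (c2 u) z & ok (c3 u) z].
Definition Dx3 u := (Dx (c1 u), Dx (c2 u), Dx (c3 u)).
Definition Dy3 u := (Dy (c1 u), Dy (c2 u), Dy (c3 u)).
Definition add3 u n := (EAdd (c1 u) (c1 n), EAdd (c2 u) (c2 n), EAdd (c3 u) (c3 n)).
Definition scale3 (r : R) u :=
  (EMul (EC r) (c1 u), EMul (EC r) (c2 u), EMul (EC r) (c3 u)).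
Definition cross3 u n :=
  (ESub (EMul (c2 u) (c3 n)) (EMul (c3 u) (c2 n)),
   ESub (EMul (c3 u) (c1 n)) (EMul (c1 u) (c3 n)),
   ESub (EMul (c1 u) (c2 n)) (EMul (c2 u) (c1 n))).
Definition eq3 u n z :=
  [/\ ev (c1 u) z = ev (c1 n) z, ev (c2 u) z = ev (c2 n) z
    & ev (c3 u) z = ev (c3 n) z].

Definition H_system3 u z :=
  eq3 (add3 (Dx3 (Dx3 u)) (Dy3 (Dy3 u))) (scale3 2 (cross3 (Dx3 u) (Dy3 u))) z.

(* The Baecklund relation with spectral parameter r + i k between a solution u
   of the H-system and the vector field n by which it is to be displaced. *)
Definition baecklund (r k : R) u n z :=
  eq3 (Dy3 n) (add3 (add3 (scale3 2 (cross3 (Dx3 u) n)) (scale3 (- k) (Dx3 n)))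
                 (scale3 (- r) (cross3 (Dx3 n) n))) z
  /\ eq3 (Dx3 n) (add3 (add3 (scale3 (- 2) (cross3 (Dy3 u) n)) (scale3 k (Dy3 n)))
                 (scale3 r (cross3 (Dy3 n) n))) z.

Lemma ok3_Dx u z : ok3 u z -> ok3 (Dx3 u) z.
Proof. by case=> *; split; exact: ok_Dx. Qed.
Lemma ok3_Dy u z : ok3 u z -> ok3 (Dy3 u) z.
Proof. by case=> *; split; exact: ok_Dy. Qed.
Lemma ok3_add u n z : ok3 u z -> ok3 n z -> ok3 (add3 u n) z.
Proof. by case=> ? ? ? [*]; split. Qed.
Lemma ok3_scale r u z : ok3 u z -> ok3 (scale3 r u) z.
Proof. by case=> ? ? ?; split. Qed.
Lemma ok3_cross u n z : ok3 u z -> ok3 n z -> ok3 (cross3 u n) z.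
Proof. by case=> ? ? ? [*]; do !split. Qed.

Lemma eq3_der A u n z : open A ->
  (forall y, A y -> [/\ ok3 u y, ok3 n y & eq3 u n y]) -> A z ->
  eq3 (Dx3 u) (Dx3 n) z /\ eq3 (Dy3 u) (Dy3 n) z.
Proof.
move=> oA H Az.
have d1 := @ev_der_ext _ A (c1 u) (c1 n) z oA _ Az.
have d2 := @ev_der_ext _ A (c2 u) (c2 n) z oA _ Az.
have d3 := @ev_der_ext _ A (c3 u) (c3 n) z oA _ Az.
by split; split; (apply d1 || apply d2 || apply d3);
  move=> y /H [[? ? ?] [? ? ?] [? ? ?]].
Qed.

Ltac ok3 := do !(apply: ok3_add || apply: ok3_scale || apply: ok3_cross ||
  apply: ok3_Dx || apply: ok3_Dy || assumption).

(** The x-derivative of the relation for n_x plus the y-derivative of that for n_y is the Laplacian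
    of n. The terms in k cancel by symmetry of the mixed derivatives, and the rest, 2 (u_x ^ n_y +
    n_x ^ u_y) - 2 r n_x ^ n_y, is what the bilinear right-hand side requires for u - r n. *)
Lemma baecklund_H A r k u n : open A ->
  (forall y, A y -> [/\ ok3 u y, ok3 n y & baecklund r k u n y]) ->
  (forall y, A y -> H_system3 u y) ->
  forall z, A z -> H_system3 (add3 u (scale3 (- r) n)) z.
Proof.
move=> oA H Hu z Az.
have [_ Ey] := eq3_der oA (z := z)
  (u := Dy3 n) (n := add3 (add3 (scale3 2 (cross3 (Dx3 u) n)) (scale3 (- k) (Dx3 n)))
                 (scale3 (- r) (cross3 (Dx3 n) n)))
  ltac:(by move=> y /H [? ? [? ?]]; split => //; ok3) Az.
have [Ex _] := eq3_der oA (z := z)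
  (u := Dx3 n) (n := add3 (add3 (scale3 (- 2) (cross3 (Dy3 u) n)) (scale3 k (Dy3 n)))
                 (scale3 r (cross3 (Dy3 n) n)))
  ltac:(by move=> y /H [? ? [? ?]]; split => //; ok3) Az.
have := Hu _ Az; have [[ou1 ou2 ou3] [on1 on2 on3] _] := H _ Az; clear H Hu.
move: Ex Ey; rewrite /H_system3 /eq3 /=.
rewrite -!/(Dx _) -!/(Dy _) /=.
rewrite /Dx /Dy /= -!/(Dx _) -!/(Dy _)
  !(DxDyC ou1, DxDyC ou2, DxDyC ou3, DxDyC on1, DxDyC on2, DxDyC on3).
move=> [X1 X2 X3] [Y1 Y2 Y3] [U1 U2 U3].
have comb (a b c d e f g h : R) : a = b -> c = d -> e = f ->
    g - h = (a - b) - r * ((c - d) + (e - f)) -> g = h.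
  by move=> -> -> -> /eqP; rewrite !subrr addr0 mulr0 subrr subr_eq0 => /eqP.
by split; [apply: comb U1 X1 Y1 _|apply: comb U2 X2 Y2 _|apply: comb U3 X3 Y3 _]; ring.
Qed.
End Vectors.

(** * Lax pair and dressing of spinors *)

Section Spinors.
Variable R : realType.

(* A spinor (a + i b, c + i d) is the tuple (a, b, c, d) of its real and
   imaginary parts. *)
Notation spinor := (ex R * ex R * ex R * ex R)%type.
Implicit Types (phi : spinor) (u n : ex R * ex R * ex R).

Notation c1 u := u.1.1.
Notation c2 u := u.1.2.
Notation c3 u := u.2.
Notation s1 p := p.1.1.1.
Notation s2 p := p.1.1.2.
Notation s3 p := p.1.2.
Notation s4 p := p.2.

Definition ok4 phi z :=
  [/\ ok (s1 phi) z, ok (s2 phi) z, ok (s3 phi) z & ok (s4 phi) z].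
Definition Dx4 phi := (Dx (s1 phi), Dx (s2 phi), Dx (s3 phi), Dx (s4 phi)).
Definition Dy4 phi := (Dy (s1 phi), Dy (s2 phi), Dy (s3 phi), Dy (s4 phi)).
Definition add4 phi psi : spinor :=
  (EAdd (s1 phi) (s1 psi), EAdd (s2 phi) (s2 psi),
   EAdd (s3 phi) (s3 psi), EAdd (s4 phi) (s4 psi)).

Definition cscale4 (r k : R) phi : spinor :=
  (ESub (EMul (EC r) (s1 phi)) (EMul (EC k) (s2 phi)),
   EAdd (EMul (EC r) (s2 phi)) (EMul (EC k) (s1 phi)),
   ESub (EMul (EC r) (s3 phi)) (EMul (EC k) (s4 phi)),
   EAdd (EMul (EC r) (s4 phi)) (EMul (EC k) (s3 phi))).

(* The action of the Pauli matrix [[u3, u1 - i u2], [u1 + i u2, - u3]]. *)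
Definition pauli u phi : spinor :=
  (EAdd (EMul (c3 u) (s1 phi)) (EAdd (EMul (c1 u) (s3 phi)) (EMul (c2 u) (s4 phi))),
   EAdd (EMul (c3 u) (s2 phi)) (ESub (EMul (c1 u) (s4 phi)) (EMul (c2 u) (s3 phi))),
   ESub (ESub (EMul (c1 u) (s1 phi)) (EMul (c2 u) (s2 phi))) (EMul (c3 u) (s3 phi)),
   ESub (EAdd (EMul (c1 u) (s2 phi)) (EMul (c2 u) (s1 phi))) (EMul (c3 u) (s4 phi))).

Definition eq4 phi psi z :=
  [/\ ev (s1 phi) z = ev (s1 psi) z, ev (s2 phi) z = ev (s2 psi) z,
      ev (s3 phi) z = ev (s3 psi) z & ev (s4 phi) z = ev (s4 psi) z].

(* Lax pair of the H-system with spectral parameter m = r + i k: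
   m phi_x + i phi_y = u_x.sigma phi and m phi_y - i phi_x = u_y.sigma phi. *)
Definition lax (r k : R) u phi z :=
  eq4 (Dy4 phi) (cscale4 0 1 (add4 (cscale4 r k (Dx4 phi))
                                   (cscale4 (- 1) 0 (pauli (Dx3 u) phi)))) z
  /\ eq4 (Dx4 phi) (cscale4 0 (- 1) (add4 (cscale4 r k (Dy4 phi))
                                   (cscale4 (- 1) 0 (pauli (Dy3 u) phi)))) z.

Definition sqnorm4 phi :=
  EAdd (EAdd (EMul (s1 phi) (s1 phi)) (EMul (s2 phi) (s2 phi)))
       (EAdd (EMul (s3 phi) (s3 phi)) (EMul (s4 phi) (s4 phi))).

(** Where [phi] is nonzero, this is the unit vector whose Pauli matrix fixes [phi]. *)
Definition hopf3 phi : ex R * ex R * ex R :=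
  let q := EInv (sqnorm4 phi) in
  (EMul (EMul (EC 2) (EAdd (EMul (s1 phi) (s3 phi)) (EMul (s2 phi) (s4 phi)))) q,
   EMul (EMul (EC 2) (ESub (EMul (s1 phi) (s4 phi)) (EMul (s2 phi) (s3 phi)))) q,
   EMul (ESub (EAdd (EMul (s1 phi) (s1 phi)) (EMul (s2 phi) (s2 phi)))
              (EAdd (EMul (s3 phi) (s3 phi)) (EMul (s4 phi) (s4 phi)))) q).

Lemma ok3_hopf phi z : ok4 phi z -> ev (sqnorm4 phi) z != 0 -> ok3 (hopf3 phi) z.
Proof. by case=> ? ? ? ? ?; do !split. Qed.

(** Each half of the Lax pair expresses one partial derivative of the spinor through the other, and
    the same half of the relation follows by substitution into the quotient [hopf3]. *)
Lemma lax_baecklund r k u phi z : ok4 phi z -> ev (sqnorm4 phi) z != 0 ->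
  lax r k u phi z -> baecklund r k u (hopf3 phi) z.
Proof.
case: phi => [[[a b] c] d] [/= oa ob oc od] q0.
rewrite /lax /eq4 /=.
rewrite /baecklund /eq3 /= /Dx /Dy /= -!/(Dx _) -!/(Dy _).
move=> [X Y]; split; [case: X => -> -> -> -> {Y}|case: Y => -> -> -> -> {X}];
 by split; field.
Qed.

(* The real part r1 of the first spectral parameter enters as a displacement by
   r1 n, its imaginary part k1 only shifts k2. *)
Definition dress r1 k1 r2 k2 n phi : spinor :=
  add4 (cscale4 r2 (k2 - k1) phi) (cscale4 (- r1) 0 (pauli n phi)).

Definition dot3 u n := EAdd (EAdd (EMul (c1 u) (c1 n)) (EMul (c2 u) (c2 n)))
  (EMul (c3 u) (c3 n)).

Lemma ok4_dress r1 k1 r2 k2 n phi z : ok3 n z -> ok4 phi z ->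
  ok4 (dress r1 k1 r2 k2 n phi) z.
Proof. by case=> ? ? ? [*]; do !split. Qed.

(** The Darboux matrix m2 - i k1 - r1 n.sigma intertwines the two Lax pairs. Substitution leaves
    components of the spinor times r1^2 n.n_x, or r1^2 n.n_y, and these scalar products vanish by
    assumption. *)
Lemma dress_lax r1 k1 r2 k2 u n phi z :
  ev (dot3 n (Dx3 n)) z = 0 -> ev (dot3 n (Dy3 n)) z = 0 ->
  baecklund r1 k1 u n z -> lax r2 k2 u phi z ->
  lax r2 k2 (add3 u (scale3 (- r1) n)) (dress r1 k1 r2 k2 n phi) z.
Proof.
case: phi => [[[a b] c] d]; case: u => [[u1 u2] u3]; case: n => [[n1 n2] n3].
have comb (x y g h : R) : x = 0 -> g - h = y * x -> g = h.
  by move=> ->; rewrite mulr0 => /eqP; rewrite subr_eq0 => /eqP.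
rewrite /lax /baecklund /eq4 /eq3 /= => hx hy [].
rewrite /Dx /Dy /= -!/(Dx _) -!/(Dy _).
move=> Nx Ny [Px Py]; split.
- move: Nx Px => [-> -> ->] [-> -> -> ->]; split;
    [apply: (comb _ (- r1 ^+ 2 * ev b z)) hx _|apply: (comb _ (r1 ^+ 2 * ev a z)) hx _
    |apply: (comb _ (- r1 ^+ 2 * ev d z)) hx _|apply: (comb _ (r1 ^+ 2 * ev c z)) hx _]; ring.
- move: Ny Py => [-> -> ->] [-> -> -> ->]; split;
    [apply: (comb _ (r1 ^+ 2 * ev b z)) hy _|apply: (comb _ (- r1 ^+ 2 * ev a z)) hy _
    |apply: (comb _ (r1 ^+ 2 * ev d z)) hy _|apply: (comb _ (- r1 ^+ 2 * ev c z)) hy _]; ring.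
Qed.

Lemma hopf3_orth phi z : ok4 phi z -> ev (sqnorm4 phi) z != 0 ->
  ev (dot3 (hopf3 phi) (Dx3 (hopf3 phi))) z = 0 /\
  ev (dot3 (hopf3 phi) (Dy3 (hopf3 phi))) z = 0.
Proof.
case: phi => [[[a b] c] d] [/= oa ob oc od] q0.
by rewrite /Dx /Dy /= -!/(Dx _) -!/(Dy _); split; field.
Qed.
End Spinors.

(** * Holomorphic potentials, vacuum waves and the two-soliton *)

Section Soliton.
Variable R : realType.
Notation spinor := (ex R * ex R * ex R * ex R)%type.
Implicit Types (f g : ex R * ex R) (phi psi : spinor) (z : R * R).

Notation s1 p := p.1.1.1.
Notation s2 p := p.1.1.2.
Notation s3 p := p.1.2.
Notation s4 p := p.2.

Definition cev f z : R[i] := Complex (ev f.1 z) (ev f.2 z).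
Definition ok2 f z := ok f.1 z /\ ok f.2 z.
Definition cauchy_riemann f z :=
  ev (Dx f.1) z = ev (Dy f.2) z /\ ev (Dx f.2) z = - ev (Dy f.1) z.

Definition holo f z := ok2 f z /\ cauchy_riemann f z.

Definition cC (c : R[i]) : ex R * ex R := (EC (complex.Re c), EC (complex.Im c)).
Definition cadd f g := (EAdd f.1 g.1, EAdd f.2 g.2).
Definition cmul f g :=
  (ESub (EMul f.1 g.1) (EMul f.2 g.2), EAdd (EMul f.1 g.2) (EMul f.2 g.1)).

Lemma holo_C c z : holo (cC c) z.
Proof. by do !split; rewrite //= oppr0. Qed.

Lemma holo_add f g z : holo f z -> holo g z -> holo (cadd f g) z.
Proof.
case=> [[? ?] [h1 h2]] [[? ?] [h3 h4]]; do !split => //.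
  by rewrite /= -!/(Dx _) -!/(Dy _) h1 h3.
by rewrite /= -!/(Dx _) -!/(Dy _) h2 h4 opprD.
Qed.

Lemma holo_mul f g z : holo f z -> holo g z -> holo (cmul f g) z.
Proof.
case=> [[? ?] [h1 h2]] [[? ?] [h3 h4]]; do !split => //.
  by rewrite /= /Dx /Dy /= -!/(Dx _) -!/(Dy _) h1 h2 h3 h4; ring.
by rewrite /= /Dx /Dy /= -!/(Dx _) -!/(Dy _) h1 h2 h3 h4; ring.
Qed.

Lemma cev_C c z : cev (cC c) z = c. Proof. by case: c. Qed.
Lemma cev_add f g z : cev (cadd f g) z = cev f z + cev g z.
Proof. by []. Qed.
Lemma cev_mul f g z : cev (cmul f g) z = cev f z * cev g z.
Proof. by rewrite /cev /= mulN1r. Qed.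

Lemma holo_harmonic (A : set (R * R)) f z : open A ->
  (forall y, A y -> holo f y) -> A z ->
  ev (Dx (Dx f.1)) z + ev (Dy (Dy f.1)) z = 0 /\
  ev (Dx (Dx f.2)) z + ev (Dy (Dy f.2)) z = 0.
Proof.
move=> oA H Az; have [[ok1 ok2] _] := H _ Az.
have K1 y (Ay : A y) : [/\ ok (Dx f.1) y, ok (Dy f.2) y & ev (Dx f.1) y = ev (Dy f.2) y].
  by case: (H y Ay) => -[w1 w2] [e1 _]; split => //; [exact: ok_Dx|exact: ok_Dy].
have K2 y (Ay : A y) : [/\ ok (Dx f.2) y, ok (EOpp (Dy f.1)) y &
    ev (Dx f.2) y = ev (EOpp (Dy f.1)) y].
  case: (H y Ay) => -[w1 w2] [_ e2]; split; first exact: ok_Dx.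
    by split => //; exact: ok_Dy.
  by rewrite e2 /= mulN1r.
have [E1 E2] := ev_der_ext oA K1 Az.
have [E3 E4] := ev_der_ext oA K2 Az.
move: E3 E4; rewrite /Dx /Dy /= -!/(Dx _) -!/(Dy _) => E3 E4.
rewrite E1 E3 (DxDyC ok2) -E2 E4 (DxDyC ok1); split; ring.
Qed.

Definition vacuum3 f : ex R * ex R * ex R := (EC 0, EC 0, EMul (EC 2) f.1).

Definition cinv (r k : R) : R * R :=
  (r / (r ^+ 2 + k ^+ 2), - k / (r ^+ 2 + k ^+ 2)).

(* f / (m - 1) + conj f / (m + 1) with m = r + i k. *)
Definition phase (r k : R) f : ex R * ex R :=
  let a := cinv (r - 1) k in let b := cinv (r + 1) k in
  (EAdd (EMul (EC (a.1 + b.1)) f.1) (EMul (EC (b.2 - a.2)) f.2),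
   EAdd (EMul (EC (a.1 - b.1)) f.2) (EMul (EC (a.2 + b.2)) f.1)).

(** The spinor with complex components e^s and e^-s. *)
Definition wave4 (s : ex R * ex R) : spinor :=
  let e := EExp s.1 in let e' := EExp (EOpp s.1) in
  (EMul e (ECos s.2), EMul e (ESin s.2),
   EMul e' (ECos s.2), EOpp (EMul e' (ESin s.2))).

Lemma ok_phase r k f z : ok2 f z -> ok2 (phase r k f) z.
Proof. by case. Qed.

Lemma ok4_wave s z : ok2 s z -> ok4 (wave4 s) z.
Proof. by case=> ? ?; do !split. Qed.

Lemma vacuum_H (A : set (R * R)) f : open A -> (forall y, A y -> holo f y) ->
  forall z, A z -> H_system3 (vacuum3 f) z.
Proof.
move=> oA H z Az; have [h _] := holo_harmonic oA H Az.
rewrite /H_system3 /eq3 /Dx /Dy /= -!/(Dx _) -!/(Dy _); split; try by ring.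
have comb (x a b : R) : x = 0 -> a - b = 2 * x -> a = b.
  by move=> ->; rewrite mulr0 => /subr0_eq.
by apply: comb h _; ring.
Qed.

(** The Pauli matrix of the vacuum is diagonal, so the Lax pair splits into scalar equations. The
    phase s solves them because m s_x + i s_y = f' + conj f'. *)
Lemma wave_lax r k f z : (r - 1) ^+ 2 + k ^+ 2 != 0 -> (r + 1) ^+ 2 + k ^+ 2 != 0 ->
  holo f z -> lax r k (vacuum3 f) (wave4 (phase r k f)) z.
Proof.
move=> p1 p2 [_ [h1 h2]]; rewrite /lax /eq4 /Dx /Dy /=.
rewrite -!/(Dx _) -!/(Dy _) h1 h2.
move: (ev (Dy f.1) z) (ev (Dy f.2) z) => y1 y2.
move: (expR _) (expR _) (cos _) (sin _) => e e' c s.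
by split; split; field; rewrite p1 p2.
Qed.

Lemma sqnorm_wave_gt0 s z : 0 < ev (sqnorm4 (wave4 s)) z.
Proof.
have -> : ev (sqnorm4 (wave4 s)) z = expR (ev s.1 z) ^+ 2 + expR (- ev s.1 z) ^+ 2.
  have := cos2Dsin2 (ev s.2 z); rewrite /= !mulN1r.
  move: (expR _) (expR _) (cos _) (sin _) => e e' c d cd.
  rewrite -[RHS]mulr1 -cd; ring.
by rewrite addr_gt0 // exprn_gt0 // expR_gt0.
Qed.

(** Squared modulus of the wedge product of two spinors. Together with that of the Hermitian
    product, defined next, it adds up to the product of the squared norms (Lagrange's identity). *)
Definition wedge_sq (phi psi : spinor) z :=
  (ev (s1 phi) z * ev (s3 psi) z - ev (s2 phi) z * ev (s4 psi) z
   - ev (s3 phi) z * ev (s1 psi) z + ev (s4 phi) z * ev (s2 psi) z) ^+ 2 +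
  (ev (s1 phi) z * ev (s4 psi) z + ev (s2 phi) z * ev (s3 psi) z
   - ev (s3 phi) z * ev (s2 psi) z - ev (s4 phi) z * ev (s1 psi) z) ^+ 2.
Definition inner_sq (phi psi : spinor) z :=
  (ev (s1 phi) z * ev (s1 psi) z + ev (s2 phi) z * ev (s2 psi) z
   + ev (s3 phi) z * ev (s3 psi) z + ev (s4 phi) z * ev (s4 psi) z) ^+ 2 +
  (ev (s1 phi) z * ev (s2 psi) z - ev (s2 phi) z * ev (s1 psi) z
   + ev (s3 phi) z * ev (s4 psi) z - ev (s4 phi) z * ev (s3 psi) z) ^+ 2.

(** The matrix n.sigma is 1 on [psi] and -1 on its orthogonal complement, so dressing multiplies
    these two components of [phi] by m2 - m1 and m2 + conj m1. *)
Lemma sqnorm_dress r1 k1 r2 k2 psi phi z : ev (sqnorm4 psi) z != 0 ->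
  ev (sqnorm4 (dress r1 k1 r2 k2 (hopf3 psi) phi)) z * ev (sqnorm4 psi) z =
  ((r1 + r2) ^+ 2 + (k2 - k1) ^+ 2) * wedge_sq psi phi z +
  ((r2 - r1) ^+ 2 + (k2 - k1) ^+ 2) * inner_sq psi phi z.
Proof.
rewrite /wedge_sq /inner_sq.
case: psi => [[[a b] c] d]; case: phi => [[[a' b'] c'] d'] /= q0.
by field.
Qed.

(** Keeps the second Hopf image free of poles: both weights in [sqnorm_dress] are positive, and by
    Lagrange's identity wedge and inner product do not vanish together. *)
Lemma sqnorm_dress_gt0 r1 k1 r2 k2 psi phi z :
  0 < r1 -> 0 < r2 -> 0 < (r2 - r1) ^+ 2 + (k2 - k1) ^+ 2 ->
  0 < ev (sqnorm4 psi) z -> 0 < ev (sqnorm4 phi) z ->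
  0 < ev (sqnorm4 (dress r1 k1 r2 k2 (hopf3 psi) phi)) z.
Proof.
move=> r1p r2p m12 p0 q0; rewrite -(pmulr_lgt0 _ p0) sqnorm_dress ?gt_eqF //.
have w0 : 0 <= wedge_sq psi phi z by rewrite addr_ge0 // sqr_ge0.
have i0 : 0 <= inner_sq psi phi z by rewrite addr_ge0 // sqr_ge0.
have c0 : 0 < (r1 + r2) ^+ 2 + (k2 - k1) ^+ 2.
  by rewrite ltr_wpDr ?sqr_ge0 // exprn_gt0 // addr_gt0.
have E : wedge_sq psi phi z + inner_sq psi phi z =
   ev (sqnorm4 psi) z * ev (sqnorm4 phi) z.
  rewrite /wedge_sq /inner_sq /=; ring.
have : 0 < wedge_sq psi phi z + inner_sq psi phi z by rewrite E mulr_gt0.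
move: w0 i0; rewrite le_eqVlt => /orP[/eqP <-|w0] i0.
  by rewrite add0r mulr0 add0r => ?; rewrite mulr_gt0.
by move=> _; rewrite ltr_wpDr ?mulr_ge0 ?mulr_gt0 // ltW.
Qed.

Definition soliton3 r1 k1 r2 k2 f :=
  let n1 := hopf3 (wave4 (phase r1 k1 f)) in
  let n2 := hopf3 (dress r1 k1 r2 k2 n1 (wave4 (phase r2 k2 f))) in
  add3 (add3 (vacuum3 f) (scale3 (- r1) n1)) (scale3 (- r2) n2).

(** Two Baecklund steps; the spinor of the second one is the vacuum wave for m2 carried through the
    first dressing. *)
Lemma soliton_ok_H (A : set (R * R)) r1 k1 r2 k2 f : open A ->
  (forall y, A y -> holo f y) -> 0 < r1 -> 0 < r2 ->
  (r1 - 1) ^+ 2 + k1 ^+ 2 != 0 -> (r2 - 1) ^+ 2 + k2 ^+ 2 != 0 ->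
  0 < (r2 - r1) ^+ 2 + (k2 - k1) ^+ 2 ->
  forall z, A z -> ok3 (soliton3 r1 k1 r2 k2 f) z /\
                   H_system3 (soliton3 r1 k1 r2 k2 f) z.
Proof.
move=> oA Hf r1p r2p m1 m2 m12.
have pos (r k : R) : 0 < r -> (r + 1) ^+ 2 + k ^+ 2 != 0.
  by move=> r0; rewrite gt_eqF // ltr_wpDr ?sqr_ge0 // exprn_gt0 // addr_gt0.
have okw r k y : A y -> ok4 (wave4 (phase r k f)) y.
  by move=> /Hf [/(ok_phase r k)/ok4_wave].
set p1 := wave4 (phase r1 k1 f); set p2 := wave4 (phase r2 k2 f).
have p1pos y : 0 < ev (sqnorm4 p1) y by exact: sqnorm_wave_gt0.
have p2pos y : 0 < ev (sqnorm4 p2) y by exact: sqnorm_wave_gt0.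
have okn1 y : A y -> ok3 (hopf3 p1) y.
  by move=> Ay; apply: ok3_hopf; [exact: okw|rewrite gt_eqF].
set p3 := dress r1 k1 r2 k2 (hopf3 p1) p2.
have okp3 y : A y -> ok4 p3 y.
  by move=> Ay; apply: ok4_dress; [exact: okn1|exact: okw].
have p3pos y : 0 < ev (sqnorm4 p3) y by exact: sqnorm_dress_gt0.
have okn2 y : A y -> ok3 (hopf3 p3) y.
  by move=> Ay; apply: ok3_hopf; [exact: okp3|rewrite gt_eqF].
have okv y : A y -> ok3 (vacuum3 f) y by move=> /Hf [[? ?] _].
have B1 y : A y -> baecklund r1 k1 (vacuum3 f) (hopf3 p1) y.
  move=> Ay; apply: lax_baecklund; [exact: okw|by rewrite gt_eqF|].
  by apply: wave_lax; [|exact: pos|exact: Hf].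
have ok1 y : A y -> ok3 (add3 (vacuum3 f) (scale3 (- r1) (hopf3 p1))) y.
  by move=> Ay; apply: ok3_add; [exact: okv|apply: ok3_scale; exact: okn1].
have H1 y : A y -> H_system3 (add3 (vacuum3 f) (scale3 (- r1) (hopf3 p1))) y.
  move: y; apply: (baecklund_H (k := k1) oA); last exact: vacuum_H.
  by move=> y Ay; split; auto.
have B2 y : A y ->
    baecklund r2 k2 (add3 (vacuum3 f) (scale3 (- r1) (hopf3 p1))) (hopf3 p3) y.
  move=> Ay; apply: lax_baecklund; [exact: okp3|by rewrite gt_eqF|].
  have [w1 w2] := hopf3_orth (okw r1 k1 _ Ay) (lt0r_neq0 (p1pos y)).
  apply: dress_lax => //; first exact: B1.
  by apply: wave_lax; [|exact: pos|exact: Hf].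
move=> z Az; split.
  by apply: ok3_add; [exact: ok1|apply: ok3_scale; exact: okn2].
move: z Az; apply: (baecklund_H (k := k2) oA); last exact: H1.
by move=> y Ay; split; auto.
Qed.
End Soliton.

(** * From expressions to maps of the plane *)

Section Semantics.
Variable R : realType.
Notation ex3 := (ex R * ex R * ex R)%type.
Implicit Types (u : ex3) (f : R * R -> 'cV[R]_3) (A : set (R * R)).

Definition ev3 u z : 'cV[R]_3 := col3 (ev u.1.1 z) (ev u.1.2 z) (ev u.2 z).

Lemma col3_eqP (a b c a' b' c' : R) :
  a = a' -> b = b' -> c = c' -> col3 a b c = col3 a' b' c'.
Proof. by move=> -> -> ->. Qed.

Lemma ord3P (P : 'I_3 -> Prop) :
  P (inord 0) -> P (inord 1) -> P (inord 2) -> forall i, P i.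
Proof.
move=> h0 h1 h2 i; have -> : i = inord i by rewrite inord_val.
by case: i => -[|[|[|//]]].
Qed.

Lemma col3E (a b c : R) : (col3 a b c (inord 0) 0 = a) *
  (col3 a b c (inord 1) 0 = b) * (col3 a b c (inord 2) 0 = c).
Proof. by rewrite !mxE !inordK. Qed.

Lemma cV3P (v w : 'cV[R]_3) : v (inord 0) 0 = w (inord 0) 0 ->
  v (inord 1) 0 = w (inord 1) 0 -> v (inord 2) 0 = w (inord 2) 0 -> v = w.
Proof.
move=> h0 h1 h2; apply/matrixP => i j; rewrite (ord1 j).
by move: i; exact: ord3P.
Qed.

Lemma sum3E (F : 'I_3 -> R) :
  \sum_i F i = F (inord 0) + F (inord 1) + F (inord 2).
Proof.
rewrite !big_ord_recr big_ord0 /= add0r.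
by congr (F _ + F _ + F _); apply/val_inj; rewrite /= inordK.
Qed.

Lemma derivable_col3 (V : normedModType R) (a b c : V -> R) z v :
  derivable a z v -> derivable b z v -> derivable c z v ->
  derivable (fun y => col3 (a y) (b y) (c y)) z v.
Proof.
move=> ha hb hc; apply/derivable_mxP => i j; rewrite (ord1 j); move: i.
by apply: ord3P; under eq_fun do rewrite col3E; [exact: ha|exact: hb|exact: hc].
Qed.

Lemma is_derive_col3 (a b c : R * R -> R) z v da db dc :
  is_derive z v a da -> is_derive z v b db -> is_derive z v c dc ->
  is_derive z v (fun y => col3 (a y) (b y) (c y)) (col3 da db dc).
Proof.
move=> [a1 a2] [b1 b2] [c1 c2].
split; first exact: derivable_col3.
 rewrite derive_mx; last exact: derivable_col3.
apply: cV3P; rewrite mxE;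
  by under eq_fun do rewrite col3E; rewrite ?(a2, b2, c2) col3E.
Qed.

Lemma continuous_col3 (a b c : R * R -> R) z :
  {for z, continuous a} -> {for z, continuous b} -> {for z, continuous c} ->
  {for z, continuous (fun y => col3 (a y) (b y) (c y))}.
Proof.
move=> ha hb hc.
pose e (i : 'I_3) := delta_mx i 0 : 'cV[R]_3.
have E (x y w : R) : col3 x y w =
    x *: e (inord 0) + y *: e (inord 1) + w *: e (inord 2).
  by apply: cV3P; rewrite !mxE !inordK //= -!val_eqE /= !inordK //=
    ?mulr1 ?mulr0 ?addr0 ?add0r.
have -> : (fun y => col3 (a y) (b y) (c y)) = (fun y =>
    a y *: e (inord 0) + b y *: e (inord 1) + c y *: e (inord 2)).
  by apply/funext => y; rewrite E.
by apply: cvgD; first apply: cvgD; apply: cvgZl.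
Qed.

Lemma ev3_derive u z v : ok3 u z ->
  is_derive z v (ev3 u) (ev3 (der (EC v.1) (EC v.2) u.1.1,
    der (EC v.1) (EC v.2) u.1.2, der (EC v.1) (EC v.2) u.2) z).
Proof.
by case: v => v1 v2 [h1 h2 h3]; apply: is_derive_col3; exact: is_derive_ev_line.
Qed.

Lemma ev3_continuous u z : ok3 u z -> {for z, continuous (ev3 u)}.
Proof. by case=> h1 h2 h3; apply: continuous_col3; exact: continuous_ev. Qed.

(** On an open set a representation passes to the derivatives; on the closed disk and on the circle
    it still gives continuity up to the boundary and smoothness in the angle. *)
Definition represents A f u := forall z, A z -> ok3 u z /\ f z = ev3 u z.

Lemma represents_is_derive A f u z v : open A -> represents A f u -> A z ->
  is_derive z v f (ev3 (der (EC v.1) (EC v.2) u.1.1,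
    der (EC v.1) (EC v.2) u.1.2, der (EC v.1) (EC v.2) u.2) z).
Proof.
move=> oA H Az; apply: near_eq_is_derive (ev3_derive _ (H _ Az).1).
have : nbhs z A by exact: open_nbhs_nbhs.
by apply: filterS => y /H [].
Qed.

Lemma represents_dx A f u : open A -> represents A f u -> represents A (dx f) (Dx3 u).
Proof.
move=> oA H z Az; split; first by apply: ok3_Dx; case: (H _ Az).
exact: (derive_val (is_derive := represents_is_derive (1, 0) oA H Az)).
Qed.

Lemma represents_dy A f u : open A -> represents A f u -> represents A (dy f) (Dy3 u).
Proof.
move=> oA H z Az; split; first by apply: ok3_Dy; case: (H _ Az).
exact: (derive_val (is_derive := represents_is_derive (0, 1) oA H Az)).
Qed.

Lemma represents_continuous A f u z : open A -> represents A f u -> A z ->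
  {for z, continuous f}.
Proof.
move=> oA H Az; have [oz fz] := H _ Az.
rewrite /prop_for /continuous_at fz; apply: cvg_trans (ev3_continuous oz).
apply: near_eq_cvg; have : nbhs z A by exact: open_nbhs_nbhs.
by apply: filterS => y /H [_ ->].
Qed.

Lemma represents_C1 A f u : open A -> represents A f u -> C1_on A f.
Proof.
move=> oA H; split => z Az; split.
- exact: (ex_derive (is_derive := represents_is_derive (1, 0) oA H Az)).
- exact: (ex_derive (is_derive := represents_is_derive (0, 1) oA H Az)).
- exact: represents_continuous (represents_dx oA H) Az.
- exact: represents_continuous (represents_dy oA H) Az.
Qed.

Lemma represents_C2 A f u : open A -> represents A f u -> C2_on A f.
Proof.
move=> oA H; split; first exact: represents_C1 H.
- exact: represents_C1 (represents_dx oA H).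
- exact: represents_C1 (represents_dy oA H).
Qed.

Lemma represents_laplacian A f u z : open A -> represents A f u -> A z ->
  laplacian f z = ev3 (add3 (Dx3 (Dx3 u)) (Dy3 (Dy3 u))) z.
Proof.
move=> oA H Az; rewrite /laplacian.
have [_ ->] := represents_dx oA (represents_dx oA H) Az.
have [_ ->] := represents_dy oA (represents_dy oA H) Az.
by apply: cV3P; rewrite [LHS]mxE !col3E.
Qed.

Lemma represents_H A f u z : open A -> represents A f u -> A z ->
  H_system3 u z -> laplacian f z = 2 *: cross (dx f z) (dy f z).
Proof.
move=> oA H Az [e1 e2 e3]; rewrite (represents_laplacian oA H Az).
have [_ ->] := represents_dx oA H Az; have [_ ->] := represents_dy oA H Az.
rewrite /cross !col3E.
by apply: cV3P; rewrite [RHS]mxE !col3E ?(e1, e2, e3) /= mulN1r.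
Qed.

Lemma represents_continuous_closed (A : set (R * R)) f u : represents A f u ->
  {within A, continuous f}.
Proof.
move=> H; apply/subspace_continuousP => z Az.
have [oz fz] := H _ Az.
suff : f x @[x --> within A (nbhs z)] --> f z by [].
have h : ev3 u x @[x --> within A (nbhs z)] --> ev3 u z.
  by apply: cvg_within_filter; exact: ev3_continuous.
rewrite fz; apply: cvg_trans h.
apply: near_eq_cvg; have W := withinT A (nbhs_filter z).
by apply: filterS W => y /H [_ ->].
Qed.

Lemma circle_ptP (t : R) : circle (circle_pt t).
Proof. by rewrite /circle /= /sqn2 /dot2 /= -!expr2 cos2Dsin2. Qed.

Lemma derive1n_circle (e : ex R) (m : nat) :
  (forall z, circle z -> ok e z) ->
  exists2 e', (forall z, circle z -> ok e' z) &
    derive1n m (fun t => ev e (circle_pt t)) = (fun t => ev e' (circle_pt t)).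
Proof.
move=> oke; elim: m => [|m [e' ok' E]]; first by exists e.
(* The angular derivative is the derivative along the rotation field [(-y, x)], so all iterates
   remain expressions. *)
exists (der (EOpp (@EY R)) (@EX R) e').
  by move=> z cz; apply: ok_der => //; exact: ok'.
apply/funext => t; rewrite derive1nS E derive1E.
have ct := circle_ptP t.
apply: (derive_val (is_derive := _)).
apply: is_derive_ev; last exact: ok'.
by apply: is_derive_eq; rewrite /= mulN1r.
Qed.

Lemma smooth_ev (e : ex R) (m : nat) (t : R) :
  (forall z, circle z -> ok e z) ->
  derivable (derive1n m (fun t => ev e (circle_pt t))) t 1.
Proof.
move=> oke; have [e' ok' ->] := derive1n_circle m oke.
have ct := circle_ptP t.
suff D : is_derive t 1 (fun t => ev e' (circle_pt t))
   (ev (der (EOpp (@EY R)) (@EX R) e') (circle_pt t)) by exact: ex_derive.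
apply: is_derive_ev; last exact: ok'.
by apply: is_derive_eq; rewrite /= mulN1r.
Qed.

Lemma derive1n_col3 (a b c : R -> R) (m : nat) :
  (forall m t, derivable (derive1n m a) t 1) ->
  (forall m t, derivable (derive1n m b) t 1) ->
  (forall m t, derivable (derive1n m c) t 1) ->
  derive1n m (fun t => col3 (a t) (b t) (c t)) =
  fun t => col3 (derive1n m a t) (derive1n m b t) (derive1n m c t).
Proof.
move=> ha hb hc; elim: m => // m IH; rewrite derive1nS IH.
apply/funext => t; rewrite derive1E derive_mx; last exact: derivable_col3.
by apply: cV3P; rewrite mxE; under eq_fun do rewrite col3E; rewrite col3E derive1nS derive1E.
Qed.

Lemma represents_smooth f u : represents (@circle R) f u -> smooth_on_circle f.
Proof.
move=> H m t.
have -> : f \o @circle_pt R = fun t => col3 (ev u.1.1 (circle_pt t))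
    (ev u.1.2 (circle_pt t)) (ev u.2 (circle_pt t)).
  apply/funext => s; by rewrite /= (H _ (circle_ptP _)).2.
have h1 k s : derivable (derive1n k (fun t => ev u.1.1 (circle_pt t))) s 1.
  by apply: smooth_ev => z /H [[]].
have h2 k s : derivable (derive1n k (fun t => ev u.1.2 (circle_pt t))) s 1.
  by apply: smooth_ev => z /H [[]].
have h3 k s : derivable (derive1n k (fun t => ev u.2 (circle_pt t))) s 1.
  by apply: smooth_ev => z /H [[]].
by rewrite derive1n_col3 //; apply: derivable_col3.
Qed.
End Semantics.

(** * Limits of complex valued functions *)

Section ComplexLimits.
Variable R : realType.
Local Open Scope complex_scope.
Local Notation "x ^*" := (conjc x) : ring_scope.
Local Notation C := R[i].
Local Notation Re := complex.Re.
Local Notation Im := complex.Im.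

Lemma ReM (x y : C) : Re (x * y) = Re x * Re y - Im x * Im y.
Proof. by case: x y => a b [c d]. Qed.
Lemma ImM (x y : C) : Im (x * y) = Re x * Im y + Im x * Re y.
Proof. by case: x y => a b [c d]. Qed.
Lemma ReD (x y : C) : Re (x + y) = Re x + Re y.
Proof. by case: x y => a b [c d]. Qed.
Lemma ImD (x y : C) : Im (x + y) = Im x + Im y.
Proof. by case: x y => a b [c d]. Qed.
Lemma ReN (x : C) : Re (- x) = - Re x. Proof. by case: x. Qed.
Lemma ImN (x : C) : Im (- x) = - Im x. Proof. by case: x. Qed.
Lemma ReJ (x : C) : Re x^* = Re x. Proof. by case: x. Qed.
Lemma ImJ (x : C) : Im x^* = - Im x. Proof. by case: x. Qed.

Lemma eqcP (x y : C) : Re x = Re y -> Im x = Im y -> x = y.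
Proof. by case: x y => a b [c d] /= -> ->. Qed.

Definition nsq (x : C) : R := Re x ^+ 2 + Im x ^+ 2.

Lemma nsq_ge0 x : 0 <= nsq x. Proof. by rewrite addr_ge0 // sqr_ge0. Qed.
Lemma nsqM x y : nsq (x * y) = nsq x * nsq y.
Proof. by rewrite /nsq ReM ImM; ring. Qed.
Lemma nsqN x : nsq (- x) = nsq x. Proof. by rewrite /nsq ReN ImN !sqrrN. Qed.
Lemma nsqJ x : nsq x^* = nsq x. Proof. by rewrite /nsq ReJ ImJ sqrrN. Qed.
Lemma nsq_eq0 x : (nsq x == 0) = (x == 0).
Proof.
apply/idP/eqP => [|->]; last by rewrite /nsq /= expr0n /= addr0.
by rewrite paddr_eq0 ?sqr_ge0 // !sqrf_eq0 => /andP[/eqP ? /eqP ?]; apply: eqcP.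
Qed.
Lemma sq_sum_eq0 (a b : R) : a ^+ 2 + b ^+ 2 = 0 -> a = 0 /\ b = 0.
Proof.
by move=> /eqP; rewrite paddr_eq0 ?sqr_ge0 // !sqrf_eq0 => /andP[/eqP ? /eqP ?].
Qed.
Lemma nsq_gt0 x : (0 < nsq x) = (x != 0).
Proof. by rewrite lt_neqAle nsq_ge0 andbT eq_sym nsq_eq0. Qed.
Lemma nsq_real (a : R) : nsq a%:C = a ^+ 2.
Proof. by rewrite /nsq /= expr0n /= addr0. Qed.
Lemma mulcJ x : x * x^* = (nsq x)%:C.
Proof. by apply: eqcP; rewrite ?ReM ?ImM ReJ ImJ /nsq /=; ring. Qed.
Lemma invcE x : x^-1 = (nsq x)^-1%:C * x^*.
Proof.
have [->|x0] := eqVneq x 0; first by rewrite invr0; apply: eqcP;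
  rewrite ?ReM ?ImM ReJ ImJ /= !(mulr0, mul0r, oppr0, subr0, addr0).
apply: (mulfI x0); rewrite divff // mulrCA mulcJ -rmorphM /= mulVf //.
by rewrite nsq_eq0.
Qed.

Section Filter.
Context {T : Type} (F : set_system T) {FF : Filter F}.
Implicit Types f g : T -> C.

(** Componentwise, to match the real and imaginary parts delivered by [ev]. *)
Definition ccvg f (l : C) :=
  (Re (f t) @[t --> F] --> Re l) /\ (Im (f t) @[t --> F] --> Im l).

Lemma ccvg_cst l : ccvg (fun=> l) l. Proof. by split; exact: cvg_cst. Qed.

Lemma ccvgD f g l m : ccvg f l -> ccvg g m -> ccvg (fun t => f t + g t) (l + m).
Proof.
move=> [f1 f2] [g1 g2]; rewrite /ccvg ReD ImD.
under eq_fun do rewrite ReD.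
under [X in _ /\ (X @ _ --> _)]eq_fun do rewrite ImD.
by split; exact: cvgD.
Qed.

Lemma ccvgM f g l m : ccvg f l -> ccvg g m -> ccvg (fun t => f t * g t) (l * m).
Proof.
move=> [f1 f2] [g1 g2]; rewrite /ccvg ReM ImM.
under eq_fun do rewrite ReM.
under [X in _ /\ (X @ _ --> _)]eq_fun do rewrite ImM.
by split; [apply: cvgB|apply: cvgD]; exact: cvgM.
Qed.

Lemma ccvgN f l : ccvg f l -> ccvg (fun t => - f t) (- l).
Proof.
move=> [f1 f2]; rewrite /ccvg ReN ImN.
under eq_fun do rewrite ReN.
under [X in _ /\ (X @ _ --> _)]eq_fun do rewrite ImN.
by split; exact: cvgN.
Qed.

Lemma ccvgB f g l m : ccvg f l -> ccvg g m -> ccvg (fun t => f t - g t) (l - m).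
Proof. by move=> hf hg; apply: ccvgD => //; exact: ccvgN. Qed.

Lemma ccvgJ f l : ccvg f l -> ccvg (fun t => (f t)^*) l^*.
Proof.
move=> [f1 f2]; rewrite /ccvg ReJ ImJ.
under eq_fun do rewrite ReJ.
under [X in _ /\ (X @ _ --> _)]eq_fun do rewrite ImJ.
by split => //; exact: cvgN.
Qed.

Lemma ccvg_real (f : T -> R) (l : R) : f @ F --> l -> ccvg (fun t => (f t)%:C) l%:C.
Proof. by move=> fl; split => //; exact: cvg_cst. Qed.

Lemma ccvg_nsq f l : ccvg f l -> nsq (f t) @[t --> F] --> nsq l.
Proof. by move=> [f1 f2]; apply: cvgD; rewrite !expr2; exact: cvgM. Qed.

Lemma ccvg_neq0 f l : l != 0 -> ccvg f l -> \forall t \near F, f t != 0.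
Proof.
move=> l0 fl; have n0 : 0 < nsq l by rewrite nsq_gt0.
move/ccvg_nsq/cvgrPdist_lt: fl => /(_ _ n0); apply: filterS => t h; apply/eqP => ft.
have nl : nsq (0 : C) = 0 by apply/eqP; rewrite nsq_eq0.
by move: h; rewrite ft nl subr0 gtr0_norm // ltxx.
Qed.

Lemma ccvgV f l : l != 0 -> ccvg f l -> ccvg (fun t => (f t)^-1) l^-1.
Proof.
move=> l0 fl; rewrite invcE; under eq_fun do rewrite invcE.
apply: ccvgM; last exact: ccvgJ.
by apply: ccvg_real; apply: cvgV; [rewrite nsq_eq0|exact: ccvg_nsq].
Qed.

Lemma ccvg_near f g l : (\forall t \near F, f t = g t) -> ccvg f l -> ccvg g l.
Proof.
move=> fg [f1 f2]; split.
  by apply: cvg_trans f1; apply: near_eq_cvg; apply: filterS fg => t ->.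
by apply: cvg_trans f2; apply: near_eq_cvg; apply: filterS fg => t ->.
Qed.

Lemma cvg_bounded_mul0 (M : R) (f g : T -> R) :
  (\forall t \near F, `|g t| <= M) -> f @ F --> (0 : R) -> g t * f t @[t --> F] --> (0 : R).
Proof.
move=> gM f0; apply/cvgr0Pnorm_lt => e e0.
have M1 : 0 < `|M| + 1 by rewrite ltr_wpDl.
move/cvgr0Pnorm_lt: f0 => /(_ _ (divr_gt0 e0 M1)) f1.
apply: filterS2 gM f1 => t gt ft; rewrite normrM.
have := normr_ge0 (g t); have := normr_ge0 (f t); move: ft.
rewrite ltr_pdivlMr // => ft p q.
apply: le_lt_trans ft; rewrite mulrC ler_wpM2l //.
by apply: le_trans gt _; rewrite (le_trans (ler_norm _)) // lerDl.
Qed.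

Definition cbounded f :=
  exists M : R, \forall t \near F, `|Re (f t)| <= M /\ `|Im (f t)| <= M.

Lemma ccvg_bounded f l : ccvg f l -> cbounded f.
Proof.
move=> [f1 f2]; exists (`|Re l| + `|Im l| + 1).
move/cvgrPdist_lt: f1 => /(_ _ ltr01) H1.
move/cvgrPdist_lt: f2 => /(_ _ ltr01) H2.
apply: filterS2 H1 H2 => t h1 h2; split.
  have -> : Re (f t) = Re l - (Re l - Re (f t)) by ring.
  apply: le_trans (ler_normB _ _) _; rewrite -addrA lerD2l.
  by apply: le_trans (ltW h1) _; rewrite lerDr.
have -> : Im (f t) = Im l - (Im l - Im (f t)) by ring.
apply: le_trans (ler_normB _ _) _; rewrite addrAC -addrA (addrC `|Im l|) addrA lerD2r.
by apply: le_trans (ltW h2) _; rewrite lerDr.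
Qed.

Lemma ccvg_bounded_mul0 f g : cbounded g -> ccvg f 0 -> ccvg (fun t => g t * f t) 0.
Proof.
move=> [M gM] [f1 f2]; rewrite /ccvg /=.
have g1 : \forall t \near F, `|Re (g t)| <= M by apply: filterS gM => t [].
have g2 : \forall t \near F, `|Im (g t)| <= M by apply: filterS gM => t [].
under eq_fun do rewrite ReM.
under [X in _ /\ (X @ _ --> _)]eq_fun do rewrite ImM.
split.
  by rewrite -[X in _ --> X](subr0 0); apply: cvgB; apply: cvg_bounded_mul0 => //; eassumption.
by rewrite -[X in _ --> X](addr0 0); apply: cvgD; apply: cvg_bounded_mul0 => //; eassumption.
Qed.
End Filter.
End ComplexLimits.

(** * The complex exponential and its difference quotient *)

Section ComplexExponential.
Variable R : realType.
Local Open Scope complex_scope.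
Local Notation "x ^*" := (conjc x) : ring_scope.
Local Notation C := R[i].
Local Notation Re := complex.Re.
Local Notation Im := complex.Im.

Definition cexp (v : C) : C :=
  Complex (expR (Re v) * cos (Im v)) (expR (Re v) * sin (Im v)).

Lemma cexpD v w : cexp (v + w) = cexp v * cexp w.
Proof.
by apply: eqcP; rewrite ?ReM ?ImM /= !(ReD, ImD) expRD ?cosD ?sinD; ring.
Qed.

Lemma cexp0 : cexp 0 = 1.
Proof. by apply: eqcP; rewrite /= expR0 ?cos0 ?sin0 ?mulr1 ?mulr0. Qed.

Lemma nsq_cexp v : nsq (cexp v) = expR (Re v) ^+ 2.
Proof. by rewrite /nsq /= !exprMn -mulrDr cos2Dsin2 mulr1. Qed.

Lemma cexp_neq0 v : cexp v != 0.
Proof. by rewrite -nsq_gt0 nsq_cexp exprn_gt0 // expR_gt0. Qed.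

Lemma cexpNK v : cexp v * cexp (- v) = 1.
Proof. by rewrite -cexpD subrr cexp0. Qed.

Lemma cexpN v : cexp (- v) = (cexp v)^-1.
Proof. by apply: (mulfI (cexp_neq0 v)); rewrite cexpNK divff // cexp_neq0. Qed.

Lemma ccvg_cexp T (F : set_system T) {FF : Filter F} (f : T -> C) l :
  ccvg F f l -> ccvg F (fun t => cexp (f t)) (cexp l).
Proof.
move=> [f1 f2].
have e1 : expR (Re (f t)) @[t --> F] --> expR (Re l).
  by apply: continuous_cvg => //; exact: continuous_expR.
have c1 : cos (Im (f t)) @[t --> F] --> cos (Im l).
  by apply: continuous_cvg => //; exact: continuous_cos.
have s1 : sin (Im (f t)) @[t --> F] --> sin (Im l).
  by apply: continuous_cvg => //; exact: continuous_sin.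
by split; exact: cvgM.
Qed.

(** Once the integer part is removed, 0 <= t < 1 and cos (2 pi t) = 1 force sin (pi t) = 0, whereas
    the sine is positive between 0 and pi. *)
Lemma cos_eq1 (x : R) : cos x = 1 -> exists n : int, x = 2 * pi * n%:~R.
Proof.
move=> cx; pose y := x / (2 * pi); exists (Num.floor y).
have p0 : (0 : R) < pi := pi_gt0 R.
have xy : x = 2 * pi * y by rewrite /y mulrC divfK // gt_eqF // mulr_gt0.
have per (n : int) (t : R) : cos (t + 2 * pi * n%:~R) = cos t.
  have nat_per (m : nat) (s : R) : cos (s + 2 * pi * m%:R) = cos s.
    elim: m => [|m IH]; first by rewrite mulr0 addr0.
    have -> : s + 2 * pi * m.+1%:R = s + 2 * pi * m%:R + pi *+ 2 by ring.
    by rewrite cosD2pi IH.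
  case: (intP n) => [|m|m]; first exact: (nat_per 0%N).
    exact: (nat_per m.+1).
  rewrite -(nat_per m.+1); congr cos; rewrite mulrNz; ring.
set n := Num.floor y; pose t := y - n%:~R.
have t0 : 0 <= t by rewrite subr_ge0 floor_le.
have t1 : t < 1 by have := floorD1_gt y; rewrite intrD -/n /t => h; lra.
have ct : cos (pi * t *+ 2) = 1.
  have -> : pi * t *+ 2 = x + 2 * pi * (- n)%:~R by rewrite xy /t mulrNz; ring.
  by rewrite per.
have s0 : sin (pi * t) = 0.
  move: ct; rewrite cos_mulr2n cos2sin2 => ct; apply/eqP; rewrite -sqrf_eq0; apply/eqP.
  by move: ct; set s := sin _ ^+ 2 => ct; lra.
have [t_gt0|] := ltP 0 t; last first.
  move=> tle; have : t = 0 by apply/eqP; rewrite eq_le tle t0.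
  by rewrite {1}xy /t => /eqP; rewrite subr_eq0 => /eqP ->.
suff : 0 < sin (pi * t) by rewrite s0 ltxx.
by apply: sin_gt0_pi; rewrite mulr_gt0 //= gtr_pMr.
Qed.

Lemma cexp_eq1 v : cexp v = 1 -> exists n : int, v = Complex 0 (2 * pi * n%:~R).
Proof.
move=> ev; have := nsq_cexp v; rewrite ev /nsq /= expr0n /= addr0 expr1n => e1.
have e2 : expR (Re v) = 1.
  by apply/eqP; rewrite -(@eqrXn2 _ 2) ?expR_ge0 ?ler01 // expr1n -e1.
have c1 : cos (Im v) = 1 by move: (congr1 (fun x : C => Re x) ev); rewrite /= e2 mul1r.
have [n En] := cos_eq1 c1; exists n; apply: eqcP => //=.
by apply: expR_inj; rewrite e2 expR0.
Qed.

Lemma cexp_int (n : int) : cexp (Complex 0 (2 * pi * n%:~R)) = 1.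
Proof.
have P (m : nat) : cexp (Complex 0 (2 * pi * m%:R)) = 1.
  elim: m => [|m IH]; first by rewrite mulr0 -[RHS]cexp0.
  have -> : Complex 0 (2 * pi * m.+1%:R) =
     Complex 0 (2 * pi * m%:R) + Complex 0 (pi *+ 2) :> C.
    by apply: eqcP; rewrite /=; ring.
  rewrite cexpD IH mul1r; apply: eqcP; rewrite /= expR0 mul1r ?cos2pi //.
  by rewrite -[pi *+ 2]add0r sinD2pi sin0.
case: (intP n) => [|m|m]; [exact: (P 0%N)|exact: (P m.+1)|].
have -> : Complex 0 (2 * pi * (- (m.+1)%:Z)%:~R) = - Complex 0 (2 * pi * m.+1%:R) :> C.
  by apply: eqcP; rewrite /= ?oppr0 // mulrNz; ring.
by rewrite cexpN P invr1.
Qed.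

(** Here e^(2v) = 1. At an integer value of the potential this makes the two limiting waves
    parallel. *)
Lemma cexp_half_period (n : int) (v : C) : v = pi%:C * 'i * n%:~R -> cexp v = cexp (- v).
Proof.
move=> vE; apply: (mulIf (cexp_neq0 v)); rewrite -!cexpD addNr cexp0.
have -> : v + v = Complex 0 (2 * pi * n%:~R).
  rewrite vE -(rmorph_int (real_complex R)).
  by apply: eqcP; rewrite !(ReD, ImD, ReM, ImM) /=; ring.
exact: cexp_int.
Qed.

(* (e^v - 1) / v with its removable singularity filled in. *)
Definition expquot (v : C) : C := if v == 0 then 1 else (cexp v - 1) / v.

Lemma expquotE v : cexp v - 1 = v * expquot v.
Proof.
rewrite /expquot; case: eqVneq => [->|v0]; first by rewrite cexp0 subrr mul0r.
by rewrite mulrC divfK.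
Qed.

Lemma bounded_quot (a b : R) (c : C) : c = a%:C \/ c = b%:C ->
  `|Re (c / Complex a b)| <= 1 /\ `|Im (c / Complex a b)| <= 1.
Proof.
move=> cE; have [->|v0] := eqVneq (Complex a b) (0 : C).
  by rewrite invr0 mulr0 /= normr0 ler01.
have q0 : 0 < a ^+ 2 + b ^+ 2 by rewrite -[X in 0 < X]/(nsq (Complex a b)) nsq_gt0.
have Ha : a ^+ 2 <= a ^+ 2 + b ^+ 2 by rewrite lerDl sqr_ge0.
have Hb : b ^+ 2 <= a ^+ 2 + b ^+ 2 by rewrite lerDr sqr_ge0.
have Hab : `|a * b| <= a ^+ 2 + b ^+ 2.
  have h1 := sqr_ge0 (a - b); have h2 := sqr_ge0 (a + b).
  by rewrite ler_norml; apply/andP; split; nra.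
have div x : `|x| <= a ^+ 2 + b ^+ 2 -> `|x / (a ^+ 2 + b ^+ 2)| <= 1.
  by move=> h; rewrite normrM normfV (gtr0_norm q0) ler_pdivrMr // mul1r.
have [e1 e2] : Re (Complex a b)^-1 = a / (a ^+ 2 + b ^+ 2) /\
   Im (Complex a b)^-1 = - b / (a ^+ 2 + b ^+ 2).
  by rewrite invcE ReM ImM ReJ ImJ /nsq /=; split; ring.
rewrite ReM ImM e1 e2.
case: cE => -> /=; rewrite !mul0r ?subr0 ?addr0 !mulrA; split; apply: div.
- by rewrite -expr2 ger0_norm ?sqr_ge0.
- by rewrite mulrN normrN.
- by rewrite mulrC.
- by rewrite mulrN normrN -expr2 ger0_norm ?sqr_ge0.
Qed.

(** The Caratheodory factors of exp, cos and sin at 0 write the quotient as 1 plus the bounded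
    ratios Re f / f and Im f / f times null functions. The points where f vanishes are covered by
    the value 1 filled in there. *)
Lemma ccvg_expquot T (F : set_system T) {FF : Filter F} (f : T -> C) :
  ccvg F f 0 -> ccvg F (fun t => expquot (f t)) 1.
Proof.
move=> f0; have [f1 f2] := f0; rewrite /= in f1 f2.
have [gE [hE cE vE]] := (is_derive1_caratheodory _ _ _).1 (is_derive_expR (0 : R)).
have [gC [hC cC vC]] := (is_derive1_caratheodory _ _ _).1 (is_derive_cos (0 : R)).
have [gS [hS cS vS]] := (is_derive1_caratheodory _ _ _).1 (is_derive_sin (0 : R)).
pose A t : C := (gE (Re (f t)) * cos (Im (f t)) - 1)%:C.
pose B t : C := Complex (gC (Im (f t))) (expR (Re (f t)) * gS (Im (f t)) - 1).
have E t : expquot (f t) = 1 + (Re (f t))%:C / f t * A t + (Im (f t))%:C / f t * B t.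
  rewrite /expquot; case: eqVneq => [->|v0]; first by rewrite invr0 !mulr0 !mul0r !addr0.
  apply: (mulfI v0); rewrite mulrC divfK //.
  have -> : f t * (1 + (Re (f t))%:C / f t * A t + (Im (f t))%:C / f t * B t) =
     f t + (Re (f t))%:C * A t + (Im (f t))%:C * B t by field.
  have := hE (Re (f t)); have := hC (Im (f t)); have := hS (Im (f t)).
  rewrite expR0 cos0 sin0 !subr0 => es ec ee.
  apply: eqcP; rewrite !(ReD, ImD, ReN, ImN, ReM, ImM) /=.
    have -> : expR (Re (f t)) = 1 + gE (Re (f t)) * Re (f t) by rewrite -ee; ring.
    rewrite mulrDl mul1r.
    have -> : cos (Im (f t)) = 1 + gC (Im (f t)) * Im (f t) by rewrite -ec; ring.
    ring.
  by rewrite es; ring.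
have Q (g : T -> C) : (forall t, g t = (Re (f t))%:C \/ g t = (Im (f t))%:C) ->
    cbounded F (fun t => g t / f t).
  move=> hg; exists 1; near=> t; have := @bounded_quot (Re (f t)) (Im (f t)) (g t) (hg t).
  by case: (f t).
under eq_fun do rewrite E.
have A0 : ccvg F A 0.
  apply: ccvg_real; rewrite -[X in _ --> X](subrr 1); apply: cvgB; last exact: cvg_cst.
  rewrite -[X in _ --> X](mulr1 1); apply: cvgM.
    by rewrite -[X in _ --> X]expR0 -vE; apply: continuous_cvg.
  by rewrite -[X in _ --> X]cos0; apply: continuous_cvg => //; exact: continuous_cos.
have B0 : ccvg F B 0.
  split => /=.
    by rewrite -[X in _ --> X]oppr0 -[X in - X]sin0 -vC; apply: continuous_cvg.
  rewrite -[X in _ --> X](subrr 1); apply: cvgB; last exact: cvg_cst.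
  rewrite -[X in _ --> X](mulr1 1); apply: cvgM.
    by rewrite -[X in _ --> X]expR0; apply: continuous_cvg => //; exact: continuous_expR.
  by rewrite -[X in _ --> X]cos0 -vS; apply: continuous_cvg.
rewrite -[X in ccvg _ _ X]addr0 -[X in X + 0]addr0; apply: ccvgD; first apply: ccvgD.
- exact: ccvg_cst.
- by apply: ccvg_bounded_mul0 => //; apply: Q => t; left.
- by apply: ccvg_bounded_mul0 => //; apply: Q => t; right.
Unshelve. all: by end_near.
Qed.
End ComplexExponential.

(** * Degeneration of the two-soliton *)

Section HopfMap.
Variable R : realType.
Local Open Scope complex_scope.
Local Notation "x ^*" := (conjc x) : ring_scope.
Local Notation C := R[i].
Local Notation Re := complex.Re.
Local Notation Im := complex.Im.

Lemma norm_coord (v : 'cV[R]_3) i : `|v i 0| <= `|v|.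
Proof. by rewrite [leRHS]mx_normrE; apply: (le_bigmax _ _ (i, 0)). Qed.

Lemma norm_le_coord (v : 'cV[R]_3) (e : R) : 0 <= e ->
  (forall i, `|v i 0| <= e) -> `|v| <= e.
Proof.
move=> e0 h; rewrite [leLHS]mx_normrE; apply: bigmax_le => // -[i j] _ /=.
by rewrite (ord1 j).
Qed.

Definition sq3 (v : 'cV[R]_3) := \sum_i v i 0 ^+ 2.

Lemma sq3_ge0 v : 0 <= sq3 v.
Proof. by apply: sumr_ge0 => i _; exact: sqr_ge0. Qed.

Lemma norm_le_enorm (v : 'cV[R]_3) : `|v| <= enorm v.
Proof.
apply: norm_le_coord => [|i]; first exact: sqrtr_ge0.
rewrite -sqrtr_sqr ler_wsqrtr // (bigD1 i) //= lerDl.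
by apply: sumr_ge0 => j _; exact: sqr_ge0.
Qed.

(** The constant is sqrt 3 rounded up. *)
Lemma enorm_le (v : 'cV[R]_3) : enorm v <= 2 * `|v|.
Proof.
have v0 := normr_ge0 v.
rewrite -[leRHS]ger0_norm ?mulr_ge0 // -sqrtr_sqr ler_wsqrtr //.
have h i : v i 0 ^+ 2 <= `|v| ^+ 2.
  by rewrite -real_normK ?num_real // lerXn2r ?nnegrE ?norm_coord.
rewrite sum3E; have := h (inord 0); have := h (inord 1); have := h (inord 2).
have := sqr_ge0 `|v|; rewrite exprMn; lra.
Qed.

Lemma cvg_sq3_0 T (F : set_system T) {FF : Filter F} (v : T -> 'cV[R]_3) :
  sq3 (v t) @[t --> F] --> (0 : R) -> v @ F --> (0 : 'cV[R]_3).
Proof.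
move=> h; apply/cvgr0Pnorm_lt => e e0.
move/cvgr0Pnorm_lt: h => /(_ _ (exprn_gt0 2 e0)); apply: filterS => t.
rewrite ger0_norm ?sq3_ge0 // => h; apply: le_lt_trans (norm_le_enorm _) _.
rewrite -[ltRHS]ger0_norm ?ltW // -sqrtr_sqr.
by rewrite ltr_sqrt ?exprn_gt0.
Qed.

Lemma subcE (v w : 'cV[R]_3) i : (v - w) i 0 = v i 0 - w i 0.
Proof. by rewrite !mxE. Qed.

Lemma cvg_col3 T (F : set_system T) {FF : Filter F} (a b c : T -> R) (x y z : R) :
  a @ F --> x -> b @ F --> y -> c @ F --> z ->
  col3 (a t) (b t) (c t) @[t --> F] --> col3 x y z.
Proof.
move=> ha hb hc; apply/cvgrPdist_le => e e0.
move/cvgrPdist_le: ha => /(_ _ e0) ha; move/cvgrPdist_le: hb => /(_ _ e0) hb.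
move/cvgrPdist_le: hc => /(_ _ e0) hc; near=> t.
apply: norm_le_coord; first exact: ltW.
by apply: ord3P; rewrite !subcE !col3E; near: t.
Unshelve. all: by end_near.
Qed.

Definition nsq2 (x y : C) : R := nsq x + nsq y.

Definition hopf (x y : C) : 'cV[R]_3 :=
  col3 (2 * Re (x^* * y) / nsq2 x y) (2 * Im (x^* * y) / nsq2 x y)
       ((nsq x - nsq y) / nsq2 x y).

Lemma nsq2_ge0 x y : 0 <= nsq2 x y.
Proof. by rewrite addr_ge0 // nsq_ge0. Qed.

Lemma nsq2_gt0 x y : (0 < nsq2 x y) = (x != 0) || (y != 0).
Proof.
by rewrite lt_neqAle nsq2_ge0 andbT eq_sym paddr_eq0 ?nsq_ge0 // !nsq_eq0 negb_and.
Qed.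

Lemma nsq2_scale c x y : nsq2 (c * x) (c * y) = nsq c * nsq2 x y.
Proof. by rewrite /nsq2 !nsqM [RHS]mulrDr. Qed.

Lemma hopf_scale c x y : c != 0 -> hopf (c * x) (c * y) = hopf x y.
Proof.
move=> c0; have n0 : nsq c != 0 by rewrite nsq_eq0.
have div (a q : R) : (nsq c * a) / (nsq c * q) = a / q.
  by rewrite -mulf_div divff // mul1r.
rewrite /hopf nsq2_scale; apply: col3_eqP; rewrite -[in RHS]div; congr (_ / _);
  by rewrite ?nsqM ?ReM ?ImM ?ReJ ?ImJ ?ReM ?ImM /nsq; ring.
Qed.

(** The Hopf map sends orthogonal spinors to antipodal points. *)
Lemma hopf_perp x y : hopf y^* (- x^*) = - hopf x y.
Proof.
have E : nsq2 y^* (- x^*) = nsq2 x y by rewrite /nsq2 nsqN !nsqJ addrC.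
apply: cV3P; rewrite [RHS]mxE !col3E E -mulNr; congr (_ / _);
  by rewrite ?nsqN ?nsqJ ?ReM ?ImM ?ReJ ?ImJ ?ReN ?ImN ?ReJ ?ImJ; ring.
Qed.

Lemma sq3_hopf x y : nsq2 x y != 0 -> sq3 (hopf x y) = 1.
Proof.
move=> h; rewrite /sq3 sum3E !col3E ReM ImM ReJ ImJ; move: h; rewrite /nsq2 /nsq => h.
by field.
Qed.

(** The chordal metric of the projective line: closeness of Hopf images means a wedge product small
    against the norms. *)
Lemma sq3_hopf_sub x y x' y' : nsq2 x y != 0 -> nsq2 x' y' != 0 ->
  sq3 (hopf x y - hopf x' y') = 4 * nsq (x * y' - y * x') / (nsq2 x y * nsq2 x' y').
Proof.
move=> h h'; rewrite /sq3 sum3E !subcE !col3E.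
rewrite /nsq !(ReD, ImD, ReN, ImN, ReM, ImM, ReJ, ImJ).
move: h h'; rewrite /nsq2 /nsq => h h'.
by field; rewrite h h'.
Qed.

Lemma cvg_hopf T (F : set_system T) {FF : Filter F} (f g : T -> C) x y :
  nsq2 x y != 0 -> ccvg F f x -> ccvg F g y ->
  hopf (f t) (g t) @[t --> F] --> hopf x y.
Proof.
move=> q0 fx gy.
have qi : (nsq2 (f t) (g t))^-1 @[t --> F] --> (nsq2 x y)^-1.
  by apply: cvgV => //; apply: cvgD; exact: ccvg_nsq.
have [p1 p2] := ccvgM (ccvgJ fx) gy.
apply: cvg_col3; apply: cvgM => //; try by apply: cvgMr.
by apply: cvgB; exact: ccvg_nsq.
Qed.

Lemma ev3_hopf (phi : ex R * ex R * ex R * ex R) z :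
  ev3 (hopf3 phi) z = hopf (Complex (ev phi.1.1.1 z) (ev phi.1.1.2 z))
                           (Complex (ev phi.1.2 z) (ev phi.2 z)).
Proof.
by rewrite /ev3 /hopf /nsq2 /nsq ReM ImM ReJ ImJ /=; apply: col3_eqP;
  rewrite -?mulrA; congr (_ * _); rewrite ?expr2; ring.
Qed.
End HopfMap.

(** * Blow-up of a degenerating family of spinors *)

Section BlowUp.
Variable R : realType.
Local Open Scope complex_scope.
Local Notation "x ^*" := (conjc x) : ring_scope.
Local Notation C := R[i].
Local Notation Re := complex.Re.
Local Notation Im := complex.Im.
Context {T : Type} (F : set_system T) {FF : Filter F}.

Lemma cboundedM (f g : T -> C) : cbounded F f -> cbounded F g ->
  cbounded F (fun t => f t * g t).
Proof.
move=> [M hM] [N hN]; exists (2 * (M * N)); apply: filterS2 hM hN.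
move=> t [m1 m2] [n1 n2]; rewrite ReM ImM mulr_natl mulr2n.
by split; apply: le_trans (ler_normD _ _) _; rewrite ?normrN !normrM;
  apply: lerD; apply: ler_pM.
Qed.

Lemma cboundedD (f g : T -> C) : cbounded F f -> cbounded F g ->
  cbounded F (fun t => f t + g t).
Proof.
move=> [M hM] [N hN]; exists (M + N); apply: filterS2 hM hN.
move=> t [m1 m2] [n1 n2]; rewrite ReD ImD.
by split; apply: le_trans (ler_normD _ _) _; apply: lerD.
Qed.

Lemma cbounded_cst (c : C) : cbounded F (fun=> c).
Proof. by apply: ccvg_bounded; exact: ccvg_cst. Qed.

Lemma nsq2D (x y d d' : C) : nsq2 (x + d) (y + d') =
  nsq2 x y + nsq2 d d' + 2 * Re (x * d^* + y * d'^*).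
Proof. by rewrite /nsq2 /nsq !(ReD, ImD, ReM, ImM, ReJ, ImJ); ring. Qed.

Lemma nsq2_comb (e : R) (s p1 p2 q1 q2 : C) :
  nsq2 (e%:C * p1 + s * q1) (e%:C * p2 + s * q2) =
  e ^+ 2 * nsq2 p1 p2 + nsq s * nsq2 q1 q2 +
  2 * Re (e%:C * s * (p1^* * q1 + p2^* * q2)).
Proof. by rewrite /nsq2 /nsq !(ReD, ImD, ReM, ImM, ReJ, ImJ) /=; ring. Qed.

(* A degenerating family of spinors eps a + tau b, with eps and tau arbitrary
   but a and b convergent to orthogonal limits, has the same Hopf image in the
   limit as the model family: after normalization by (eps^2 + |tau|^2)^(1/2)
   the spinors stay away from 0 and their wedge product tends to 0. *)
Lemma hopf_blowup (eps : T -> R) (tau a1 a2 b1 b2 : T -> C) (p1 p2 q1 q2 : C) :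
  (\forall t \near F, 0 < eps t) ->
  ccvg F a1 p1 -> ccvg F a2 p2 -> ccvg F b1 q1 -> ccvg F b2 q2 ->
  p1^* * q1 + p2^* * q2 = 0 -> nsq2 p1 p2 != 0 -> nsq2 q1 q2 != 0 ->
  hopf ((eps t)%:C * a1 t + tau t * b1 t) ((eps t)%:C * a2 t + tau t * b2 t)
  - hopf ((eps t)%:C * p1 + tau t * q1) ((eps t)%:C * p2 + tau t * q2)
    @[t --> F] --> (0 : 'cV[R]_3).
Proof.
move=> eps0 ha1 ha2 hb1 hb2 orth p0 q0.
pose W t := Num.sqrt (eps t ^+ 2 + nsq (tau t)).
pose e t := eps t / W t; pose s t := tau t / (W t)%:C.
have W0 t : 0 < eps t -> 0 < W t.
  by move=> h; rewrite sqrtr_gt0 ltr_wpDr ?nsq_ge0 // exprn_gt0.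
have es t : 0 < eps t -> e t ^+ 2 + nsq (s t) = 1.
  move=> h; have w0 := W0 _ h; rewrite /e /s nsqM invcE nsqM nsqJ !nsq_real.
  have -> : nsq (tau t) = W t ^+ 2 - eps t ^+ 2.
    by rewrite sqr_sqrtr ?addr_ge0 ?sqr_ge0 ?nsq_ge0 //; ring.
  by field; rewrite gt_eqF.
have bs : cbounded F s.
  exists 1; apply: filterS eps0 => t /es h.
  have hr := sqr_ge0 (Re (s t)); have hi := sqr_ge0 (Im (s t)); have he := sqr_ge0 (e t).
  move: h; rewrite /nsq => h; split; rewrite -sqrtr_sqr -[leRHS]sqrtr1 ler_wsqrtr //; lra.
have be : cbounded F (fun t => (e t)%:C).
  exists 1; apply: filterS eps0 => t /es h; have := nsq_ge0 (s t) => h1.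
  by split; rewrite /= ?normr0 ?ler01 // -sqrtr_sqr -[leRHS]sqrtr1 ler_wsqrtr //; lra.
pose D1 t := (e t)%:C * (a1 t - p1) + s t * (b1 t - q1).
pose D2 t := (e t)%:C * (a2 t - p2) + s t * (b2 t - q2).
pose Y1 t := (e t)%:C * p1 + s t * q1.
pose Y2 t := (e t)%:C * p2 + s t * q2.
have lim0 f g (l m : C) : ccvg F f l -> ccvg F g m ->
    ccvg F (fun t => (e t)%:C * (f t - l) + s t * (g t - m)) 0.
  move=> fl gm; rewrite -[X in ccvg _ _ X]addr0; apply: ccvgD;
    apply: ccvg_bounded_mul0 => //.
    by rewrite -[X in ccvg _ _ X](subrr l); apply: ccvgB => //; exact: ccvg_cst.
  by rewrite -[X in ccvg _ _ X](subrr m); apply: ccvgB => //; exact: ccvg_cst.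
have D10 : ccvg F D1 0 by exact: lim0.
have D20 : ccvg F D2 0 by exact: lim0.
have bY1 : cbounded F Y1.
  by apply: cboundedD; apply: cboundedM => //; exact: cbounded_cst.
have bY2 : cbounded F Y2.
  by apply: cboundedD; apply: cboundedM => //; exact: cbounded_cst.
pose wd t := Y2 t * D1 t - Y1 t * D2 t.
have wd0 : ccvg F wd 0.
  rewrite -[X in ccvg _ _ X](subrr 0).
  by apply: ccvgB; exact: ccvg_bounded_mul0.
pose cr t := Y1 t * (D1 t)^* + Y2 t * (D2 t)^*.
have cr0 : ccvg F cr 0.
  rewrite -[X in ccvg _ _ X]addr0; apply: ccvgD; apply: ccvg_bounded_mul0 => //;
  by rewrite -[X in ccvg _ _ X](conjc0 R); exact: ccvgJ.
pose m := Num.min (nsq2 p1 p2) (nsq2 q1 q2).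
have m0 : 0 < m.
  by rewrite lt_min !lt_neqAle !nsq2_ge0 !andbT ![0 == _]eq_sym p0 q0.
(* Orthogonality of p and q removes the cross term, and [es] makes the rest a convex combination of
   their squared norms. *)
have nY t : 0 < eps t -> m <= nsq2 (Y1 t) (Y2 t).
  move=> /es h; rewrite nsq2_comb orth mulr0 /= mulr0 addr0 -[leLHS]mul1r -h mulrDl.
  by apply: lerD; apply: ler_wpM2l; rewrite ?sqr_ge0 ?nsq_ge0 // ge_min lexx ?orbT.
have nX t : nsq2 (Y1 t + D1 t) (Y2 t + D2 t) =
    nsq2 (Y1 t) (Y2 t) + nsq2 (D1 t) (D2 t) + 2 * Re (cr t).
  exact: nsq2D.
have [cr1 _] := cr0; rewrite /= in cr1.
have m4 : 0 < m / 4 by rewrite divr_gt0.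
move/cvgr0Pnorm_lt: cr1 => /(_ _ m4) crs.
have nXm : \forall t \near F, m / 2 <= nsq2 (Y1 t + D1 t) (Y2 t + D2 t).
  apply: filterS2 eps0 crs => t /nY h1 h2; rewrite nX.
  have := nsq2_ge0 (D1 t) (D2 t); move: h2; rewrite ltr_norml => /andP[h2 _]; lra.
apply: cvg_sq3_0.
(* The numerator 4 of [sq3_hopf_sub] over the lower bounds m / 2 and m of the two squared norms. *)
have wdn : (8 / m ^+ 2) * nsq (wd t) @[t --> F] --> (0 : R).
  have -> : (0 : R) = (8 / m ^+ 2) * nsq 0 by rewrite /nsq /= expr0n /= addr0 mulr0.
  by apply: cvgMr; exact: ccvg_nsq.
apply: (squeeze_cvgr _ (cvg_cst 0) wdn).
apply: filterS2 eps0 nXm => t h hX; rewrite sq3_ge0 /=.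
have w0 := W0 _ h; have hY := nY _ h.
have wc : (W t)%:C != 0 by rewrite -nsq_gt0 nsq_real exprn_gt0.
have We : (eps t)%:C = (W t)%:C * (e t)%:C.
  by rewrite -rmorphM /= /e mulrC divfK // gt_eqF.
have Ws : tau t = (W t)%:C * s t by rewrite /s mulrC divfK.
have sc (x y : C) : (eps t)%:C * x + tau t * y = (W t)%:C * ((e t)%:C * x + s t * y).
  by rewrite We {1}Ws; ring.
rewrite !sc !hopf_scale // -/(Y1 t) -/(Y2 t).
have -> : (e t)%:C * a1 t + s t * b1 t = Y1 t + D1 t by rewrite /Y1 /D1; ring.
have -> : (e t)%:C * a2 t + s t * b2 t = Y2 t + D2 t by rewrite /Y2 /D2; ring.
have hX0 : 0 < nsq2 (Y1 t + D1 t) (Y2 t + D2 t) by apply: lt_le_trans hX; rewrite divr_gt0.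
have hY0 : 0 < nsq2 (Y1 t) (Y2 t) by exact: lt_le_trans hY.
rewrite sq3_hopf_sub ?gt_eqF //.
have -> : (Y1 t + D1 t) * Y2 t - (Y2 t + D2 t) * Y1 t = wd t by rewrite /wd; ring.
rewrite ler_pdivrMr ?mulr_gt0 // mulrAC -subr_ge0.
set x := nsq2 _ _ in hX hX0 *; set y := nsq2 _ _ in hY hY0 *.
have -> : 8 / m ^+ 2 * (x * y) * nsq (wd t) - 4 * nsq (wd t) =
   4 * nsq (wd t) * ((2 * x) * y / m ^+ 2 - 1) by field; rewrite gt_eqF.
rewrite mulr_ge0 ?mulr_ge0 ?nsq_ge0 // subr_ge0 ler_pdivlMr ?exprn_gt0 // mul1r expr2.
apply: ler_pM => //; [exact: ltW|exact: ltW|by rewrite mulrC -ler_pdivrMr].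
Qed.
End BlowUp.

(** * The soliton as a function of complex numbers *)

Section SolitonLimits.
Variable R : realType.
Local Open Scope complex_scope.
Local Notation "x ^*" := (conjc x) : ring_scope.
Local Notation C := R[i].
Local Notation Re := complex.Re.
Local Notation Im := complex.Im.

Lemma cev_phase (r k : R) (f : ex R * ex R) z :
  cev (phase r k f) z =
  cev f z / (Complex r k - 1) + (cev f z)^* / (Complex r k + 1).
Proof.
by apply: eqcP; rewrite ?(ReD, ImD, ReM, ImM) !invcE ?(ReM, ImM)
  !(ReJ, ImJ, ReD, ImD, ReN, ImN) /nsq !(ReD, ImD, ReN, ImN) /= ?subr0 ?oppr0 ?addr0; ring.
Qed.

(** After multiplication by the squared norm of [psi], to which the Hopf map is insensitive, the
    dressed spinor is expanded in [psi] and its orthogonal companion, with the eigenvalues m2 - m1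
    and m2 + conj m1 of the dressing matrix. *)
Lemma dress_hopf (r1 k1 r2 k2 : R) (psi phi : ex R * ex R * ex R * ex R) (z : R * R)
    (x y v w : C) :
  x = Complex (ev psi.1.1.1 z) (ev psi.1.1.2 z) ->
  y = Complex (ev psi.1.2 z) (ev psi.2 z) ->
  v = Complex (ev phi.1.1.1 z) (ev phi.1.1.2 z) ->
  w = Complex (ev phi.1.2 z) (ev phi.2 z) ->
  nsq2 x y != 0 ->
  let m1 := Complex r1 k1 in let m2 := Complex r2 k2 in
  let inner := x^* * v + y^* * w in let wedge := y * v - x * w in
  ev3 (hopf3 (dress r1 k1 r2 k2 (hopf3 psi) phi)) z =
  hopf ((m2 - m1) * inner * x + (m2 + m1^*) * wedge * y^*)
       ((m2 - m1) * inner * y - (m2 + m1^*) * wedge * x^*).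
Proof.
move=> xE yE vE wE N0 /=; rewrite ev3_hopf.
set d1 := Complex _ _; set d2 := Complex _ _.
have n0 : (nsq2 x y)%:C != 0 :> C by rewrite -nsq_gt0 nsq_real exprn_even_gt0.
rewrite -(hopf_scale d1 d2 n0).
rewrite {}/d1 {}/d2; clear n0; move: N0; rewrite xE yE vE wE /nsq2 /nsq /= => N0.
clear xE yE vE wE; move: psi phi N0 => [[[a b] c] d] [[[a' b'] c'] d'] /=.
move: (ev a z) (ev b z) (ev c z) (ev d z) => {}a {}b {}c {}d.
move: (ev a' z) (ev b' z) (ev c' z) (ev d' z) => {}a' {}b' {}c' {}d'.
rewrite !expr2 => N0.
congr hopf; apply: eqcP; rewrite ?(ReD, ImD, ReM, ImM, ReN, ImN, ReJ, ImJ) /=; field; exact: N0.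
Qed.

Definition soliton (eps : R) (sg g : C) : 'cV[R]_3 :=
  let f := (eps * pi)%:C * 'i * g in
  let m1 := 1 + eps%:C / sg in let m2 := 1 + eps%:C / (sg - 1) in
  let s1 := f / (m1 - 1) + f^* / (m1 + 1) in
  let s2 := f / (m2 - 1) + f^* / (m2 + 1) in
  let x := cexp s1 in let y := cexp (- s1) in
  let v := cexp s2 in let w := cexp (- s2) in
  let inner := x^* * v + y^* * w in let wedge := y * v - x * w in
  col3 0 0 (2 * Re f) - Re m1 *: hopf x y
  - Re m2 *: hopf ((m2 - m1) * inner * x + (m2 + m1^*) * wedge * y^*)
                  ((m2 - m1) * inner * y - (m2 + m1^*) * wedge * x^*).

Lemma cexp_neq0_nsq2 (s w : C) : nsq2 (cexp s) w != 0.
Proof. by rewrite gt_eqF // nsq2_gt0 cexp_neq0. Qed.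

Lemma ev3_soliton (eps : R) (sg : C) (g : ex R * ex R) z :
  let m1 := 1 + eps%:C / sg in let m2 := 1 + eps%:C / (sg - 1) in
  ev3 (soliton3 (Re m1) (Im m1) (Re m2) (Im m2)
         (cmul (cC ((eps * pi)%:C * 'i)) g)) z = soliton eps sg (cev g z).
Proof.
move=> m1 m2; set f := cmul _ g.
have fE : cev f z = (eps * pi)%:C * 'i * cev g z by rewrite /f cev_mul cev_C.
have wx r k : Complex (ev (wave4 (phase r k f)).1.1.1 z) (ev (wave4 (phase r k f)).1.1.2 z)
   = cexp (cev (phase r k f) z) by [].
have wy r k : Complex (ev (wave4 (phase r k f)).1.2 z) (ev (wave4 (phase r k f)).2 z)
   = cexp (- cev (phase r k f) z).
  by apply: eqcP; rewrite /cexp /= ?mulN1r ?cosN // sinN mulrN.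
have mE (m : C) : Complex (Re m) (Im m) = m by case: m.
have ev3_add3 u n : ev3 (add3 u n) z = ev3 u z + ev3 n z.
  by apply: cV3P; rewrite [RHS]mxE !col3E.
have ev3_scale3 r u : ev3 (scale3 r u) z = r *: ev3 u z.
  by apply: cV3P; rewrite [RHS]mxE !col3E.
rewrite /soliton3 !ev3_add3 !ev3_scale3 ev3_hopf.
rewrite (dress_hopf _ _ _ _ (esym (wx _ _)) (esym (wy _ _)) (esym (wx _ _)) (esym (wy _ _))).
  rewrite wx wy !cev_phase !mE fE /soliton -/m1 -/m2 !scaleNr; congr (_ - _ - _).
  by rewrite /ev3 -fE.
exact: cexp_neq0_nsq2.
Qed.
End SolitonLimits.

(** * Limits of the soliton as eps tends to 0 *)

Section Degeneration.
Variable R : realType.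
Local Open Scope complex_scope.
Local Notation "x ^*" := (conjc x) : ring_scope.
Local Notation C := R[i].
Local Notation Re := complex.Re.
Local Notation Im := complex.Im.
Context {T : Type} (F : set_system T) {FF : Filter F}.
Variables (eps : T -> R) (g : T -> C) (g0 sg : C).
Hypotheses (eps0 : eps @ F --> (0 : R)) (eps_gt0 : \forall t \near F, 0 < eps t).
Hypotheses (sg0 : sg != 0) (sg1 : sg - 1 != 0) (hg : ccvg F g g0).

Let c : C := pi%:C * 'i.
Let f t : C := (eps t * pi)%:C * 'i * g t.
Let m (r : C) t : C := 1 + (eps t)%:C / r.
Let s (r : C) t : C := f t / (m r t - 1) + (f t)^* / (m r t + 1).

Lemma lim_eps : ccvg F (fun t => (eps t)%:C) 0.
Proof. by apply: ccvg_real. Qed.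

Lemma lim_f : ccvg F f 0.
Proof.
have -> : f = fun t => (eps t)%:C * (c * g t).
  by apply/funext => t; rewrite /f /c rmorphM /=; ring.
rewrite -(mul0r (c * g0)); apply: ccvgM; first exact: lim_eps.
by apply: ccvgM => //; exact: ccvg_cst.
Qed.

Lemma lim_m r : ccvg F (m r) 1.
Proof.
rewrite -[X in ccvg _ _ X]addr0 -[in X in 1 + X](mul0r r^-1).
apply: ccvgD; first exact: ccvg_cst.
by apply: ccvgM; [exact: lim_eps|exact: ccvg_cst].
Qed.

Lemma two_neq0 : (1 + 1 : C) != 0.
Proof. by rewrite -mulr2n pnatr_eq0. Qed.

Lemma lim_m1V r : ccvg F (fun t => (m r t + 1)^-1) (1 + 1)^-1.
Proof.
apply: ccvgV; first exact: two_neq0.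
by apply: ccvgD; [exact: lim_m|exact: ccvg_cst].
Qed.

(** The factor eps of [f] cancels exactly against m - 1 = eps / r; only the conjugate term, of order
    eps, is left over. *)
Lemma s_near r : r != 0 ->
  \forall t \near F, c * r * g t + (f t)^* / (m r t + 1) = s r t.
Proof.
move=> r0; apply: filterS eps_gt0 => t e0; rewrite /s; congr (_ + _).
have e1 : (eps t)%:C != 0 :> C by rewrite -nsq_gt0 nsq_real exprn_gt0.
rewrite /m /f /c [1 + _]addrC addrK rmorphM /=; field.
by rewrite r0 e1.
Qed.

Lemma lim_s r : r != 0 -> ccvg F (s r) (c * r * g0).
Proof.
move=> r0; apply: ccvg_near (s_near r0) _.
rewrite -[X in ccvg _ _ X]addr0; apply: ccvgD.
  by apply: ccvgM => //; exact: ccvg_cst.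
rewrite -(mul0r (1 + 1)^-1); apply: ccvgM; last exact: lim_m1V.
by rewrite -[X in ccvg _ _ X](conjc0 R); apply: ccvgJ; exact: lim_f.
Qed.

Let s1 := s sg. Let s2 := s (sg - 1).
Let x0 := cexp (c * sg * g0). Let y0 := cexp (- (c * sg * g0)).
Let v0 := cexp (c * (sg - 1) * g0). Let w0 := cexp (- (c * (sg - 1) * g0)).

Lemma lim_x : ccvg F (fun t => cexp (s1 t)) x0.
Proof. by apply: ccvg_cexp; exact: lim_s. Qed.
Lemma lim_y : ccvg F (fun t => cexp (- s1 t)) y0.
Proof. by apply: ccvg_cexp; apply: ccvgN; exact: lim_s. Qed.
Lemma lim_v : ccvg F (fun t => cexp (s2 t)) v0.
Proof. by apply: ccvg_cexp; exact: lim_s. Qed.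
Lemma lim_w : ccvg F (fun t => cexp (- s2 t)) w0.
Proof. by apply: ccvg_cexp; apply: ccvgN; exact: lim_s. Qed.

Let inner t := (cexp (s1 t))^* * cexp (s2 t) + (cexp (- s1 t))^* * cexp (- s2 t).
Let wedge t := cexp (- s1 t) * cexp (s2 t) - cexp (s1 t) * cexp (- s2 t).
Let inner0 := x0^* * v0 + y0^* * w0.
Let wedge0 := y0 * v0 - x0 * w0.

Lemma lim_inner : ccvg F inner inner0.
Proof.
by apply: ccvgD; apply: ccvgM; try apply: ccvgJ;
  [exact: lim_x|exact: lim_v|exact: lim_y|exact: lim_w].
Qed.

Lemma lim_wedge : ccvg F wedge wedge0.
Proof.
by apply: ccvgB; apply: ccvgM;
  [exact: lim_y|exact: lim_v|exact: lim_x|exact: lim_w].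
Qed.

Lemma lim_dm : ccvg F (fun t => m (sg - 1) t - m sg t) 0.
Proof. by rewrite -(subrr 1); apply: ccvgB; exact: lim_m. Qed.

Lemma lim_mm : ccvg F (fun t => m (sg - 1) t + (m sg t)^*) 2.
Proof.
have -> : (2 : C) = 1 + 1^* by apply: eqcP; rewrite /= ?oppr0 ?addr0.
by apply: ccvgD; [exact: lim_m|apply: ccvgJ; exact: lim_m].
Qed.

Let H t := hopf
  ((m (sg - 1) t - m sg t) * inner t * cexp (s1 t)
     + (m (sg - 1) t + (m sg t)^*) * wedge t * (cexp (- s1 t))^*)
  ((m (sg - 1) t - m sg t) * inner t * cexp (- s1 t)
     - (m (sg - 1) t + (m sg t)^*) * wedge t * (cexp (s1 t))^*).

(* As eps tends to 0 the vacuum vanishes and both spectral parameters tend to 1,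
   so that only the two Hopf images survive. *)
Lemma lim_soliton_hopf (h : T -> 'cV[R]_3) :
  H t - h t @[t --> F] --> (0 : 'cV[R]_3) ->
  (forall t, `|h t| <= 1) ->
  soliton (eps t) sg (g t) - (- hopf x0 y0 - h t) @[t --> F] --> (0 : 'cV[R]_3).
Proof.
move=> Hh hb.
have vec (A B E G J : 'cV[R]_3) (p q : R) : A - p *: B - q *: G - (- E - J) =
    (A - (p *: B - E)) - ((q *: (G - J)) + (q - 1) *: J).
  by apply/matrixP => i j; rewrite !mxE; ring.
pose k t := (col3 0 0 (2 * Re (f t)) -
  (Re (m sg t) *: hopf (cexp (s1 t)) (cexp (- s1 t)) - hopf x0 y0))
  - ((Re (m (sg - 1) t) *: (H t - h t)) + (Re (m (sg - 1) t) - 1) *: h t).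
have -> : (fun t => soliton (eps t) sg (g t) - (- hopf x0 y0 - h t)) = k.
  by apply/funext => t; exact: vec.
have [mr1 _] := lim_m sg; have [mr2 _] := lim_m (sg - 1).
rewrite /= in mr1 mr2.
rewrite /k -[X in _ --> X](subr0 0); apply: cvgB.
  rewrite -[X in _ --> X](subr0 0); apply: cvgB.
    have [f0 _] := lim_f.
    have -> : (0 : 'cV[R]_3) = col3 0 0 (2 * Re (0 : C)).
      by apply: cV3P; rewrite [LHS]mxE !col3E //= mulr0.
    by apply: cvg_col3; [exact: cvg_cst|exact: cvg_cst|exact: cvgMr].
  rewrite -[X in _ --> X](subrr (hopf x0 y0)); apply: cvgB; last exact: cvg_cst.
  rewrite -[X in _ --> X](scale1r (hopf x0 y0)); apply: cvgZ => //.
  by apply: cvg_hopf; [exact: cexp_neq0_nsq2|exact: lim_x|exact: lim_y].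
rewrite -[X in _ --> X](addr0 0); apply: cvgD.
  by rewrite -[X in _ --> X](scale1r 0); apply: cvgZ.
have m0 : Re (m (sg - 1) t) - 1 @[t --> F] --> (0 : R).
  by rewrite -(subrr 1); apply: cvgB => //; exact: cvg_cst.
apply/cvgr0Pnorm_lt => e e0; move/cvgr0Pnorm_lt: m0 => /(_ _ e0).
by apply: filterS => t; apply: le_lt_trans; rewrite normrZ ler_piMr.
Qed.

Lemma norm_hopf_le (x y : C) : `|hopf x y| <= 1.
Proof.
(* On the zero spinor the quotients in [hopf] default to 0. *)
have [h|h] := eqVneq (nsq2 x y) 0.
  by apply: norm_le_coord => //; apply: ord3P; rewrite col3E h invr0 mulr0 normr0 ler01.
by apply: le_trans (norm_le_enorm _) _; rewrite /enorm -/(sq3 _) sq3_hopf // sqrtr1.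
Qed.

Lemma wedge0E : wedge0 = cexp (- (c * g0)) - cexp (c * g0).
Proof. by rewrite /wedge0 /y0 /v0 /x0 /w0 -!cexpD; congr (cexp _ - cexp _); ring. Qed.

(** In the limit m2 - m1 vanishes but the wedge product, -2 sinh (pi i g0), does not. The second
    spinor tends to a multiple of the one orthogonal to the first, so the two Hopf images become
    antipodal and cancel. *)
Lemma soliton_away : (forall n : int, g0 != n%:~R) ->
  soliton (eps t) sg (g t) @[t --> F] --> (0 : 'cV[R]_3).
Proof.
move=> gn; have wn : wedge0 != 0.
  rewrite wedge0E; apply/eqP => /subr0_eq E.
  have /cexp_eq1[n En] : cexp (c * g0 + c * g0) = 1 by rewrite cexpD -{1}E mulrC cexpNK.
  have := gn n; rewrite -subr_eq0 => /eqP; apply.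
  have p0 : pi != 0 :> R by rewrite gt_eqF // pi_gt0.
  have cr : Re c = 0 by rewrite /c ReM /=; ring.
  have ci : Im c = pi by rewrite /c ImM /=; ring.
  have h2 : Re (c * g0 + c * g0) = 0 by rewrite En.
  have h1 : Im (c * g0 + c * g0) = 2 * pi * n%:~R by rewrite En.
  have gen (d : C) : Re d = 0 -> Im d = pi -> Im (d * g0 + d * g0) = 2 * pi * n%:~R ->
      Re (d * g0 + d * g0) = 0 -> pi * Re g0 = pi * n%:~R /\ pi * Im g0 = 0.
    rewrite !(ReD, ImD, ReM, ImM) => -> -> h3 h4; split; lra.
  have [h3 h4] := gen c cr ci h1 h2.
  have gi : Im g0 = 0 by apply: (mulfI p0); rewrite mulr0.
  have gr : Re g0 = n%:~R by apply: (mulfI p0).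
  by rewrite -(rmorph_int (real_complex R)); apply: eqcP;
    rewrite ?(ReD, ImD, ReN, ImN) ?gr ?gi /= ?subrr ?oppr0 ?addr0.
have yn : y0^* != 0 by rewrite conjc_eq0 cexp_neq0.
have N0 : nsq2 (2 * wedge0 * y0^*) (- (2 * wedge0 * x0^*)) != 0.
  rewrite gt_eqF // nsq2_gt0; apply/orP; left.
  by rewrite mulf_neq0 // mulf_neq0 // pnatr_eq0.
have hl : hopf (2 * wedge0 * y0^*) (- (2 * wedge0 * x0^*)) = - hopf x0 y0.
  by rewrite -mulrN hopf_scale ?hopf_perp // mulf_neq0 ?pnatr_eq0.
have := @lim_soliton_hopf (fun=> - hopf x0 y0); rewrite opprK addNr.
have -> : (fun t => soliton (eps t) sg (g t) - 0) = fun t => soliton (eps t) sg (g t).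
  by apply/funext => t; rewrite subr0.
move=> Q; apply: Q; last by move=> _; rewrite normrN norm_hopf_le.
rewrite -(addNr (hopf x0 y0)); apply: cvgD; last exact: cvg_cst.
have zero_lim (a b : T -> C) a0 b0 : ccvg F a a0 -> ccvg F b b0 ->
    ccvg F (fun t => (m (sg - 1) t - m sg t) * a t * b t) 0.
  move=> ha hb; rewrite -(mul0r b0) -(mul0r a0).
  by apply: ccvgM => //; apply: ccvgM => //; exact: lim_dm.
rewrite -hl; apply: cvg_hopf => //.
  rewrite -[X in ccvg _ _ X]add0r; apply: ccvgD.
    exact: zero_lim lim_inner lim_x.
  apply: ccvgM; last by apply: ccvgJ; exact: lim_y.
  by apply: ccvgM; [exact: lim_mm|exact: lim_wedge].
rewrite -[X in ccvg _ _ X]add0r; apply: ccvgB.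
  exact: zero_lim lim_inner lim_y.
apply: ccvgM; last by apply: ccvgJ; exact: lim_x.
by apply: ccvgM; [exact: lim_mm|exact: lim_wedge].
Qed.

Section Collision.
Variables (n : int) (tau V : T -> C) (V0 : C).
Hypotheses (g0n : g0 = n%:~R) (htau : ccvg F tau 0) (hV : ccvg F V V0).
Hypothesis gE : \forall t \near F, g t = g0 + tau t * V t.

(** [eta] is the deviation of s1 - s2 from c g0. The conjugate terms of the two phases are of order
    eps, but their difference is eps times [kap], which tends to 0; hence it is negligible against
    m2 - m1, which is of exact order eps. *)
Let kap t := (c * g t)^* * ((m sg t + 1)^-1 - (m (sg - 1) t + 1)^-1).
Let eta t := tau t * (c * V t) + (eps t)%:C * kap t.
Let K t := - (cexp (- (c * g0)) * cexp (- eta t) * 2 * expquot (2 * eta t)).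

(** Since e^(c g0) equals its inverse, the wedge product is a multiple of 1 - e^(2 eta); [expquot]
    factors out [eta] and leaves a factor with nonzero limit. *)
Lemma wedge_near : \forall t \near F, wedge t = eta t * K t.
Proof.
have s1N := s_near sg0; have s2N := s_near sg1.
near=> t.
have E1 : s1 t - s2 t = c * g0 + eta t.
  have <- : c * sg * g t + (f t)^* / (m sg t + 1) = s1 t by near: t.
  have <- : c * (sg - 1) * g t + (f t)^* / (m (sg - 1) t + 1) = s2 t by near: t.
  have -> : (f t)^* = (eps t)%:C * (c * g t)^*.
    have -> : f t = (eps t)%:C * (c * g t) by rewrite /f /c rmorphM /=; ring.
    by rewrite rmorphM /= oppr0.
  have gt : g t = g0 + tau t * V t by near: t.
  by rewrite /eta /kap {1 3}gt; ring.
have per : cexp (c * g0) = cexp (- (c * g0)) by apply: (cexp_half_period (n := n)); rewrite g0n.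
have -> : wedge t = cexp (- (s1 t - s2 t)) - cexp (s1 t - s2 t).
  by rewrite /wedge -!cexpD; congr (cexp _ - cexp _); ring.
rewrite E1 opprD (cexpD (c * g0)) (cexpD (- (c * g0))) per /K.
have -> : cexp (eta t) = cexp (- eta t) * cexp (2 * eta t).
  by rewrite -cexpD; congr cexp; ring.
have -> : cexp (2 * eta t) = 1 + 2 * eta t * expquot (2 * eta t).
  by rewrite -expquotE; ring.
ring.
Unshelve. all: by end_near.
Qed.

Lemma lim_kap : ccvg F kap 0.
Proof.
rewrite -(mulr0 (c * g0)^*); apply: ccvgM.
  by apply: ccvgJ; apply: ccvgM => //; exact: ccvg_cst.
by rewrite -(subrr (1 + 1)^-1); apply: ccvgB; exact: lim_m1V.
Qed.

Lemma lim_eta : ccvg F eta 0.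
Proof.
have -> : (0 : C) = 0 * (c * V0) + 0 * 0 by rewrite !mul0r addr0.
apply: ccvgD; apply: ccvgM => //.
- by apply: ccvgM => //; exact: ccvg_cst.
- exact: lim_eps.
- exact: lim_kap.
Qed.

Let K0 := - (cexp (- (c * g0)) * 2).

Lemma lim_K : ccvg F K K0.
Proof.
have -> : K0 = - (cexp (- (c * g0)) * cexp (- 0) * 2 * 1).
  by rewrite oppr0 cexp0 !mulr1.
apply: ccvgN; apply: ccvgM.
  apply: ccvgM; last exact: ccvg_cst.
  apply: ccvgM; first exact: ccvg_cst.
  by apply: ccvg_cexp; apply: ccvgN; exact: lim_eta.
apply: ccvg_expquot; rewrite -(mulr0 2); apply: ccvgM; first exact: ccvg_cst.
exact: lim_eta.
Qed.

(** At an integer the second limiting wave is the first one times the sign e^(-c g0), so the inner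
    product is a squared norm up to sign. *)
Lemma inner0_neq0 : inner0 != 0.
Proof.
have vE : v0 = x0 * cexp (- (c * g0)) by rewrite -cexpD; congr cexp; ring.
have wE : w0 = y0 * cexp (- (c * g0)).
  have per : cexp (c * g0) = cexp (- (c * g0)) by apply: (cexp_half_period (n := n)); rewrite g0n.
  by rewrite -per -cexpD; congr cexp; ring.
have -> : inner0 = (nsq2 x0 y0)%:C * cexp (- (c * g0)).
  have gen (a b d : C) : a^* * (a * d) + b^* * (b * d) = (nsq2 a b)%:C * d.
    by rewrite /nsq2 rmorphD /= -!mulcJ; ring.
  by rewrite /inner0 vE wE gen.
rewrite mulf_neq0 ?cexp_neq0 // -nsq_gt0 nsq_real exprn_gt0 //.
by rewrite nsq2_gt0 cexp_neq0.
Qed.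

Let gam : C := (sg - 1)^-1 - sg^-1.

(** Writing m2 - m1 as eps times [gam] and the wedge product as [eta * K] turns the spinor into eps
    A + tau B, where A and B tend to multiples of the first spinor and of its orthogonal companion.
    By [hopf_blowup] these limits may be inserted whatever the ratio of tau to eps. *)
Lemma soliton_bubble : V0 != 0 -> exists al be : C, [/\ al != 0, be != 0 &
  soliton (eps t) sg (g t) - (- hopf x0 y0
    - hopf ((eps t)%:C * (al * x0) + tau t * (be * y0^*))
           ((eps t)%:C * (al * y0) + tau t * (be * - x0^*)))
    @[t --> F] --> (0 : 'cV[R]_3)].
Proof.
move=> V00; pose al := gam * inner0; pose be := 2 * (c * V0 * K0).
have c0 : c != 0.
  rewrite mulf_neq0 // -nsq_gt0 ?nsq_real ?exprn_gt0 ?pi_gt0 //.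
  by rewrite /nsq /= expr0n /= add0r expr1n.
have gam0 : gam != 0.
  have -> : gam = (sg * (sg - 1))^-1 by rewrite /gam; field; rewrite sg0 sg1.
  by rewrite invr_eq0 mulf_neq0.
have al0 : al != 0 by rewrite mulf_neq0 // inner0_neq0.
have be0 : be != 0.
  have K00 : K0 != 0 by rewrite oppr_eq0 mulf_neq0 ?cexp_neq0 ?pnatr_eq0.
  have t0 : (2 : C) != 0 by rewrite pnatr_eq0.
  exact: mulf_neq0 t0 (mulf_neq0 (mulf_neq0 c0 V00) K00).
exists al, be; split => //; apply: lim_soliton_hopf => [|t]; last exact: norm_hopf_le.
pose mm t := m (sg - 1) t + (m sg t)^*.
pose A1 t := gam * inner t * cexp (s1 t) + mm t * (kap t * K t) * (cexp (- s1 t))^*.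
pose A2 t := gam * inner t * cexp (- s1 t) - mm t * (kap t * K t) * (cexp (s1 t))^*.
pose B1 t := mm t * (c * V t * K t) * (cexp (- s1 t))^*.
pose B2 t := mm t * (c * V t * K t) * - (cexp (s1 t))^*.
have lk : ccvg F (fun t => mm t * (kap t * K t)) 0.
  rewrite -(mulr0 2) -[in X in 2 * X](mul0r K0).
  by apply: ccvgM; [exact: lim_mm|apply: ccvgM; [exact: lim_kap|exact: lim_K]].
have lgi : ccvg F (fun t => gam * inner t) al.
  by apply: ccvgM; [exact: ccvg_cst|exact: lim_inner].
have lb : ccvg F (fun t => mm t * (c * V t * K t)) be.
  apply: ccvgM; first exact: lim_mm.
  by apply: ccvgM; [apply: ccvgM => //; exact: ccvg_cst|exact: lim_K].
have hA1 : ccvg F A1 (al * x0).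
  rewrite -[X in ccvg _ _ X]addr0 -[in X in _ + X](mul0r y0^*); apply: ccvgD.
    by apply: ccvgM => //; exact: lim_x.
  by apply: ccvgM => //; apply: ccvgJ; exact: lim_y.
have hA2 : ccvg F A2 (al * y0).
  rewrite -[X in ccvg _ _ X]subr0 -[in X in _ - X](mul0r x0^*); apply: ccvgB.
    by apply: ccvgM => //; exact: lim_y.
  by apply: ccvgM => //; apply: ccvgJ; exact: lim_x.
have hB1 : ccvg F B1 (be * y0^*).
  by apply: ccvgM => //; apply: ccvgJ; exact: lim_y.
have hB2 : ccvg F B2 (be * - x0^*).
  by apply: ccvgM => //; apply: ccvgN; apply: ccvgJ; exact: lim_x.
have orth : (al * x0)^* * (be * y0^*) + (al * y0)^* * (be * - x0^*) = 0.
  by rewrite !rmorphM /=; ring.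
have ne (u v w : C) : u != 0 -> v != 0 -> nsq2 (u * v) w != 0.
  by move=> u0 vn0; rewrite gt_eqF // nsq2_gt0 mulf_neq0.
have hl : hopf ((eps t)%:C * A1 t + tau t * B1 t) ((eps t)%:C * A2 t + tau t * B2 t)
  - hopf ((eps t)%:C * (al * x0) + tau t * (be * y0^*))
         ((eps t)%:C * (al * y0) + tau t * (be * - x0^*))
    @[t --> F] --> (0 : 'cV[R]_3).
  apply: hopf_blowup => //; first by apply: ne => //; exact: cexp_neq0.
  by apply: ne => //; rewrite conjc_eq0; exact: cexp_neq0.
apply: cvg_trans hl; apply: near_eq_cvg.
have wN := wedge_near; apply: filterS wN => t wE.
have dm : m (sg - 1) t - m sg t = (eps t)%:C * gam by rewrite /m /gam; ring.
congr (hopf _ _ - _).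
  rewrite dm wE -/(mm t) /A1 /B1 /eta.
  by move: (mm t) (inner t) (kap t) (K t) (cexp _) (cexp _)^* => *; ring.
rewrite dm wE -/(mm t) /A2 /B2 /eta.
by move: (mm t) (inner t) (kap t) (K t) (cexp _) (cexp _)^* => *; ring.
Qed.
End Collision.
End Degeneration.

(** * Degree 2 bubbles and their projections *)

Section Rotations.
Variable R : realType.
Local Open Scope complex_scope.
Local Notation "x ^*" := (conjc x) : ring_scope.
Local Notation C := R[i].
Local Notation Re := complex.Re.
Local Notation Im := complex.Im.

Definition mat3 (u v w : 'cV[R]_3) : 'M[R]_3 :=
  \matrix_(i, j) nth 0 [:: u i 0; v i 0; w i 0] j.

Lemma mat3E u v w i : (mat3 u v w i (inord 0) = u i 0) *
  (mat3 u v w i (inord 1) = v i 0) * (mat3 u v w i (inord 2) = w i 0).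
Proof. by rewrite !mxE !inordK. Qed.

Lemma mulmx3E (A : 'M[R]_3) (v : 'cV[R]_3) i : (A *m v) i 0 =
  A i (inord 0) * v (inord 0) 0 + A i (inord 1) * v (inord 1) 0
  + A i (inord 2) * v (inord 2) 0.
Proof. by rewrite mxE sum3E. Qed.

Lemma mul_trmx3E (A : 'M[R]_3) i j : (A *m A^T) i j =
  A i (inord 0) * A j (inord 0) + A i (inord 1) * A j (inord 1)
  + A i (inord 2) * A j (inord 2).
Proof. by rewrite mxE sum3E 3![(A^T) _ _]mxE. Qed.

Lemma scalar3E (i j : 'I_3) : (1%:M : 'M[R]_3) i j = (i == j)%:R.
Proof. by rewrite mxE. Qed.

Lemma det3 (A : 'M[R]_3) : let a i j := A (inord i) (inord j) in
  \det A = a 0 0 * (a 1 1 * a 2 2 - a 1 2 * a 2 1)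
         - a 0 1 * (a 1 0 * a 2 2 - a 1 2 * a 2 0)
         + a 0 2 * (a 1 0 * a 2 1 - a 1 1 * a 2 0) :> R.
Proof.
move=> a; have aE (i j : 'I_3) : A i j = a (val i) (val j) by rewrite /a !inord_val.
have d2 (B : 'M[R]_2) : \det B = B ord0 ord0 * B (lift ord0 ord0) (lift ord0 ord0)
    - B ord0 (lift ord0 ord0) * B (lift ord0 ord0) ord0.
  rewrite (expand_det_row _ ord0) !big_ord_recl big_ord0 addr0 /cofactor.
  rewrite !det_mx11 !mxE /=.
  have -> : lift (lift ord0 ord0) 0 = ord0 :> 'I_2 by exact/val_inj.
  have -> : lift ord0 0 = lift ord0 ord0 :> 'I_2 by exact/val_inj.
  by rewrite /bump /=; ring.
rewrite (expand_det_row _ ord0) !big_ord_recl big_ord0 addr0 /cofactor.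
by rewrite !d2 !mxE !aE /= /bump /=; ring.
Qed.

Lemma in_SO3_mul (P Q : 'M[R]_3) : in_SO3 P -> in_SO3 Q -> in_SO3 (P *m Q).
Proof.
move=> [p1 p2] [q1 q2]; split; last by rewrite det_mulmx p2 q2 mulr1.
by rewrite trmx_mul mulmxA -(mulmxA P) q1 mulmx1.
Qed.

(** The rotation attached by the double cover from SU(2) to SO(3) to the normalized spinor,
    completed by its orthogonal companion. *)
Definition frame (x y : C) : 'M[R]_3 :=
  let n := nsq2 x y in
  mat3 (col3 (Re (x * x - y * y) / n) (- (Im (x * x + y * y) / n)) (- (2 * Re (x * y) / n)))
       (col3 (Im (x * x - y * y) / n) (Re (x * x + y * y) / n) (- (2 * Im (x * y) / n)))
       (hopf x y).

Lemma frame_SO3 x y : nsq2 x y != 0 -> in_SO3 (frame x y).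
Proof.
case: x y => [a b] [c d] h; split.
  apply/matrixP => i j; move: i; apply: ord3P; move: j; apply: ord3P;
  rewrite mul_trmx3E !mat3E !col3E scalar3E -val_eqE /= !inordK //= /nsq2 /nsq /=;
  move: h; rewrite /nsq2 /nsq /= => h; by field.
rewrite det3 !mat3E !col3E /nsq2 /nsq /=; move: h; rewrite /nsq2 /nsq /= => h.
by field.
Qed.

Definition spin (l : C) : 'M[R]_3 :=
  mat3 (col3 (Re l) (Im l) 0) (col3 (- Im l) (Re l) 0) (col3 0 0 1).

Lemma spin_SO3 l : nsq l = 1 -> in_SO3 (spin l).
Proof.
case: l => [a b]; rewrite /nsq /= => h.
have comb (u v k : R) : u - v = k * (a ^+ 2 + b ^+ 2 - 1) -> u = v.
  by rewrite h subrr mulr0 => /subr0_eq.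
split.
  apply/matrixP => i j; move: i; apply: ord3P; move: j; apply: ord3P;
  rewrite mul_trmx3E !mat3E !col3E scalar3E -val_eqE /= !inordK //=;
  (try by ring); apply: (comb _ _ 1); ring.
by rewrite det3 !mat3E !col3E /=; apply: (comb _ _ 1); ring.
Qed.

Definition pair_of (z : C) : R * R := (Re z, Im z).

Lemma stereo_pair (z : C) : stereo (pair_of z) =
  col3 (2 * Re z / (1 + nsq z)) (2 * Im z / (1 + nsq z)) ((nsq z - 1) / (1 + nsq z)).
Proof.
have E : sqn2 (pair_of z) = nsq z by rewrite /sqn2 /dot2 /nsq /= !expr2.
by rewrite /stereo E; apply: cV3P; rewrite mxE !col3E /= mulrC.
Qed.

Lemma nsq1_neq0 (z : C) : 1 + nsq z != 0.
Proof. by rewrite gt_eqF // ltr_pwDl ?nsq_ge0. Qed.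

Lemma stereo_spin l z : nsq l = 1 ->
  spin l *m stereo (pair_of z) = stereo (pair_of (l * z)).
Proof.
move=> h; rewrite !stereo_pair nsqM h mul1r; move: (nsq1_neq0 z) => n0.
by apply: cV3P; rewrite mulmx3E !mat3E !col3E ?ReM ?ImM; field.
Qed.

(** In the basis of a spinor and its orthogonal companion the Hopf map is, up to sign and rotation,
    the stereographic projection of the ratio [t] of the coefficients. *)
Lemma frame_stereo x y t : nsq2 x y != 0 ->
  frame x y *m stereo (pair_of t) = - hopf (x + t * y^*) (y - t * x^*).
Proof.
move=> h; have n0 := nsq1_neq0 t; rewrite stereo_pair.
have E : nsq2 (x + t * y^*) (y - t * x^*) = nsq2 x y * (1 + nsq t).
  by rewrite /nsq2 /nsq !(ReD, ImD, ReN, ImN, ReM, ImM, ReJ, ImJ); ring.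
have h' : nsq2 x y * (1 + nsq t) != 0 by rewrite mulf_neq0.
apply: cV3P; rewrite mulmx3E !mat3E !col3E [RHS]mxE !col3E E;
  move: h n0 {E h'}; rewrite /nsq2 /nsq !(ReD, ImD, ReN, ImN, ReM, ImM, ReJ, ImJ) => h n0;
  by field; rewrite h n0.
Qed.

Lemma frame_e3 x y : frame x y *m col3 0 0 1 = hopf x y.
Proof. by apply: cV3P; rewrite mulmx3E !mat3E !col3E; ring. Qed.

Lemma spin_e3 l : spin l *m col3 0 0 1 = col3 0 0 1.
Proof. by apply: cV3P; rewrite mulmx3E !mat3E !col3E; ring. Qed.

(** Division by eps al leaves the ratio (be / al) tau / eps. The phase of be / al becomes a rotation
    about the third axis and is absorbed in Q; its modulus is 1 / rho. *)
Lemma hopf_bubble x y al be : nsq2 x y != 0 -> al != 0 -> be != 0 ->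
  exists2 Q, in_SO3 Q & exists2 rho : R, 0 < rho &
  Q *m col3 0 0 1 = hopf x y /\
  forall (eps : R) tau, 0 < eps ->
  - hopf x y - hopf (eps%:C * (al * x) + tau * (be * y^*))
                   (eps%:C * (al * y) + tau * (be * - x^*))
  = Q *m (stereo (pair_of (tau / (eps * rho)%:C)) - col3 0 0 1).
Proof.
move=> h al0 be0.
have na : 0 < nsq al by rewrite nsq_gt0.
have nb : 0 < nsq be by rewrite nsq_gt0.
pose rho := Num.sqrt (nsq al / nsq be).
have rho0 : 0 < rho by rewrite sqrtr_gt0 divr_gt0.
pose l := be / al * rho%:C.
have l1 : nsq l = 1.
  rewrite /l !nsqM nsq_real sqr_sqrtr ?ltW ?divr_gt0 // invcE nsqM nsqJ nsq_real.
  by field; rewrite !gt_eqF.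
exists (frame x y *m spin l); first by apply: in_SO3_mul; [exact: frame_SO3|exact: spin_SO3].
exists rho => //; split; first by rewrite -mulmxA spin_e3 frame_e3.
move=> eps tau e0; rewrite mulmxBr -!mulmxA spin_e3 frame_e3 stereo_spin // frame_stereo //.
rewrite addrC; congr (- _ - _).
have ec : eps%:C != 0 :> C by rewrite -nsq_gt0 nsq_real exprn_gt0.
have rc : rho%:C != 0 :> C by rewrite -nsq_gt0 nsq_real exprn_gt0.
rewrite -[RHS](hopf_scale _ _ (mulf_neq0 ec al0)); congr hopf;
  by rewrite /l rmorphM /=; field; rewrite ec rc al0.
Qed.
End Rotations.

(** * Bubbles in the coordinate of a disk automorphism *)

Section Bubbles.
Variable R : realType.
Local Open Scope complex_scope.
Local Notation "x ^*" := (conjc x) : ring_scope.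
Local Notation C := R[i].
Local Notation Re := complex.Re.
Local Notation Im := complex.Im.

Definition cplx (z : R * R) : C := Complex z.1 z.2.

Lemma nsq_cplx z : nsq (cplx z) = sqn2 z.
Proof. by rewrite /nsq /sqn2 /dot2 /= !expr2. Qed.

Definition mobius (xi : R) (z : R * R) : C :=
  (cplx z - xi%:C) / (1 - xi%:C * cplx z).

Lemma mobius_den xi z : -1 < xi < 1 -> closed_disk z -> 1 - xi%:C * cplx z != 0.
Proof.
move=> /andP[x1 x2]; rewrite /closed_disk /= /sqn2 /dot2 => hz.
apply/eqP => /(congr1 (fun c : C => Re c)); case: z hz => a b /= hz; nra.
Qed.

(** The factor 1 - |z|^2 is nonnegative on the disk and zero on the circle, which gives both
    [mobius_le1] and [mobius_eq1]. *)
Lemma mobius_nsq xi z :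
  nsq (1 - xi%:C * cplx z) - nsq (cplx z - xi%:C) = (1 - xi ^+ 2) * (1 - sqn2 z).
Proof. by case: z => a b; rewrite /nsq /sqn2 /dot2 /=; ring. Qed.

Lemma nsq_div (x y : C) : nsq (x / y) = nsq x / nsq y.
Proof.
have [->|y0] := eqVneq y 0.
  by rewrite invr0 mulr0 /nsq /= expr0n /= addr0 invr0 mulr0.
have n0 : nsq y != 0 by rewrite nsq_eq0.
by apply: (mulIf n0); rewrite -nsqM !divfK.
Qed.

Lemma mobius_le1 xi z : -1 < xi < 1 -> closed_disk z -> nsq (mobius xi z) <= 1.
Proof.
move=> hx hz; have d0 := mobius_den hx hz; rewrite nsq_div ler_pdivrMr ?nsq_gt0 // mul1r.
rewrite -subr_ge0 mobius_nsq mulr_ge0 // subr_ge0 //.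
by move/andP: hx => [h1 h2]; nra.
Qed.

Lemma mobius_eq1 xi z : -1 < xi < 1 -> circle z -> nsq (mobius xi z) = 1.
Proof.
move=> hx hz; have d0 : 1 - xi%:C * cplx z != 0.
  by apply: mobius_den => //; rewrite /closed_disk /= hz.
have E := mobius_nsq xi z; rewrite hz subrr mulr0 in E.
by rewrite nsq_div -(subr0_eq E) divff // nsq_eq0.
Qed.

Lemma mobius_center xi : mobius xi (xi, 0) = 0.
Proof. by rewrite /mobius (_ : cplx _ = xi%:C) // subrr mul0r. Qed.

Lemma mobius_onto xi (t : C) : -1 < xi < 1 -> nsq t < 1 ->
  exists2 z, disk z & mobius xi z = t.
Proof.
move=> hx ht; have x1 : xi ^+ 2 < 1 by move/andP: hx => [h1 h2]; nra.
have d0 : 1 + xi%:C * t != 0.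
  apply/eqP => h; have h2 : xi%:C * t = - 1 by apply/eqP; rewrite -subr_eq0 opprK addrC h.
  have : nsq (xi%:C * t) = 1.
    by rewrite h2 nsqN -(rmorph1 (real_complex R)) nsq_real expr1n.
  rewrite nsqM nsq_real => h1; have := nsq_ge0 t; have := sqr_ge0 xi; nra.
pose w := (t + xi%:C) / (1 + xi%:C * t).
have xc : 1 - xi%:C ^+ 2 != 0 :> C.
  rewrite -rmorphXn -(rmorph1 (real_complex R)) -rmorphB /= -nsq_gt0 nsq_real.
  by rewrite exprn_gt0 // subr_gt0.
have ew : cplx (pair_of w) = w by case: (w).
exists (pair_of w).
  rewrite /disk /= -nsq_cplx ew nsq_div ltr_pdivrMr ?nsq_gt0 // mul1r -subr_gt0.
  have -> : nsq (1 + xi%:C * t) - nsq (t + xi%:C) = (1 - xi ^+ 2) * (1 - nsq t).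
    by case: (t) => a b; rewrite /nsq /=; ring.
  by rewrite mulr_gt0 // subr_gt0.
have num : w - xi%:C = t * (1 - xi%:C ^+ 2) / (1 + xi%:C * t) by rewrite /w; field.
have den : 1 - xi%:C * w = (1 - xi%:C ^+ 2) / (1 + xi%:C * t) by rewrite /w; field.
by rewrite /mobius ew num den; field; rewrite d0 xc.
Qed.

(** With this scale and this [a] the quotient zeta / (1 - conj a zeta) is exactly
    [mobius xi z / s]. *)
Definition bubble_at (s xi : R) := bubble (s * (1 - xi ^+ 2)) (xi, 0) (s * xi, 0) (0, 0).

Lemma bubbleE s xi z : 0 < s -> -1 < xi < 1 -> closed_disk z ->
  bubble_at s xi z = stereo (pair_of (mobius xi z ^+ 2 / (s ^+ 2)%:C)).
Proof.
move=> s0 hx hz; have d0 := mobius_den hx hz.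
have x1 : 0 < 1 - xi ^+ 2 by move/andP: hx => [h1 h2]; nra.
have n0 : 0 < nsq (1 - xi%:C * cplx z) by rewrite nsq_gt0.
rewrite /bubble_at /bubble; set zeta := _ *: _; set den := 1 - _ + _.
(* Positive on the closed disk, so the default branch of [bubble] is never taken there. *)
have dE : den = nsq (1 - xi%:C * cplx z) / (1 - xi ^+ 2) ^+ 2.
  rewrite /den /zeta; case: (z) => a b; rewrite /sqn2 /dot2 /nsq /= /GRing.scale /=.
  by field; rewrite !gt_eqF.
rewrite dE mulf_eq0 invr_eq0 sqrf_eq0 !gt_eqF //=.
congr stereo.
have sc : s%:C != 0 :> C by rewrite -nsq_gt0 nsq_real exprn_gt0.
have -> : mobius xi z ^+ 2 / (s ^+ 2)%:C = (mobius xi z / s%:C) ^+ 2.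
  by rewrite rmorphXn /=; field; rewrite sc.
have TE : mobius xi z / s%:C =
  (s^-1 / nsq (1 - xi%:C * cplx z))%:C * ((cplx z - xi%:C) * (1 - xi%:C * cplx z)^*).
  by rewrite /mobius invcE rmorphM /= !fmorphV /=; ring.
rewrite TE addr0; set n := nsq _ in n0 dE *.
rewrite /zeta; case: (z) n n0 {dE TE d0 hz zeta den} => a b n n0.
rewrite /pair_of /csqr /sqn2 /dot2 ![in RHS]expr2 /= /GRing.scale /= /scale_pair /=.
rewrite /GRing.scale /=.
by congr pair; field; rewrite !gt_eqF.
Qed.
End Bubbles.

(** * Harmonic extension and projection of the bubbles *)

Section Projection.
Variable R : realType.
Local Open Scope complex_scope.
Local Notation "x ^*" := (conjc x) : ring_scope.
Local Notation C := R[i].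
Local Notation Re := complex.Re.
Local Notation Im := complex.Im.

Definition czvar : ex R * ex R := (@EX R, @EY R).

Definition cinvx (f : ex R * ex R) : ex R * ex R :=
  let q := EInv (EAdd (EMul f.1 f.1) (EMul f.2 f.2)) in
  (EMul f.1 q, EOpp (EMul f.2 q)).

Lemma holo_zvar z : holo czvar z.
Proof. by do !split; rewrite //= oppr0. Qed.

Lemma cev_zvar z : cev czvar z = cplx z. Proof. by []. Qed.

Lemma cev_inv f z : cev (cinvx f) z = (cev f z)^-1.
Proof.
by rewrite invcE; apply: eqcP; rewrite ?ReM ?ImM ?ReJ ?ImJ /nsq /= !expr2; ring.
Qed.

Lemma holo_inv f z : cev f z != 0 -> holo f z -> holo (cinvx f) z.
Proof.
rewrite -nsq_gt0 /nsq /= !expr2 => f0 [[w1 w2] [h1 h2]]; have n0 := lt0r_neq0 f0.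
split; first by do !split.
by split; rewrite /= /Dx /Dy /= -!/(Dx _) -!/(Dy _) h1 h2; field.
Qed.

Definition mobius_sq_ex (xi : R) : ex R * ex R :=
  let t := cmul (cadd czvar (cC (- xi%:C)))
                (cinvx (cadd (cC 1) (cmul (cC (- xi%:C)) czvar))) in
  cmul t t.

Lemma cev_mobius_sq xi z : cev (mobius_sq_ex xi) z = mobius xi z ^+ 2.
Proof.
rewrite !cev_mul cev_inv !cev_add !cev_mul !cev_C cev_zvar expr2 /mobius.
by rewrite mulNr.
Qed.

Lemma holo_mobius_sq xi z : -1 < xi < 1 -> closed_disk z -> holo (mobius_sq_ex xi) z.
Proof.
move=> hx hz.
suff : holo (cmul (cadd czvar (cC (- xi%:C)))
                (cinvx (cadd (cC 1) (cmul (cC (- xi%:C)) czvar)))) z.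
  by move=> h; exact: holo_mul.
apply: holo_mul; first by apply: holo_add; [exact: holo_zvar|exact: holo_C].
apply: holo_inv.
  by rewrite cev_add cev_mul !cev_C mulNr; exact: mobius_den.
apply: holo_add; first exact: holo_C.
by apply: holo_mul; [exact: holo_C|exact: holo_zvar].
Qed.

(* The bounded harmonic function with the boundary values of the bubble, in the
   coordinate t = (mobius xi z)^2 in which these are affine. *)
Definition hext (s : R) (t : C) : 'cV[R]_3 :=
  col3 (2 * s ^+ 2 * Re t / (1 + s ^+ 4)) (2 * s ^+ 2 * Im t / (1 + s ^+ 4))
       ((1 - s ^+ 4) / (1 + s ^+ 4)).

Definition hext_ex (Q : 'M[R]_3) (s xi : R) : ex R * ex R * ex R :=
  let t := mobius_sq_ex xi in let k := (1 + s ^+ 4)^-1 in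
  let row i := EAdd (EAdd (EMul (EC (Q i (inord 0) * (2 * s ^+ 2) * k)) t.1)
                          (EMul (EC (Q i (inord 1) * (2 * s ^+ 2) * k)) t.2))
                    (EC (Q i (inord 2) * (1 - s ^+ 4) * k)) in
  (row (inord 0), row (inord 1), row (inord 2)).

Lemma s4_neq0 (s : R) : 1 + s ^+ 4 != 0.
Proof. by rewrite gt_eqF // ltr_pwDl // (exprM s 2 2) sqr_ge0. Qed.

Lemma ev3_hext Q s xi z :
  ev3 (hext_ex Q s xi) z = Q *m hext s (mobius xi z ^+ 2).
Proof.
rewrite -cev_mobius_sq /ev3 /hext_ex; move: (mobius_sq_ex xi) => t.
by apply: cV3P; rewrite mulmx3E !col3E /=; ring.
Qed.

Lemma open_disk : open (@disk R).
Proof.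
have c : continuous (fun z : R * R => sqn2 z).
  by move=> z; apply: (@continuous_ev R (EAdd (EMul (@EX R) (@EX R)) (EMul (@EY R) (@EY R))) z).
have -> : @disk R = (fun z : R * R => sqn2 z) @^-1` [set x | x < 1] by [].
by apply: open_comp; [move=> z _; exact: c|exact: open_lt].
Qed.

Lemma disk_closed z : disk z -> closed_disk (z : R * R).
Proof. exact: ltW. Qed.
Lemma circle_closed z : circle z -> closed_disk (z : R * R).
Proof. by rewrite /circle /closed_disk /= => ->. Qed.

Definition projected (Q : 'M[R]_3) (s xi : R) z : 'cV[R]_3 :=
  Q *m bubble_at s xi z - Q *m hext s (mobius xi z ^+ 2).

(** On |t| = 1 the denominator of the stereographic projection is constant. *)
Lemma stereo_boundary s (t : C) : 0 < s -> nsq t = 1 ->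
  stereo (pair_of (t / (s ^+ 2)%:C)) = hext s t.
Proof.
move=> s0 t1; rewrite stereo_pair nsq_div nsq_real t1.
have s2 : s ^+ 2 != 0 by rewrite gt_eqF // exprn_gt0.
have n0 := s4_neq0 s.
have -> : t / (s ^+ 2)%:C = (s ^- 2)%:C * t by rewrite fmorphV /= mulrC.
have hr : Re ((s ^- 2)%:C * t) = s ^- 2 * Re t by rewrite ReM /=; ring.
have hi : Im ((s ^- 2)%:C * t) = s ^- 2 * Im t by rewrite ImM /=; ring.
have d : 1 + 1 / s ^+ 2 ^+ 2 != 0.
  by rewrite gt_eqF // ltr_pwDl // divr_ge0 // -exprM (exprM s 2 2) sqr_ge0.
have s1 : s != 0 by rewrite gt_eqF.
have d' : s ^+ 4 + 1 != 0 by rewrite addrC.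
by rewrite hr hi /hext; apply: col3_eqP; field; rewrite ?n0 ?s1 ?d'.
Qed.

(** The extension is harmonic, being affine in the real and imaginary parts of the holomorphic
    function [mobius xi z ^+ 2]. *)
Lemma projected_is_projection Q s xi : 0 < s -> -1 < xi < 1 ->
  is_projection (fun z => Q *m bubble_at s xi z) (projected Q s xi).
Proof.
move=> s0 hx; exists (fun z => Q *m hext s (mobius xi z ^+ 2)); last by [].
have rep A : A `<=` @closed_disk R ->
    represents A (fun z => Q *m hext s (mobius xi z ^+ 2)) (hext_ex Q s xi).
  move=> sA z /sA hz; split; last by rewrite ev3_hext.
  have := holo_mobius_sq hx hz; rewrite /hext_ex.
  by move: (mobius_sq_ex xi) => t [[? ?] _]; do !split.
have repD := rep _ disk_closed.
split.
- exact: represents_continuous_closed (rep _ (@subset_refl _ _)).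
- exact: represents_C2 open_disk repD.
- move=> z hz; rewrite (represents_laplacian open_disk repD hz).
  have [l1 l2] := holo_harmonic open_disk
    (fun y hy => holo_mobius_sq hx (disk_closed hy)) hz.
  have gen (x y p q p' q' k : R) : p + p' = 0 -> q + q' = 0 ->
     x * p + y * q + (x * p' + y * q') = 0.
    by move=> h1 h2; rewrite addrACA -!mulrDr h1 h2 !mulr0 addr0.
  have simp (a b d : R) (f1 f2 : ex R) :
     let e := EAdd (EAdd (EMul (EC a) f1) (EMul (EC b) f2)) (EC d) in
     ev (Dx (Dx f1)) z + ev (Dy (Dy f1)) z = 0 ->
     ev (Dx (Dx f2)) z + ev (Dy (Dy f2)) z = 0 ->
     ev (Dx (Dx e)) z + ev (Dy (Dy e)) z = 0.
    move=> e h1 h2; rewrite -[RHS](gen a b _ _ _ _ 0 h1 h2).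
    by rewrite /e /Dx /Dy /=; ring.
  by apply: cV3P; rewrite [RHS]mxE col3E; exact: (simp _ _ _ _ _ l1 l2).
- move=> z hz; rewrite bubbleE //; last exact: circle_closed.
  by rewrite stereo_boundary // expr2 nsqM mobius_eq1 // mulr1.
Qed.

Lemma sq3_SO3 Q (v : 'cV[R]_3) : in_SO3 Q -> sq3 (Q *m v) = sq3 v.
Proof.
move=> [/mulmx1C Q1 _].
have sqE (w : 'cV[R]_3) : sq3 w = (w^T *m w) 0 0.
  by rewrite mxE; apply: eq_bigr => i _; rewrite mxE expr2.
by rewrite !sqE trmx_mul -mulmxA (mulmxA Q^T) Q1 mul1mx.
Qed.

Lemma norm_le_sq3 (v : 'cV[R]_3) (e : R) : 0 <= e -> sq3 v <= e ^+ 2 -> `|v| <= e.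
Proof.
move=> e0 h; apply: le_trans (norm_le_enorm _) _.
by rewrite -[leRHS]ger0_norm // -sqrtr_sqr ler_wsqrtr.
Qed.

(** The bubble shifted so as to vanish at infinity, hence negligible away from its node; its values
    lie on the unit sphere about - Q e3. *)
Definition bubble_part (Q : 'M[R]_3) (s xi : R) z : 'cV[R]_3 :=
  Q *m (stereo (pair_of (mobius xi z ^+ 2 / (s ^+ 2)%:C)) - col3 0 0 1).

(** The difference is Q (e3 - hext), of squared length 4 s^4 (|t|^2 + s^4) / (1 + s^4)^2 with |t| <=
    1. *)
Lemma projected_near Q s xi z : in_SO3 Q -> 0 < s -> -1 < xi < 1 -> closed_disk z ->
  `|projected Q s xi z - bubble_part Q s xi z| <= 2 * s ^+ 2.
Proof.
move=> hQ s0 hx hz; have n0 := s4_neq0 s.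
rewrite /projected /bubble_part bubbleE // mulmxBr.
have -> (a b c : 'cV[R]_3) : a - b - (a - c) = c - b by apply/matrixP => i j; rewrite !mxE; ring.
rewrite -mulmxBr; apply: norm_le_sq3; first by rewrite mulr_ge0 ?sqr_ge0.
rewrite sq3_SO3 //.
have t1 : nsq (mobius xi z ^+ 2) <= 1.
  have := mobius_le1 hx hz; rewrite expr2 nsqM; have := nsq_ge0 (mobius xi z) => *; nra.
rewrite /sq3 sum3E !subcE !col3E; move: t1; rewrite /nsq.
move: (Re _) (Im _) => a b t1.
have s4 : 0 < s ^+ 4 by rewrite exprn_gt0.
have -> : (0 - 2 * s ^+ 2 * a / (1 + s ^+ 4)) ^+ 2 + (0 - 2 * s ^+ 2 * b / (1 + s ^+ 4)) ^+ 2
   + (1 - (1 - s ^+ 4) / (1 + s ^+ 4)) ^+ 2 =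
   4 * s ^+ 4 * (a ^+ 2 + b ^+ 2 + s ^+ 4) / (1 + s ^+ 4) ^+ 2 by field.
rewrite ler_pdivrMr ?exprn_gt0 ?addr_gt0 // exprMn -exprM.
have -> : (2 : R) ^+ 2 * s ^+ (2 * 2) = 4 * s ^+ 4 by ring.
rewrite ler_wpM2l // ?mulr_ge0 ?ltW //.
nra.
Qed.

Lemma sq3_stereo_sub (t : C) : sq3 (stereo (pair_of t) - col3 0 0 1) = 4 / (1 + nsq t).
Proof.
rewrite stereo_pair /sq3 sum3E !subcE !col3E; have := nsq1_neq0 t.
by rewrite /nsq => h; field.
Qed.

(** The squared length is 4 / (1 + |t|^2 / s^4), at most 4 s^4 / |t|^2, for t the square of the disk
    coordinate. *)
Lemma bubble_part_small Q s xi z (e : R) : in_SO3 Q -> 0 < s -> 0 < e ->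
  4 * s ^+ 4 <= e ^+ 2 * nsq (mobius xi z ^+ 2) ->
  `|bubble_part Q s xi z| <= e.
Proof.
move=> hQ s0 e0 h; apply: norm_le_sq3; first exact: ltW.
rewrite sq3_SO3 // sq3_stereo_sub nsq_div nsq_real.
set t := nsq _ in h *; have t0 : 0 <= t by exact: nsq_ge0.
have s4 : 0 < s ^+ 4 by rewrite exprn_gt0.
rewrite -exprM ler_pdivrMr; last by rewrite ltr_pwDl // divr_ge0 // ltW.
rewrite mulrDr mulr1 mulrA; apply: le_trans (_ : e ^+ 2 * t / s ^+ 4 <= _).
  by rewrite ler_pdivlMr.
by rewrite lerDr sqr_ge0.
Qed.

Lemma bubble_part_sphere Q s xi z : in_SO3 Q ->
  sq3 (bubble_part Q s xi z + Q *m col3 0 0 1) = 1.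
Proof.
move=> hQ; rewrite /bubble_part mulmxBr subrK sq3_SO3 // stereo_pair.
move: (_ / (s ^+ 2)%:C) => t; rewrite /sq3 sum3E !col3E; have := nsq1_neq0 t.
by rewrite /nsq => h; field.
Qed.
End Projection.

(** * Choice of the spectral parameter and of the potential *)

Section Directions.
Variable R : realType.
Local Open Scope complex_scope.
Local Notation "x ^*" := (conjc x) : ring_scope.
Local Notation C := R[i].
Local Notation Re := complex.Re.
Local Notation Im := complex.Im.

Lemma angle_exists (a b : R) : a ^+ 2 + b ^+ 2 = 1 ->
  exists t : R, cos t = a /\ sin t = b.
Proof.
move=> h; have a1 : -1 <= a <= 1.
  by have := sqr_ge0 b; move=> hb; apply/andP; split; nra.
have ia : a \in `[(-1), 1] by rewrite in_itv.
have s2 : Num.sqrt (1 - a ^+ 2) = `|b| by rewrite -h addrC addKr sqrtr_sqr.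
have [b0|b0] := leP 0 b.
  by exists (acos a); rewrite acosK // sin_acos // s2 ger0_norm.
by exists (- acos a); rewrite cosN sinN acosK // sin_acos // s2 ltr0_norm // opprK.
Qed.

Lemma clog_exists (w : C) : w != 0 -> exists l, cexp l = w.
Proof.
rewrite -nsq_gt0 => w0; pose r := Num.sqrt (nsq w).
have r0 : 0 < r by rewrite sqrtr_gt0.
have r2 : r ^+ 2 = nsq w by rewrite sqr_sqrtr // ltW.
have [|t [ct st]] := @angle_exists (Re w / r) (Im w / r).
  by rewrite !expr_div_n -mulrDl r2 divff // gt_eqF.
exists (Complex (ln r) t); apply: eqcP; rewrite /= lnK ?posrE // ?ct ?st.
  by rewrite mulrC divfK // gt_eqF.
by rewrite mulrC divfK // gt_eqF.
Qed.

Lemma hopf_onto (v : 'cV[R]_3) : sq3 v = 1 ->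
  exists x y : C, nsq2 x y != 0 /\ hopf x y = v.
Proof.
rewrite /sq3 sum3E; set a := v (inord 0) 0; set b := v (inord 1) 0.
set d := v (inord 2) 0 => h.
have [d1|d1] := eqVneq d (-1).
  exists 0, 1; have E : nsq2 (0 : C) 1 = 1 by rewrite /nsq2 /nsq /=; ring.
  rewrite E oner_eq0; split => //.
  have ab : a ^+ 2 + b ^+ 2 = 0 by move: h; rewrite d1; lra.
  have [a0 b0] := sq_sum_eq0 ab.
  apply: cV3P; rewrite !col3E E divr1 -/a -/b -/d ?a0 ?b0 ?d1 ?ReM ?ImM /nsq /=; ring.
have d2 : 0 < 1 + d.
  have : -1 <= d by have := sqr_ge0 a; have := sqr_ge0 b => *; nra.
  by rewrite le_eqVlt eq_sym (negbTE d1) /= => ?; lra.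
exists (1 + d)%:C, (Complex a b).
have E : nsq2 (1 + d)%:C (Complex a b) = 2 * (1 + d).
  by rewrite /nsq2 /nsq /= expr0n /= addr0; move: h; nra.
have n0 : 2 * (1 + d) != 0 by rewrite gt_eqF // mulr_gt0.
rewrite E; split => //.
have hd : d = (2 * d * (1 + d)) / (2 * (1 + d)).
  by field; rewrite gt_eqF.
apply: cV3P; rewrite !col3E E -/a -/b -/d ?ReM ?ImM /nsq /=.
- by field; rewrite gt_eqF.
- by field; rewrite gt_eqF.
- by rewrite [RHS]hd; congr (_ / _); move: h; lra.
Qed.

(** The spinors (e^s, e^-s) miss only the two poles. A small shift makes both components of a
    preimage nonzero, and then s is half the logarithm of their quotient. *)
Lemma hopf_dense (v : 'cV[R]_3) (e : R) : sq3 v = 1 -> 0 < e ->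
  exists s : C, `|hopf (cexp s) (cexp (- s)) - v| < e.
Proof.
move=> /hopf_onto[x [y [n0 hv]]] e0.
have lim : hopf (x + t%:C) (y + t%:C) @[t --> (0 : R)^'+] --> hopf x y.
  have l0 : ccvg (0 : R)^'+ (fun t : R => t%:C) 0.
    by apply: ccvg_real; apply: cvg_at_right_filter; exact: cvg_id.
  by apply: cvg_hopf => //; rewrite -[X in ccvg _ _ X]addr0; apply: ccvgD => //; exact: ccvg_cst.
have near_e : \forall t \near (0 : R)^'+, `|hopf x y - hopf (x + t%:C) (y + t%:C)| < e.
  by move/cvgrPdist_lt : lim => /(_ _ e0).
have near_ne (w : C) : \forall t \near (0 : R)^'+, w + t%:C != 0.
  have [w0|w0] := ltP (Re w) 0.
    near=> t; apply/eqP => /(congr1 (fun c : C => Re c)) /=; rewrite ReD /=.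
    have : t < - Re w by near: t; apply: nbhs_right_lt; rewrite oppr_gt0.
    by clear => h1 h2; lra.
  near=> t; apply/eqP => /(congr1 (fun c : C => Re c)) /=; rewrite ReD /=.
  have : 0 < t by near: t; exact: nbhs_right_gt.
  by clear - w0 => h1 h2; lra.
have [t [[h1 h2] h3]] := filter_ex (filterI (filterI (near_ne x) (near_ne y)) near_e).
set x' := x + t%:C in h1 h3; set y' := y + t%:C in h2 h3.
have [l hl] := clog_exists (mulf_neq0 h1 (invr_neq0 h2)).
exists (l / 2); suff <- : hopf x' y' = hopf (cexp (l / 2)) (cexp (- (l / 2))).
  by rewrite -hv distrC.
have q0 := cexp_neq0 (l / 2).
rewrite -(hopf_scale x' y' (c := cexp (l / 2) / x')); last by rewrite mulf_neq0 // invr_neq0.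
congr hopf; first by rewrite divfK.
rewrite cexpN; apply: (mulIf q0); rewrite mulVf //.
have -> : cexp (l / 2) / x' * y' * cexp (l / 2) = cexp (l / 2) * cexp (l / 2) * (y' / x') by ring.
rewrite -cexpD -splitr hl; field; by rewrite h1 h2.
Unshelve. all: by end_near.
Qed.

Lemma floor_lim (a : R) :
  (Num.floor (a * n.+1%:R))%:~R / n.+1%:R @[n --> \oo] --> a.
Proof.
have h : a - (n.+1%:R)^-1 @[n --> \oo] --> a.
  by rewrite -[X in _ --> X]subr0; apply: cvgB; [exact: cvg_cst|exact: cvg_harmonic].
apply: (squeeze_cvgr _ h (cvg_cst a)); near=> n.
have n0 : 0 < n.+1%:R :> R by [].
have := floor_le (a * n.+1%:R); have := floorD1_gt (a * n.+1%:R).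
rewrite intrD => h1 h2; apply/andP; split; last by rewrite ler_pdivrMr.
rewrite ler_pdivlMr // mulrBl mulVf ?gt_eqF //; lra.
Unshelve. all: by end_near.
Qed.

Let c : C := pi%:C * 'i.

(** One parameter [sg] has to serve all k directions, so the freedom lies in the integers: along a
    suitable sequence of non-real [sg] tending to 0, the multiples of pi i sg become dense modulo pi
    i. *)
Lemma directions (k : nat) (v : 'I_k -> 'cV[R]_3) (e : R) :
  (forall i, sq3 (v i) = 1) -> 0 < e ->
  exists (sg : C) (n : 'I_k -> int), [/\ sg != 0, sg - 1 != 0 &
    forall i, `|hopf (cexp (c * sg * (n i)%:~R)) (cexp (- (c * sg * (n i)%:~R))) - v i| < e].
Proof.
move=> hv e0; have p0 : pi != 0 :> R by rewrite gt_eqF // pi_gt0.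
have e2 : 0 < e / 2 by rewrite divr_gt0.
pose s i := projT1 (cid (hopf_dense (hv i) e2)).
have hs i : `|hopf (cexp (s i)) (cexp (- s i)) - v i| < e / 2.
  exact: (projT2 (cid (hopf_dense (hv i) e2))).
(* With sg = 1/M - i/M^2 and N = J M + Q one has pi i sg N = w + pi i J, where w
   tends to s, and the term pi i J only changes the sign of the spinor. *)
pose J i (M : nat) : int := Num.floor (Re (s i) / pi * M.+1%:R).
pose Q i (M : nat) : int := Num.floor (Im (s i) / pi * M.+1%:R).
pose N i (M : nat) : int := J i M * M.+1%:Z + Q i M.
pose sg (M : nat) : C := Complex (M.+1%:R^-1) (- M.+1%:R ^- 2).
(* [J] steers the real part and [Q] the imaginary part; [Q] enters the real part only with a further
   factor 1 / M. *)
pose w i (M : nat) : C := Complex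
  (pi * ((J i M)%:~R / M.+1%:R + (Q i M)%:~R / M.+1%:R * M.+1%:R^-1))
  (pi * ((Q i M)%:~R / M.+1%:R)).
have lw i : ccvg \oo (w i) (s i).
  have E x : pi * (x / pi) = x :> R by rewrite mulrC divfK.
  rewrite /ccvg /=; split.
    have -> : Re (s i) = pi * (Re (s i) / pi + Im (s i) / pi * 0) by rewrite mulr0 addr0 E.
    apply: cvgMr; apply: cvgD; first exact: floor_lim.
    by apply: cvgM; [exact: floor_lim|exact: cvg_harmonic].
  by rewrite -[X in _ --> X]E; apply: cvgMr; exact: floor_lim.
have wE i M : exists b : C, b != 0 /\ cexp (c * sg M * (N i M)%:~R) = b * cexp (w i M)
   /\ cexp (- (c * sg M * (N i M)%:~R)) = b * cexp (- w i M).
  have m0 : M.+1%:R != 0 :> R by rewrite pnatr_eq0.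
  have nE : ((N i M)%:~R : C) = ((J i M)%:~R * M.+1%:R + (Q i M)%:~R)%:C.
    by rewrite /N intrD intrM rmorphD rmorphM /= !rmorph_int rmorph_nat.
  have D : c * sg M * (N i M)%:~R = w i M + Complex 0 (pi * (J i M)%:~R).
    rewrite nE /c /sg /w; apply: eqcP; rewrite !(ReM, ImM, ReD, ImD) /=; by field.
  exists (cexp (Complex 0 (pi * (J i M)%:~R))); split; first exact: cexp_neq0.
  rewrite D opprD !cexpD; split; first by rewrite mulrC.
  rewrite mulrC; congr (_ * _).
  apply: (mulIf (cexp_neq0 (Complex 0 (pi * (J i M)%:~R)))).
  rewrite mulrC cexpNK -cexpD.
  have -> : Complex 0 (pi * (J i M)%:~R) + Complex 0 (pi * (J i M)%:~R)
     = Complex 0 (2 * pi * (J i M)%:~R) :> C by apply: eqcP; rewrite ?ReD ?ImD /=; ring.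
  by rewrite cexp_int.
have lim i : \forall M \near \oo, `|hopf (cexp (s i)) (cexp (- s i)) -
    hopf (cexp (w i M)) (cexp (- w i M))| < e / 2.
  have : hopf (cexp (w i M)) (cexp (- w i M)) @[M --> \oo] --> hopf (cexp (s i)) (cexp (- s i)).
    apply: cvg_hopf; [exact: cexp_neq0_nsq2|exact: ccvg_cexp|].
    by apply: ccvg_cexp; exact: ccvgN.
  by move=> /cvgrPdist_lt /(_ _ e2).
have [M hM] := filter_ex (filter_forall _ lim).
exists (sg M), (fun i => N i M); split.
- apply/eqP => /(congr1 (fun z : C => Re z)) /= /eqP; rewrite invr_eq0.
  by rewrite pnatr_eq0.
- apply/eqP => /(congr1 (fun z : C => Im z)); rewrite ImD /= oppr0 addr0 => /eqP.
  by rewrite oppr_eq0 invr_eq0 expf_eq0 /= pnatr_eq0.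
move=> i; have [b [b0 [-> ->]]] := wE i M; rewrite hopf_scale //.
have h1 := hs i; have h2 := hM i.
set A := hopf (cexp (w i M)) _ in h2 *; set B := hopf (cexp (s i)) _ in h1 h2; rewrite distrC in h2.
have -> : A - v i = (A - B) + (B - v i) by rewrite addrA subrK.
by apply: le_lt_trans (ler_normD _ _) _; rewrite (splitr e) ltrD.
Qed.
End Directions.

(** * Polynomials with prescribed integer values *)

Section Potential.
Variable R : realType.
Local Open Scope complex_scope.
Local Notation "x ^*" := (conjc x) : ring_scope.
Local Notation C := R[i].
Local Notation Re := complex.Re.
Local Notation Im := complex.Im.

Fixpoint cpoly (s : seq C) (f : ex R * ex R) : ex R * ex R :=
  if s is a :: s' then cadd (cmul (cpoly s' f) f) (cC a) else cC 0.

Lemma cev_poly (p : {poly C}) f z : cev (cpoly p f) z = p.[cev f z].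
Proof.
rewrite /horner; elim: (polyseq p) => [|a s IH] /=; first exact: cev_C.
by rewrite cev_add cev_mul IH cev_C.
Qed.

Lemma holo_poly (s : seq C) f z : holo f z -> holo (cpoly s f) z.
Proof.
move=> hf; elim: s => [|a s IH] /=; first exact: holo_C.
by apply: holo_add; [exact: holo_mul|exact: holo_C].
Qed.

Lemma ccvg_horner T (F : set_system T) {FF : Filter F} (f : T -> C) l (p : {poly C}) :
  ccvg F f l -> ccvg F (fun t => p.[f t]) p.[l].
Proof.
move=> fl; elim/poly_ind: p => [|p a IH].
  by rewrite horner0; under eq_fun do rewrite horner0; exact: ccvg_cst.
rewrite hornerMXaddC; under eq_fun do rewrite hornerMXaddC.
by apply: ccvgD; [exact: ccvgM|exact: ccvg_cst].
Qed.

Lemma ccvg_cplx (z0 : R * R) : ccvg (nbhs z0) (@cplx R) (cplx z0).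
Proof. by split; [exact: cvg_fst|exact: cvg_snd]. Qed.

(** The first property keeps [P] from being an integer on the real line off the nodes; the nonzero
    [U] makes the contact at a node exactly double, which is the source of the degree 2. *)
Lemma interpolant (k : nat) (x : 'I_k -> R) (n : 'I_k -> int) : injective x ->
  exists P : {poly C}, (forall t : R, Im P.[t%:C] = 0 -> exists i, t = x i) /\
  forall i, exists U : {poly C}, U.[(x i)%:C] != 0 /\
     P = ((n i)%:~R)%:P + ('X - ((x i)%:C)%:P) ^+ 2 * U.
Proof.
move=> xinj.
pose W : {poly R} := \prod_i ('X - (x i)%:P).
pose L i : {poly R} := \prod_(j | j != i) ((x i - x j)^-1 *: ('X - (x j)%:P)).
(* L^2 (3 - 2 L) is flat at L = 0 and at L = 1, so each summand agrees with its nodal value to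
   second order. *)
pose pr : {poly R} := \sum_j (n j)%:~R *: (L j ^+ 2 * (3 - 2 * L j)).
pose phi := map_poly (real_complex R).
(* On the real line Im P = W^2 vanishes at the nodes only, to order exactly 2,
   while the Hermite interpolant pr matches n there to order 2. *)
pose P : {poly C} := phi pr + ('i)%:P * phi (W ^+ 2).
have phiE (p : {poly R}) (t : R) : (phi p).[t%:C] = (p.[t])%:C by rewrite horner_map.
exists P; split.
  move=> t; rewrite /P hornerD hornerM hornerC !phiE ImD ImM /= !horner_exp => h.
  have W0 : W.[t] = 0 by apply/eqP; rewrite -sqrf_eq0; apply/eqP; move: h; lra.
  move: W0; rewrite /W horner_prod => /eqP /prodf_eq0[i _].
  by rewrite hornerXsubC subr_eq0 => /eqP ->; exists i.
move=> i.
have L1 j : j != i -> ('X - (x i)%:P) %| L j.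
  move=> ji; rewrite /L (bigD1 i) 1?eq_sym //=; apply: dvdp_mulr.
  by rewrite dvdpZr // invr_eq0 subr_eq0; apply: contra ji => /eqP /xinj ->.
have L2 : ('X - (x i)%:P) %| L i - 1.
  rewrite dvdp_XsubCl /root hornerD hornerN hornerC /L horner_prod big1 ?subrr // => j ji.
  rewrite hornerZ hornerXsubC mulVf // subr_eq0.
  by apply: contra ji => /eqP /xinj ->.
have D : ('X - (x i)%:P) ^+ 2 %| pr - ((n i)%:~R)%:P.
  rewrite /pr (bigD1 i) //= addrAC; apply: dvdp_add.
    have -> : (n i)%:~R *: (L i ^+ 2 * (3 - 2 * L i)) - ((n i)%:~R)%:P =
      (L i - 1) ^+ 2 * (- (n i)%:~R *: (2 * L i + 1)).
      by rewrite -!mul_polyC polyCN; ring.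
    by apply: dvdp_mulr; exact: dvdp_exp2r.
  apply: (big_ind (fun q => _ %| q)) => [|p q|j ji]; [exact: dvdp0|exact: dvdp_add|].
  by rewrite -mul_polyC dvdp_mull // dvdp_mulr // dvdp_exp2r // L1.
have [u hu] := dvdpP _ _ D.
pose Wi : {poly R} := \prod_(j | j != i) ('X - (x j)%:P).
have WE : W = ('X - (x i)%:P) * Wi by rewrite /W (bigD1 i).
(* The imaginary part at [x i] is the square of [Wi], nonzero because the other nodes differ from
   [x i]. *)
exists (phi u + ('i)%:P * phi (Wi ^+ 2)); split.
  rewrite hornerD hornerM hornerC !phiE.
  apply/eqP => /(congr1 (fun z : C => Im z)); rewrite ImD ImM /= horner_exp => h.
  have : Wi.[x i] = 0 by apply/eqP; rewrite -sqrf_eq0; apply/eqP; move: h; lra.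
  rewrite /Wi horner_prod => /eqP /prodf_eq0[j ji].
  by rewrite hornerXsubC subr_eq0 => /eqP /xinj E; rewrite E eqxx in ji.
have -> : 'X - ((x i)%:C)%:P = phi ('X - (x i)%:P) by rewrite /phi map_polyXsubC.
have -> : ((n i)%:~R)%:P = phi (((n i)%:~R)%:P).
  rewrite /phi map_polyC; congr (_%:P); exact: esym (rmorph_int (real_complex R) _).
have prE : pr = ((n i)%:~R)%:P + ('X - (x i)%:P) ^+ 2 * u by rewrite mulrC -hu addrC subrK.
have phiD (p q : {poly R}) : phi (p + q) = phi p + phi q by exact: rmorphD.
have phiM (p q : {poly R}) : phi (p * q) = phi p * phi q by exact: rmorphM.
by rewrite /P prE WE !expr2 !(phiD, phiM); ring.
Qed.

(** Near a real point off the nodes Im P stays away from 0. Near a node an integer value of [P] can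
    only be [n i], by continuity, and as [U] is nonzero there it is taken at the node alone.
    Compactness of [-1, 1] makes [d] uniform; the factor 2 matches the bound on the imaginary part
    of the logarithm. *)
Lemma thin_strip (k : nat) (x : 'I_k -> R) (n : 'I_k -> int) (P : {poly C}) :
  (forall t : R, Im P.[t%:C] = 0 -> exists i, t = x i) ->
  (forall i, exists U : {poly C}, U.[(x i)%:C] != 0 /\
     P = ((n i)%:~R)%:P + ('X - ((x i)%:C)%:P) ^+ 2 * U) ->
  exists2 d : R, 0 < d <= 1 & forall a b : R, -1 <= a <= 1 -> `|b| <= 2 * d ->
    (exists m : int, P.[Complex a b] = m%:~R) -> exists i, Complex a b = (x i)%:C.
Proof.
move=> hP hU.
have loc (a0 : R) : \forall q \near (a0, 0 : R),
    (exists m : int, P.[cplx q] = m%:~R) -> exists i, cplx q = (x i)%:C.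
  have lP : ccvg (nbhs (a0, 0 : R)) (fun q => P.[cplx q]) P.[cplx (a0, 0)].
    by apply: ccvg_horner; exact: ccvg_cplx.
  have intIm (m : int) : Im (m%:~R : C) = 0 by rewrite -(rmorph_int (real_complex R)).
  have intRe (m : int) : Re (m%:~R : C) = m%:~R by rewrite -(rmorph_int (real_complex R)).
  have [im0|im0] := eqVneq (Im P.[a0%:C]) 0; last first.
    have [_ l2] := lP; have im1 : 0 < `|Im P.[a0%:C]| by rewrite normr_gt0.
    move/cvgrPdist_lt: l2 => /(_ _ im1); apply: filterS => q h [m hm].
    by move: h; rewrite hm intIm subr0 ltxx.
  have [i ai] := hP _ im0; have [U [U0 PE]] := hU i.
  have lU : ccvg (nbhs (a0, 0 : R)) (fun q => U.[cplx q]) U.[cplx (a0, 0)].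
    by apply: ccvg_horner; exact: ccvg_cplx.
  have E0 : cplx (a0, 0) = (x i)%:C by rewrite ai.
  have nU : \forall q \near (a0, 0 : R), U.[cplx q] != 0.
    by apply: ccvg_neq0 lU; rewrite E0.
  have Pn : P.[(x i)%:C] = (n i)%:~R.
    by rewrite PE !hornerE /= subrr expr0n /= mul0r addr0.
  have [l1 _] := lP; rewrite E0 Pn in l1.
  move/cvgrPdist_lt: l1 => /(_ _ ltr01) h1.
  apply: filterS2 nU h1 => q Uq h [m hm]; exists i.
  have mn : m = n i.
    have : `|n i - m| < 1 by rewrite -(ltr_int R) intr_norm intrB -!intRe -hm.
    rewrite ltr_norml => /andP[h1 h2]; apply/eqP; rewrite eq_le -subr_le0 -[X in _ && X]subr_le0.
    by rewrite -![_ <= 0]ltzD1 !add0r h2 andbT -opprB ltrNl.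
  have := hm; rewrite mn PE hornerD hornerC -[RHS]addr0 => /addrI /eqP.
  rewrite hornerM mulf_eq0 (negbTE Uq) orbF horner_exp hornerXsubC sqrf_eq0 subr_eq0.
  by move=> /eqP.
have K := (compact_near_coveringP _).1 (@segment_compact R (-1) 1).
pose Q (d a : R) := forall b : R, `|b| <= 2 * d ->
    (exists m : int, P.[Complex a b] = m%:~R) -> exists i, Complex a b = (x i)%:C.
have step (a : R) : `[(-1), 1]%classic a ->
    \forall a' \near a & d \near (0 : R)^'+, Q d a'.
  move=> _; have [[A B] /= [An Bn] AB] := loc a.
  have [r /= r0 rB] := Bn.
  exists (A, [set d : R | 2 * d < r]) => /=.
    split => //; near=> d; rewrite /= mulrC -ltr_pdivlMr //.
    by near: d; apply: nbhs_right_lt; rewrite divr_gt0.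
  move=> [a' d] /= [Aa dr] b hb hm; apply: (AB (a', b)) => //; split => //=.
  by apply: rB; rewrite /= sub0r normrN; exact: le_lt_trans dr.
have H : \forall d \near (0 : R)^'+, `[(-1), 1]%classic `<=` Q d by exact: K.
have [d [[d0 d1] hd]] := filter_ex
  (filterI (filterI (nbhs_right_gt (0 : R)) (nbhs_right_lt (ltr01 : 0 < 1 :> R))) H).
exists d; first by rewrite d0 ltW.
by move=> a b ha; apply: hd; rewrite /= in_itv.
Unshelve. all: by end_near.
Qed.
End Potential.

(** * Transfer to the disk by a logarithm *)

Section LogPotential.
Variable R : realType.
Local Open Scope complex_scope.
Local Notation "x ^*" := (conjc x) : ring_scope.
Local Notation C := R[i].
Local Notation Re := complex.Re.
Local Notation Im := complex.Im.

(* Principal branch of log (1 + rho z). *)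
Definition logx (rho : R) : ex R * ex R :=
  let a := EAdd (EC 1) (EMul (EC rho) (@EX R)) in let b := EMul (EC rho) (@EY R) in
  (EMul (EC 2^-1) (ELn (EAdd (EMul a a) (EMul b b))), EAtan (EMul b (EInv a))).

Definition half_plane (rho : R) : set (R * R) := [set z | 0 < 1 + rho * z.1].

Lemma sq_sum_gt0 (a b : R) : 0 < a -> 0 < a * a + b * b.
Proof. by move=> a0; rewrite ltr_pwDl ?mulr_gt0 // -expr2 sqr_ge0. Qed.

Lemma holo_log rho z : half_plane rho z -> holo (logx rho) z.
Proof.
case: z => x y; rewrite /half_plane /= => a0.
have n0 := sq_sum_gt0 (rho * y) a0.
split; first by do !split => //=; rewrite gt_eqF.
move: n0 a0; rewrite /cauchy_riemann /Dx /Dy /= => n0 a0.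
have n1 := lt0r_neq0 n0; have a1 := lt0r_neq0 a0.
have E (a b : R) : a != 0 -> a * a + b * b != 0 ->
    (1 + b * a^-1 * (b * a^-1))^-1 = a * a / (a * a + b * b).
  move=> h1 h2; have h3 : 1 + b * a^-1 * (b * a^-1) = (a * a + b * b) / (a * a) by field.
  by rewrite h3 invf_div.
rewrite !E //; split; field; by rewrite ?a1 ?n1.
Qed.

(** Both sides have positive real part, since cos (atan t) > 0, so the real parts agree once their
    squares do; the imaginary parts follow from b = t a. *)
Lemma cexp_log rho z : half_plane rho z ->
  cexp (cev (logx rho) z) = 1 + rho%:C * cplx z.
Proof.
case: z => x y; rewrite /half_plane /= => a0; have n0 := sq_sum_gt0 (rho * y) a0.
set a := 1 + rho * x in a0 n0; set b := rho * y in n0.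
have -> : 1 + rho%:C * cplx (x, y) = Complex a b :> C.
  by apply: eqcP; rewrite ?(ReD, ImD, ReM, ImM) /= /a /b; ring.
pose t := b / a; pose r := expR (2^-1 * ln (a * a + b * b)).
have r0 : 0 < r by exact: expR_gt0.
have r2 : r * r = a * a + b * b.
  by rewrite -expRD -mulrDl -div1r -splitr mul1r lnK.
have c0 : 0 < cos (atan t).
  by rewrite cos_atan invr_gt0 sqrtr_gt0 ltr_pwDl ?sqr_ge0.
have c2 : cos (atan t) ^+ 2 * (1 + t ^+ 2) = 1.
  have p : 0 < 1 + t ^+ 2 by rewrite ltr_pwDl ?sqr_ge0.
  by rewrite cos_atan exprVn sqr_sqrtr ?(ltW p) // mulVf // gt_eqF.
have st : sin (atan t) = t * cos (atan t).
  by rewrite -{2}(atanK t) /tan divfK // gt_eqF.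
have bt : b = t * a by rewrite /t divfK // gt_eqF.
have rc : r * cos (atan t) = a.
  apply/eqP; rewrite -(@eqrXn2 _ 2) ?ltW ?mulr_gt0 //; apply/eqP.
  have -> : (r * cos (atan t)) ^+ 2 = (r * r) * cos (atan t) ^+ 2 by ring.
  rewrite r2 bt -[RHS]mulr1 -c2; ring.
apply: eqcP; rewrite /= -/a -/b -/t -/r //.
by rewrite st mulrCA rc -bt.
Qed.

Lemma ccvg_cev (f : ex R * ex R) (z : R * R) : ok2 f z -> ccvg (nbhs z) (cev f) (cev f z).
Proof. by case=> h1 h2; split; [exact: (continuous_ev h1)|exact: (continuous_ev h2)]. Qed.

Lemma closed_disk_coord (z : R * R) : closed_disk z -> -1 <= z.1 <= 1.
Proof.
case: z => x y; rewrite /closed_disk /sqn2 /dot2 /= => h.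
by apply/andP; split; nra.
Qed.

(** |1 + rho z| lies between 1 - rho and 2, with ln 2 <= 1, and its argument is below pi / 2 < 2. *)
Lemma log_bounds (rho : R) (z : R * R) : 0 < rho < 1 -> closed_disk z ->
  ln (1 - rho) <= Re (cev (logx rho) z) <= 1 /\ `|Im (cev (logx rho) z)| <= 2.
Proof.
move=> /andP[r0 r1] hz; have /andP[x1 x2] := closed_disk_coord hz.
have hp : half_plane rho z by rewrite /half_plane /=; nra.
have := congr1 (@nsq R) (cexp_log hp); rewrite nsq_cexp.
have -> : nsq (1 + rho%:C * cplx z) = (1 + rho * z.1) ^+ 2 + (rho * z.2) ^+ 2.
  by case: (z) => x y; rewrite /nsq /=; ring.
set l := Re _ => hl; have l0 := expR_gt0 l.
split; last first.
  have := atan_gtNpi2 (rho * z.2 / (1 + rho * z.1)).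
  have := atan_ltpi2 (rho * z.2 / (1 + rho * z.1)).
  have := @pihalf_lt2 R; rewrite /= ler_norml; move=> p1 p2 p3; apply/andP; split; lra.
apply/andP; split.
  have h1 : 1 - rho <= 1 + rho * z.1 by nra.
  have r2 : 0 < 1 - rho by rewrite subr_gt0.
  have h2 : (1 - rho) ^+ 2 <= expR l ^+ 2.
    rewrite hl; apply: (@le_trans _ _ ((1 + rho * z.1) ^+ 2)); last by rewrite lerDl sqr_ge0.
    by rewrite ler_pXn2r ?nnegrE //; lra.
  rewrite -[leRHS]expRK ler_ln ?posrE //.
  by move: h2; rewrite ler_pXn2r // nnegrE ltW.
rewrite -ler_expR; apply: le_trans (_ : 2 <= _); last first.
  by apply: le_trans (expR_ge1Dx 1).
have : expR l ^+ 2 <= 2 ^+ 2; last by rewrite ler_pXn2r // nnegrE ltW.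
rewrite hl; move: hz; rewrite /closed_disk /sqn2 /dot2 /=; nra.
Qed.

(** The local form is stated in the square of the disk automorphism, not of z - xi, because the
    boundary values of the bubble are explicit in that coordinate. *)
Lemma potential_exists (k : nat) (n : 'I_k -> int) :
  exists (A : set (R * R)) (g : ex R * ex R) (xi : 'I_k -> R),
  [/\ open A, @closed_disk R `<=` A, (forall z, A z -> holo g z),
      injective xi & forall i, -1 < xi i < 1] /\
  (forall z, closed_disk z -> (exists m : int, cev g z = m%:~R) ->
     exists i, z = (xi i, 0)) /\
  forall i, cev g (xi i, 0) = (n i)%:~R /\
    exists (V : R * R -> C) (V0 : C), [/\ V0 != 0, ccvg (nbhs (xi i, 0 : R)) V V0 &
      \forall z \near (xi i, 0 : R), cev g z = (n i)%:~R + mobius (xi i) z ^+ 2 * V z].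
Proof.
(* Negative nodes: the image of the real diameter under d log (1 + rho z) starts at -1 for every d,
   but its right end shrinks with d. *)
pose x (i : 'I_k) : R := - (i.+1%:R / k.+1%:R).
have k0 : 0 < k.+1%:R :> R by [].
have xinj : injective x.
  move=> i j /oppr_inj /(divIf (lt0r_neq0 k0)) /eqP; rewrite eqr_nat eqSS => /eqP.
  exact: val_inj.
have x1 i : -1 < x i < 0.
  rewrite /x oppr_lt0 divr_gt0 // ltrN2 ltr_pdivrMr // mul1r ltr_nat ltnS ltn_ord //.
(* d log(1 + rho z) maps the closed disk into the strip of half-width 2 d over
   [-1, 1], and the nodes x_i lie in the image of the real diameter. *)
have [P [hP hU]] := interpolant n xinj.
have [d /andP[d0 d1] hd] := thin_strip hP hU.
have dn : d != 0 by rewrite gt_eqF.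
(* Chosen so that [d * ln (1 - rho) = -1]. *)
pose rho := 1 - expR (- d^-1).
have e1 : expR (- d^-1) < 1 by rewrite expR_lt1 oppr_lt0 invr_gt0.
have rho01 : 0 < rho < 1 by rewrite /rho subr_gt0 e1 /= ltrBlDr ltrDl expR_gt0.
have [r0 r1] := andP rho01; have rn : rho != 0 by rewrite gt_eqF.
pose xi i := (expR (x i / d) - 1) / rho.
have xiE i : 1 + rho * xi i = expR (x i / d) by rewrite /xi mulrC divfK // addrC subrK.
have xi1 i : -1 < xi i < 1.
  have [h1 h2] := andP (x1 i).
  have u : expR (x i / d) < 1 by rewrite expR_lt1 pmulr_llt0 ?invr_gt0.
  have l : expR (- d^-1) < expR (x i / d).
    by rewrite ltr_expR ltr_pdivlMr // mulNr mulVf.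
  rewrite /xi ltr_pdivlMr // ltr_pdivrMr // mulN1r mul1r /rho; apply/andP; split; lra.
pose lg := logx rho; pose g := cpoly P (cmul (cC d%:C) lg).
have gE z : cev g z = P.[d%:C * cev lg z] by rewrite /g cev_poly cev_mul cev_C.
have dc : d%:C != 0 :> C by rewrite -nsq_gt0 nsq_real exprn_gt0.
have lgE i : cev lg (xi i, 0) = (x i / d)%:C.
  apply: eqcP; rewrite /= ?mulr0 ?mul0r ?atan0 // addr0 xiE lnM ?posrE ?expR_gt0 // !expRK.
  by move: (x i / d) => y; lra.
have sub : @closed_disk R `<=` half_plane rho.
  by move=> z /closed_disk_coord /andP[h1 h2]; rewrite /half_plane /=; nra.
have oA : open (half_plane rho).
  have c : continuous (fun z : R * R => 1 + rho * z.1).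
    move=> z; apply: (@continuous_ev R (EAdd (EC 1) (EMul (EC rho) (@EX R))) z).
    by do !split.
  have -> : half_plane rho = (fun z : R * R => 1 + rho * z.1) @^-1` [set y | 0 < y] by [].
  by apply: open_comp; [move=> z _; exact: c|exact: open_gt].
exists (half_plane rho), g, xi; split; [split => //|split].
- by move=> z hz; apply: holo_poly; apply: holo_mul; [exact: holo_C|exact: holo_log].
- move=> i j xij; apply: xinj; apply: (divIf dn); apply: expR_inj.
  by rewrite -!xiE xij.
- move=> z hz; rewrite gE => hm.
  have [/andP[b1 b2] b3] := log_bounds rho01 hz.
  have lnr : ln (1 - rho) = - d^-1 by rewrite /rho opprB addrC subrK expRK.
  rewrite lnr in b1.
  have pE : d%:C * cev lg z = Complex (d * Re (cev lg z)) (d * Im (cev lg z)).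
    by apply: eqcP; rewrite ?ReM ?ImM /=; ring.
  have ha : -1 <= d * Re (cev lg z) <= 1.
    apply/andP; split; last by apply: le_trans d1; rewrite ler_piMr // ltW.
    by rewrite -(mulfV dn) -mulrN ler_wpM2l // ltW.
  have hb : `|d * Im (cev lg z)| <= 2 * d.
    by rewrite normrM gtr0_norm // mulrC ler_wpM2r // ltW.
  rewrite pE in hm; have [i hi] := hd _ _ ha hb hm; exists i; rewrite -pE in hi.
  have lz : cev lg z = (x i / d)%:C.
    by apply: (mulfI dc); rewrite hi -rmorphM /= mulrC divfK.
  have := cexp_log (sub _ hz); rewrite -/lg lz => hc.
  have hr : expR (x i / d) = 1 + rho * z.1.
    move: (congr1 (fun c : C => Re c) hc); rewrite ReD ReM /= cos0 mulr1 mul0r subr0.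
    by [].
  have hi2 : 0 = rho * z.2.
    move: (congr1 (fun c : C => Im c) hc); rewrite ImD ImM /= sin0 mulr0 mul0r addr0 add0r.
    by [].
  apply/esym; case: (z) hr hi2 => a b /= hr hi2; congr pair.
    by rewrite /xi hr addrC addKr mulrC mulKf.
  by apply: (mulfI rn); rewrite mulr0.
move=> i; have [U [U0 PE]] := hU i.
have hxi : half_plane rho (xi i, 0) by rewrite /half_plane /= xiE expR_gt0.
split.
  rewrite gE lgE -rmorphM /= [d * _]mulrC divfK // PE !hornerE /= subrr expr0n /=.
  by rewrite mul0r addr0.
pose dl z := cev lg z - cev lg (xi i, 0).
pose q : C := (d * rho / (1 + rho * xi i))%:C.
(* The quotient of d log (1 + rho z) - x_i by [mobius]: [expquot] relates the difference of
   logarithms to rho (z - xi) / (1 + rho xi). *)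
pose S z := q * (1 - (xi i)%:C * cplx z) / expquot (dl z).
have lcv : ccvg (nbhs (xi i, 0 : R)) (cev lg) (cev lg (xi i, 0)).
  by apply: ccvg_cev; case: (holo_log hxi).
have dl0 : ccvg (nbhs (xi i, 0 : R)) dl 0.
  by rewrite -(subrr (cev lg (xi i, 0))); apply: ccvgB => //; exact: ccvg_cst.
have eq1 : ccvg (nbhs (xi i, 0 : R)) (fun z => expquot (dl z)) 1 by exact: ccvg_expquot.
have x2 : 0 < 1 - xi i ^+ 2 by move/andP: (xi1 i) => [h1 h2]; nra.
have den : ccvg (nbhs (xi i, 0 : R)) (fun z => 1 - (xi i)%:C * cplx z) (1 - xi i ^+ 2)%:C.
  have -> : (1 - xi i ^+ 2)%:C = 1 - (xi i)%:C * cplx (xi i, 0).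
    by apply: eqcP; rewrite ?(ReD, ImD, ReN, ImN, ReM, ImM) /=; ring.
  apply: ccvgB; first exact: ccvg_cst.
  by apply: ccvgM; [exact: ccvg_cst|exact: ccvg_cplx].
have lS : ccvg (nbhs (xi i, 0 : R)) S (q * (1 - xi i ^+ 2)%:C / 1).
  apply: ccvgM; first by apply: ccvgM => //; exact: ccvg_cst.
  by apply: ccvgV => //; exact: oner_neq0.
have lU : ccvg (nbhs (xi i, 0 : R)) (fun z => U.[d%:C * cev lg z]) U.[(x i)%:C].
  apply: ccvg_horner; have -> : (x i)%:C = d%:C * cev lg (xi i, 0).
    by rewrite lgE -rmorphM /= [d * _]mulrC divfK.
  by apply: ccvgM => //; exact: ccvg_cst.
have real_neq0 (a : R) : a != 0 -> a%:C != 0 :> C.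
  by move=> a0; rewrite -nsq_gt0 nsq_real exprn_even_gt0.
exists (fun z => S z ^+ 2 * U.[d%:C * cev lg z]),
  ((q * (1 - xi i ^+ 2)%:C / 1) ^+ 2 * U.[(x i)%:C]).
have q0 : q != 0.
  apply: real_neq0; rewrite !mulf_neq0 ?invr_eq0 //.
  by rewrite xiE gt_eqF // expR_gt0.
split.
- by rewrite mulf_neq0 // expf_neq0 // divr1 mulf_neq0 // real_neq0 // gt_eqF.
- by apply: ccvgM => //; rewrite !expr2; under eq_fun do rewrite expr2; exact: ccvgM.
have nd := ccvg_neq0 (FF := nbhs_filter _) (real_neq0 _ (lt0r_neq0 x2)) den.
have nq := ccvg_neq0 (FF := nbhs_filter _) (oner_neq0 _) eq1.
have nA : \forall z \near (xi i, 0 : R), half_plane rho z by exact: open_nbhs_nbhs.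
apply: filterS3 nd nq nA => z z1 z2 z3.
have rE : 1 + rho%:C * (xi i)%:C = (1 + rho * xi i)%:C.
  by apply: eqcP; rewrite ?(ReD, ImD, ReM, ImM) /=; ring.
have c1 : 1 + rho%:C * (xi i)%:C != 0 :> C.
  by rewrite rE; apply: real_neq0; rewrite xiE gt_eqF // expR_gt0.
have key : d%:C * cev lg z - (x i)%:C = mobius (xi i) z * S z.
  have dlE : dl z * expquot (dl z) = rho%:C * (cplx z - (xi i)%:C) / (1 + rho%:C * (xi i)%:C).
    rewrite -expquotE /dl cexpD cexpN !cexp_log //.
    have -> : cplx (xi i, 0) = (xi i)%:C by [].
    by field.
  have -> : d%:C * cev lg z - (x i)%:C = d%:C * dl z.
    by rewrite /dl mulrBr lgE -rmorphM /= [d * _]mulrC divfK.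
  have qE : q = d%:C * rho%:C / (1 + rho%:C * (xi i)%:C).
    by rewrite rE /q -fmorphV -!rmorphM.
  apply: (mulIf z2); rewrite -mulrA dlE /S qE /mobius; field.
  by rewrite c1 z2 z1.
rewrite gE {1}PE hornerD hornerC hornerM horner_exp hornerXsubC key.
by rewrite exprMn mulrA.
Qed.
End LogPotential.

(** * Gluing *)

Section Gluing.
Variable R : realType.
Local Open Scope complex_scope.
Local Notation "x ^*" := (conjc x) : ring_scope.
Local Notation C := R[i].
Local Notation Re := complex.Re.
Local Notation Im := complex.Im.

Lemma compact_closed_disk : compact (@closed_disk R).
Proof.
have c : continuous (fun z : R * R => sqn2 z).
  by move=> z; apply: (@continuous_ev R (EAdd (EMul (@EX R) (@EX R)) (EMul (@EY R) (@EY R))) z).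
apply: (@subclosed_compact _ _ (`[(-1 : R), 1]%classic `*` `[(-1 : R), 1]%classic)).
- have -> : @closed_disk R = (fun z : R * R => sqn2 z) @^-1` [set x | x <= 1] by [].
  by apply: preimage_closed; [move=> z _; exact: c|exact: closed_le].
- by apply: compact_setX; exact: segment_compact.
- move=> [a b] /= h; have h1 := closed_disk_coord h.
  have h2 := @closed_disk_coord R (b, a); rewrite /closed_disk /sqn2 /dot2 /= in h h2.
  by split; rewrite /= in_itv; [exact: h1|apply: h2; rewrite addrC].
Qed.

Lemma center_closed (x : R) : -1 < x < 1 -> closed_disk (x, 0 : R).
Proof. by move=> /andP[h1 h2]; rewrite /closed_disk /sqn2 /dot2 /=; nra. Qed.

Lemma stereo_onto (y : 'cV[R]_3) : sq3 y = 1 -> y != col3 0 0 1 ->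
  exists r : C, y = stereo (pair_of r).
Proof.
rewrite /sq3 sum3E; set a := y (inord 0) 0; set b := y (inord 1) 0.
set d := y (inord 2) 0 => h yn.
have d1 : 1 - d != 0.
  apply: contra yn; rewrite subr_eq0 => /eqP d1; apply/eqP.
  have ab : a ^+ 2 + b ^+ 2 = 0 by move: h; rewrite -d1; lra.
  have [a0 b0] := sq_sum_eq0 ab.
  by apply: cV3P; rewrite !col3E -/a -/b -/d.
exists (Complex (a / (1 - d)) (b / (1 - d))).
have ab : a ^+ 2 + b ^+ 2 = (1 - d) * (1 + d).
  have -> : (1 - d) * (1 + d) = 1 - d ^+ 2 by ring.
  by move: h; lra.
have N : nsq (Complex (a / (1 - d)) (b / (1 - d))) = (1 + d) / (1 - d).
  rewrite /nsq /= !expr_div_n -mulrDl ab expr2 -mulf_div divff // mul1r //.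
have M : 1 + (1 + d) / (1 - d) = 2 / (1 - d) by field.
by rewrite stereo_pair N M; apply: cV3P; rewrite !col3E /= -/a -/b -/d; field.
Qed.

Lemma norm_sum_le (k : nat) (P : pred 'I_k) (b : 'I_k -> 'cV[R]_3) (e : R) :
  (0 < k)%N -> 0 <= e -> (forall i, P i -> `|b i| <= e / k%:R) ->
  `|\sum_(i | P i) b i| <= e.
Proof.
move=> k0 e0 hb; have kR : 0 < k%:R :> R by rewrite ltr0n.
apply: le_trans (ler_norm_sum _ _ _) _.
apply: le_trans (_ : \sum_(i | P i) (e / k%:R) <= _); first exact: ler_sum.
apply: le_trans (_ : \sum_(i < k) (e / k%:R) <= _).
  by rewrite [leRHS](bigID P) /= lerDl; apply: sumr_ge0 => *; rewrite divr_ge0 // ltW.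
by rewrite sumr_const card_ord -[leLHS]mulr_natr divfK // gt_eqF.
Qed.

Local Open Scope ereal_scope.

Lemma hausdorff_ge0 (A B : set 'cV[R]_3) : A !=set0 -> 0 <= hausdorff_dist A B.
Proof.
move=> [a Aa]; rewrite /hausdorff_dist le_max; apply/orP; left.
apply: le_trans (_ : dist_to_set B a <= _); last by apply: ereal_sup_ubound; exists a.
by apply: le_ereal_inf_tmp => _ [b _ <-]; rewrite lee_fin sqrtr_ge0.
Qed.

Lemma hausdorff_le (A B : set 'cV[R]_3) (e : R) :
  (forall a, A a -> exists2 b, B b & (enorm (a - b) <= e)%R) ->
  (forall b, B b -> exists2 a, A a & (enorm (b - a) <= e)%R) ->
  hausdorff_dist A B <= e%:E.
Proof.
have half (A' B' : set 'cV[R]_3) :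
    (forall a, A' a -> exists2 b, B' b & (enorm (a - b) <= e)%R) ->
    ereal_sup [set dist_to_set B' a | a in A'] <= e%:E.
  move=> h; apply: ge_ereal_sup => _ [a Aa <-]; have [b Bb hb] := h _ Aa.
  apply: le_trans (_ : (enorm (a - b))%:E <= _); last by rewrite lee_fin.
  by apply: ereal_inf_lbound; exists b.
by move=> hA hB; rewrite /hausdorff_dist ge_max !half.
Qed.

Local Close Scope ereal_scope.

Notation near0 z0 := (filter_prod (nbhs (z0 : R * R)) ((0 : R)^'+)).

Lemma lim_near0_eps (z0 : R * R) : (t.2 : R) @[t --> near0 z0] --> (0 : R).
Proof.
by apply: (@cvg_trans _ ((0 : R)^'+)); [exact: cvg_snd|exact: cvg_within].
Qed.

Lemma near0_eps_gt0 (z0 : R * R) : \forall t \near near0 z0, 0 < (t.2 : R).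
Proof.
exists (setT, [set e : R | 0 < e]) => /=.
  by split; [exact: filterT|exact: nbhs_right_gt].
by move=> [z e] [_].
Qed.

Lemma near0_fst (z0 : R * R) (P : R * R -> Prop) :
  (\forall z \near z0, P z) -> \forall t \near near0 z0, P t.1.
Proof.
by move=> h; exists (P, setT) => [|[z e] []] //; split => //; exact: filterT.
Qed.

Lemma ccvg_near0 (z0 : R * R) (f : R * R -> C) l :
  ccvg (nbhs z0) f l -> ccvg (near0 z0) (fun t => f t.1) l.
Proof. by case=> h1 h2; split; [exact: cvg_comp cvg_fst h1|exact: cvg_comp cvg_fst h2]. Qed.

Section Approximation.
Variables (k : nat) (k_gt0 : (0 < k)%N) (c : 'I_k -> 'cV[R]_3).
Hypothesis S0 : forall i : 'I_k, unit_sphere (c i) 0.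
Variable eta : R.
Hypothesis eta_gt0 : 0 < eta.

Let cc : C := pi%:C * 'i.

(** The bubble covers the unit sphere about - Q e3, so [- c i] is the direction that Q e3 has to
    approximate; it is a unit vector because the sphere contains 0. *)
Lemma sq3_center i : sq3 (- c i) = 1.
Proof.
have := S0 i; rewrite /unit_sphere /= /enorm sub0r -/(sq3 _) => h.
by rewrite -[sq3 _]sqr_sqrtr ?sq3_ge0 // h expr1n.
Qed.

(** The Hausdorff estimate rests on three facts: the sum of bubbles is uniformly close to the
    soliton, at most one bubble matters at each point, and a point off the real axis, where the
    nodes lie, has a value near 0. The tolerance eta / k leaves eta for a sum over the bubbles. *)
Lemma gluing : exists (sg : C) (A : set (R * R)) (g : ex R * ex R) (xi : 'I_k -> R)
    (Q : 'I_k -> 'M[R]_3) (rho : 'I_k -> R),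
  [/\ sg != 0, sg - 1 != 0, open A, @closed_disk R `<=` A &
      forall z, A z -> holo g z] /\
  (forall i, [/\ -1 < xi i < 1, in_SO3 (Q i), 0 < rho i &
      `|Q i *m col3 0 0 1 + c i| < eta]) /\
  \forall eps \near (0 : R)^'+,
    [/\ 0 < eps,
      forall i, 2 * (eps * rho i) <= eta / k%:R,
      `|soliton eps sg (cev g (0, 2^-1))| <= eta,
      forall z, closed_disk z ->
        `|soliton eps sg (cev g z) - \sum_i bubble_part (Q i) (Num.sqrt (eps * rho i)) (xi i) z|
          <= eta &
      forall z, closed_disk z -> exists i, forall j, j != i ->
        `|bubble_part (Q j) (Num.sqrt (eps * rho j)) (xi j) z| <= eta / k%:R].
Proof.
have [sg [n [sg0 sg1 hn]]] := directions sq3_center eta_gt0.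
have [A [g [xi [[oA sA hg xinj xi1] [hint hloc]]]]] := @potential_exists R k n.
have kR : 0 < k%:R :> R by rewrite ltr0n.
pose x i := cexp (cc * sg * (n i)%:~R); pose y i := cexp (- (cc * sg * (n i)%:~R)).
have bub i : exists QR : 'M[R]_3 * R, [/\ in_SO3 QR.1, 0 < QR.2,
    QR.1 *m col3 0 0 1 = hopf (x i) (y i) &
    soliton t.2 sg (cev g t.1) - bubble_part QR.1 (Num.sqrt (t.2 * QR.2)) (xi i) t.1
      @[t --> near0 (xi i, 0 : R)] --> (0 : 'cV[R]_3)].
  have [gi [V [V0 [V00 lV gE]]]] := hloc i.
  have hxi : A (xi i, 0) by apply: sA; apply: center_closed.
  have lg : ccvg (near0 (xi i, 0)) (fun t => cev g t.1) (n i)%:~R.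
    by rewrite -gi; apply: ccvg_near0; apply: ccvg_cev; case: (hg _ hxi).
  have lT : ccvg (near0 (xi i, 0)) (fun t => mobius (xi i) t.1 ^+ 2) 0.
    apply: (ccvg_near0 (f := fun z => mobius (xi i) z ^+ 2)).
    have -> : (0 : C) = mobius (xi i) (xi i, 0) ^+ 2 by rewrite mobius_center expr0n.
    under eq_fun do rewrite -cev_mobius_sq.
    rewrite -cev_mobius_sq; apply: ccvg_cev.
    by case: (holo_mobius_sq (xi1 i) (center_closed (xi1 i))).
  have lV' := ccvg_near0 lV.
  have gE' : \forall t \near near0 (xi i, 0 : R),
      cev g t.1 = (n i)%:~R + mobius (xi i) t.1 ^+ 2 * V t.1 by exact: near0_fst gE.
  have [al [be [al0 be0 lim]]] := soliton_bubble (lim_near0_eps _) (near0_eps_gt0 _)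
     sg0 sg1 lg erefl lT lV' gE' V00.
  have N0 : nsq2 (x i) (y i) != 0 by exact: cexp_neq0_nsq2.
  have [Q hQ [rho rho0 [Qe3 hB]]] := hopf_bubble N0 al0 be0.
  (* The size s of the bubble is given by s^2 = eps rho, which identifies tau / (eps rho) with the
     argument of [stereo] in [bubble_part]. *)
  exists (Q, rho); split => //=.
  apply: cvg_trans lim; apply: near_eq_cvg.
  apply: filterS (near0_eps_gt0 (xi i, 0)) => t t0; congr (_ - _).
  by rewrite hB // /bubble_part sqr_sqrtr // mulr_ge0 // ltW.
have [QR hQR] := choice bub.
pose Q i := (QR i).1; pose rho i := (QR i).2.
have hQ i : in_SO3 (Q i) by case: (hQR i).
have hrho i : 0 < rho i by case: (hQR i).
have small_j j (z0 : R * R) (e : R) : 0 < e -> closed_disk z0 -> z0 != (xi j, 0) ->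
    \forall t \near near0 z0,
      `|bubble_part (Q j) (Num.sqrt (t.2 * rho j)) (xi j) t.1| <= e.
  move=> e0 hz z0n.
  have m0 : mobius (xi j) z0 != 0.
    rewrite mulf_neq0 ?invr_neq0 ?mobius_den // subr_eq0; apply: contra z0n.
    by case: (z0) => a b /eqP [-> ->].
  have n0 : 0 < nsq (mobius (xi j) z0 ^+ 2) by rewrite nsq_gt0 expf_neq0.
  have l1 : nsq (mobius (xi j) t.1 ^+ 2) @[t --> near0 z0] --> nsq (mobius (xi j) z0 ^+ 2).
    apply: ccvg_nsq; apply: (ccvg_near0 (f := fun z => mobius (xi j) z ^+ 2)).
    under eq_fun do rewrite -cev_mobius_sq.
    by rewrite -cev_mobius_sq; apply: ccvg_cev; case: (holo_mobius_sq (xi1 j) hz).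
  have l2 : 4 * (t.2 * rho j) ^+ 2 @[t --> near0 z0] --> (0 : R).
    have l0 : t.2 * rho j @[t --> near0 z0] --> 0 * rho j.
      by apply: cvgM; [exact: lim_near0_eps|exact: cvg_cst].
    have l4 : 4 * ((t.2 * rho j) * (t.2 * rho j)) @[t --> near0 z0] -->
        4 * ((0 * rho j) * (0 * rho j)) by apply: cvgMr; exact: cvgM.
    by rewrite !mul0r mulr0 in l4; under eq_fun do rewrite expr2.
  have l3 : e ^+ 2 * nsq (mobius (xi j) t.1 ^+ 2) - 4 * (t.2 * rho j) ^+ 2
      @[t --> near0 z0] --> e ^+ 2 * nsq (mobius (xi j) z0 ^+ 2) - 0.
    by apply: cvgB => //; exact: cvgMr.
  have p0 : 0 < e ^+ 2 * nsq (mobius (xi j) z0 ^+ 2) - 0 by rewrite subr0 mulr_gt0 ?exprn_gt0.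
  move/cvgrPdist_lt: l3 => /(_ _ p0) h3.
  apply: filterS2 h3 (near0_eps_gt0 z0) => t h t0.
  have tr : 0 < t.2 * rho j by rewrite mulr_gt0.
  apply: bubble_part_small => //; first by rewrite sqrtr_gt0.
  have -> : Num.sqrt (t.2 * rho j) ^+ 4 = (t.2 * rho j) ^+ 2.
    by rewrite (exprM _ 2 2) sqr_sqrtr // ltW.
  move: h; rewrite ltr_norml => /andP[_ h]; rewrite -subr_ge0.
  by move: h; rewrite ltrBlDr -ltrBlDl subrr => /ltW.
have kn : 0 < eta / k%:R / 2 by rewrite !divr_gt0.
have away (z0 : R * R) : closed_disk z0 -> (forall i, z0 != (xi i, 0)) ->
    soliton t.2 sg (cev g t.1) @[t --> near0 z0] --> (0 : 'cV[R]_3).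
  move=> hz hne; apply: (@soliton_away _ _ _ _ _ _ (cev g z0)) => //.
  - exact: lim_near0_eps.
  - exact: near0_eps_gt0.
  - by apply: ccvg_near0; apply: ccvg_cev; case: (hg _ (sA _ hz)).
  - move=> m; apply/eqP => gm; have [i zi] := hint _ hz (ex_intro _ m gm).
    by have := hne i; rewrite zi eqxx.
pose Pr (eps : R) (z : R * R) :=
  `|soliton eps sg (cev g z) - \sum_i bubble_part (Q i) (Num.sqrt (eps * rho i)) (xi i) z|
     <= eta /\
  exists i, forall j, j != i ->
     `|bubble_part (Q j) (Num.sqrt (eps * rho j)) (xi j) z| <= eta / k%:R.
have e2 : 0 < eta / 2 by rewrite divr_gt0.
have sum_small (P : pred 'I_k) (b : 'I_k -> 'cV[R]_3) :
    (forall i, P i -> `|b i| <= eta / k%:R / 2) -> `|\sum_(i | P i) b i| <= eta / 2.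
  by move=> hb; apply: norm_sum_le => // [|i /hb]; [exact: ltW|rewrite mulrAC].
have halfk (b : 'cV[R]_3) : `|b| <= eta / k%:R / 2 -> `|b| <= eta / k%:R.
  by move=> h; apply: le_trans h _; rewrite ler_piMr ?divr_ge0 ?ltW // invf_lt1 // ltr1n.
have loc (z0 : R * R) : closed_disk z0 -> \forall z \near z0 & eps \near (0 : R)^'+, Pr eps z.
  move=> hz.
  have [[i zi]|hne] := pselect (exists i, z0 = (xi i, 0)).
    have [_ _ _ lim] := hQR i; rewrite -zi in lim.
    move/cvgr0Pnorm_lt: lim => /(_ _ e2) h1.
    have h2 : \forall t \near near0 z0, forall j, j != i ->
        `|bubble_part (Q j) (Num.sqrt (t.2 * rho j)) (xi j) t.1| <= eta / k%:R / 2.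
      apply: filter_forall => j; have [->|ji] := eqVneq j i.
        by apply: filterS (near0_eps_gt0 z0) => t _.
      have : \forall t \near near0 z0,
        `|bubble_part (Q j) (Num.sqrt (t.2 * rho j)) (xi j) t.1| <= eta / k%:R / 2.
        apply: small_j => //; rewrite zi; apply: contra ji => /eqP [E].
        by apply/eqP/esym/xinj.
      by apply: filterS.
    have : \forall t \near near0 z0, Pr t.2 t.1.
      apply: filterS2 h1 h2 => t h1 h2; split; last by exists i => j /h2 /halfk.
      rewrite (bigD1 i) //= opprD addrA (splitr eta).
      apply: le_trans (ler_normB _ _) _; apply: lerD; first exact: ltW.
      by apply: sum_small => j /h2.
    by [].
  have hne' i : z0 != (xi i, 0) by apply/eqP => E; apply: hne; exists i.
  have := away _ hz hne' => /cvgr0Pnorm_lt /(_ _ e2) h1.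
  have h2 : \forall t \near near0 z0, forall j,
        `|bubble_part (Q j) (Num.sqrt (t.2 * rho j)) (xi j) t.1| <= eta / k%:R / 2.
    by apply: filter_forall => j; exact: small_j.
  have : \forall t \near near0 z0, Pr t.2 t.1.
    apply: filterS2 h1 h2 => t h1 h2; split; last first.
      by exists (Ordinal k_gt0) => j _; apply: halfk.
    rewrite (splitr eta); apply: le_trans (ler_normB _ _) _.
    by apply: lerD; [exact: ltW|apply: sum_small].
  by [].
(* The limits are joint in z and eps, so compactness makes them uniform. *)
have K := (compact_near_coveringP _).1 compact_closed_disk.
have H : \forall eps \near (0 : R)^'+, @closed_disk R `<=` Pr eps by exact: K.
pose zs : R * R := (0, 2^-1).
have hzs : closed_disk zs by rewrite /closed_disk /sqn2 /dot2 /=; lra.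
have zsn i : zs != (xi i, 0).
  by apply/eqP => -[_ /eqP]; rewrite invr_eq0 pnatr_eq0.
have hs : \forall eps \near (0 : R)^'+, `|soliton eps sg (cev g zs)| <= eta.
  have [[U E] /= [Un En] UE] : \forall t \near near0 zs, `|soliton t.2 sg (cev g t.1)| < eta.
    by have /cvgr0Pnorm_lt /(_ _ eta_gt0) := away _ hzs zsn.
  apply: filterS En => eps Ee; apply: ltW; apply: (UE (zs, eps)); split => //=.
  exact: nbhs_singleton.
exists sg, A, g, xi, Q, rho; split => //; split.
  move=> i; split => //; have [_ _ -> _] := hQR i.
  by have := hn i; rewrite opprK.
have hr : \forall eps \near (0 : R)^'+, forall i, 2 * (eps * rho i) <= eta / k%:R.
  apply: filter_forall => i; near=> eps.
  rewrite mulrA -ler_pdivlMr // mulrC -ler_pdivlMr //; apply: ltW.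
  by near: eps; apply: nbhs_right_lt; rewrite !divr_gt0.
near=> eps; split.
- by near: eps; exact: nbhs_right_gt.
- by near: eps.
- by near: eps.
- by move=> z hz; have [] : Pr eps z by apply: (near H eps).
- by move=> z hz; have [] : Pr eps z by apply: (near H eps).
Unshelve. all: by end_near.
Qed.
End Approximation.
End Gluing.

(** * Assembly of the solution and its Hausdorff distance to the spheres *)

Section Conclusion.
Variable R : realType.
Local Open Scope complex_scope.
Local Notation C := R[i].
Local Notation Re := complex.Re.
Local Notation Im := complex.Im.

Lemma spectral_nondegenerate (eps : R) (sg : C) : 0 < eps -> sg != 0 -> sg - 1 != 0 ->
  let m1 := 1 + eps%:C / sg in let m2 := 1 + eps%:C / (sg - 1) in
  [/\ (Re m1 - 1) ^+ 2 + Im m1 ^+ 2 != 0, (Re m2 - 1) ^+ 2 + Im m2 ^+ 2 != 0 &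
      0 < (Re m2 - Re m1) ^+ 2 + (Im m2 - Im m1) ^+ 2].
Proof.
move=> e0 s0 s1 m1 m2.
have ec : eps%:C != 0 :> C by rewrite -nsq_gt0 nsq_real exprn_gt0.
have nE (m : C) : (Re m - 1) ^+ 2 + Im m ^+ 2 = nsq (m - 1).
  by rewrite /nsq !(ReD, ImD, ReN, ImN) /= subr0.
have dE : (Re m2 - Re m1) ^+ 2 + (Im m2 - Im m1) ^+ 2 = nsq (m2 - m1).
  by rewrite /nsq !(ReD, ImD, ReN, ImN).
rewrite !nE dE nsq_gt0 !nsq_eq0 /m1 /m2 ![1 + _]addrC !addrK.
rewrite !mulf_neq0 ?invr_neq0 //; split => //.
have -> : eps%:C / (sg - 1) + 1 - (eps%:C / sg + 1) = eps%:C / (sg * (sg - 1)).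
  by field; rewrite s0 s1.
by rewrite mulf_neq0 // invr_neq0 // mulf_neq0.
Qed.

Lemma spectral_pos (s : C) : \forall eps \near (0 : R)^'+, 0 < Re (1 + eps%:C / s).
Proof.
have l : ccvg ((0 : R)^'+) (fun eps : R => 1 + eps%:C / s) (1 + 0%:C / s).
  apply: ccvgD; first exact: ccvg_cst.
  apply: ccvgM; last exact: ccvg_cst.
  by apply: ccvg_real; exact: cvg_within.
have [l1 _] := l; move/cvgrPdist_lt: l1 => /(_ _ ltr01).
apply: filterS => eps; rewrite (_ : Re (1 + 0%:C / s) = 1).
  by rewrite ltr_norml => /andP[_ h]; lra.
by rewrite ReD ReM /=; ring.
Qed.

Lemma represents_scale (l : R) (A : set (R * R)) f u :
  represents A f u -> represents A (fun z => l *: f z) (scale3 l u).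
Proof.
move=> h z /h[ok fz]; split; first exact: ok3_scale.
by rewrite fz; apply: cV3P; rewrite mxE !col3E.
Qed.

(** A value of u is close to one [bubble_part], on a sphere displaced from the given one by the
    small vector Q e3 + c. Conversely, a point of the given sphere, moved by this vector, is a value
    of its bubble on the disk or is close to 0, and values of u near 0 are supplied by the point (0,
    1/2). The multiplier [l] prepares the division by eps_n. *)
Lemma approximation (k : nat) (k_gt0 : (0 < k)%N) (c : 'I_k -> 'cV[R]_3)
    (S0 : forall i : 'I_k, unit_sphere (c i) 0) (e : R) : 0 < e ->
  exists (u w : R * R -> 'cV[R]_3) (Q : 'I_k -> 'M[R]_3) (mu : 'I_k -> R)
    (xi a p : 'I_k -> R * R) (PQdelta : 'I_k -> R * R -> 'cV[R]_3),
  [/\ (forall l : R, smooth_on_circle (fun z => l *: u z)) /\ (forall i, in_SO3 (Q i) /\ 0 < mu i),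
      forall i, is_projection
        (fun z => Q i *m bubble (mu i) (xi i) (a i) (p i) z) (PQdelta i),
      (forall z, closed_disk z -> u z = \sum_(i < k) PQdelta i z + w z) /\
      (forall z, closed_disk z -> enorm (w z) < e),
      solves_H_system u u &
      (hausdorff_dist (u @` @disk R) (\bigcup_i unit_sphere (c i)) <= e%:E)%E].
Proof.
(* The worst error below is [2 * (3 * eta + eta)]; the factor 2 passes from the sup norm to the
   Euclidean one. *)
move=> e0; pose eta := e / 10; have eta0 : 0 < eta by rewrite divr_gt0.
have [sg [A [g [xi [Q [rho [[sg0 sg1 oA sA hg] [hQ near_eps]]]]]]]] :=
  gluing k_gt0 S0 eta0.
have [eps [[[eps0 hr hzs hsum hone] m1p] m2p]] := filter_ex
  (filterI (filterI near_eps (spectral_pos sg)) (spectral_pos (sg - 1))).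
pose s i := Num.sqrt (eps * rho i).
have rho0 i : 0 < rho i by case: (hQ i).
have hQ1 i : in_SO3 (Q i) by case: (hQ i).
have xi1 i : -1 < xi i < 1 by case: (hQ i).
have s0 i : 0 < s i by rewrite sqrtr_gt0 mulr_gt0.
have s2 i : s i ^+ 2 = eps * rho i by rewrite sqr_sqrtr // ltW // mulr_gt0.
have kR : 0 < k%:R :> R by rewrite ltr0n.
have x2 i : 0 < 1 - xi i ^+ 2 by move/andP: (xi1 i) => [h1 h2]; nra.
pose u z := soliton eps sg (cev g z).
pose b i z := bubble_part (Q i) (s i) (xi i) z.
pose PQ i := projected (Q i) (s i) (xi i).
have [d1 d2 d3] := spectral_nondegenerate eps0 sg0 sg1.
have hf z : A z -> holo (cmul (cC ((eps * pi)%:C * 'i)) g) z.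
  by move=> /hg h; apply: holo_mul => //; exact: holo_C.
have sol := soliton_ok_H oA hf m1p m2p d1 d2 d3.
have rep : represents A u (soliton3 (Re (1 + eps%:C / sg)) (Im (1 + eps%:C / sg))
    (Re (1 + eps%:C / (sg - 1))) (Im (1 + eps%:C / (sg - 1)))
    (cmul (cC ((eps * pi)%:C * 'i)) g)).
  by move=> z Az; split; [case: (sol _ Az)|rewrite ev3_soliton].
have rep_sub (B : set (R * R)) : B `<=` A -> represents B u _ :=
  fun BA z Bz => rep z (BA z Bz).
have cA : @circle R `<=` A by move=> z /circle_closed /sA.
have dA : @disk R `<=` A by move=> z /disk_closed /sA.
have base z : closed_disk z -> exists i, `|u z - b i z| <= 2 * eta /\
    forall j, j != i -> `|b j z| <= eta.
  move=> hz; have [i hi] := hone z hz; exists i; split; last first.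
    move=> j /hi h; apply: le_trans h _; rewrite ler_piMr ?(ltW eta0) // invf_le1 //.
    by rewrite ler1n.
  have -> : u z - b i z = (u z - \sum_j b j z) + \sum_(j | j != i) b j z.
    have gen (U B S T : 'cV[R]_3) : T = B + S -> U - B = (U - T) + S.
      by move=> ->; apply/matrixP => l m; rewrite !mxE; ring.
    by apply: gen; rewrite (bigD1 i).
  apply: le_trans (ler_normD _ _) _; rewrite mulr_natl mulr2n.
  by apply: lerD; [exact: hsum|apply: norm_sum_le => //; exact: ltW].
have to_sphere i (v : 'cV[R]_3) : sq3 (v + Q i *m col3 0 0 1) = 1 ->
    unit_sphere (c i) (v + (Q i *m col3 0 0 1 + c i)).
  move=> h; rewrite /unit_sphere /= /enorm -/(sq3 _) addrA addrK h.
  exact: sqrtr1.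
have close i : `|Q i *m col3 0 0 1 + c i| < eta by case: (hQ i).
exists u, (fun z => u z - \sum_i PQ i z), Q, (fun i => s i * (1 - xi i ^+ 2)),
  (fun i => (xi i, 0)), (fun i => (s i * xi i, 0)), (fun=> (0, 0)), PQ; split.
- split; first by move=> l; apply: represents_smooth (represents_scale l (rep_sub _ cA)).
  by move=> i; split => //; rewrite mulr_gt0.
- by move=> i; exact: projected_is_projection.
- split=> z hz; first by rewrite addrC subrK.
  have -> : u z - \sum_i PQ i z = (u z - \sum_i b i z) - \sum_i (PQ i z - b i z).
    have gen (U V B : 'cV[R]_3) : U - V = (U - B) - (V - B).
      by apply/matrixP => l m; rewrite !mxE; ring.
    have E : \sum_i (PQ i z - b i z) = \sum_i PQ i z - \sum_i b i z.
      by rewrite big_split /= sumrN.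
    by rewrite E; exact: gen.
  have h : `|\sum_i (PQ i z - b i z)| <= eta.
    apply: norm_sum_le => // [|i _]; first exact: ltW.
    apply: le_trans (projected_near (hQ1 i) (s0 i) (xi1 i) hz) _.
    by rewrite s2.
  apply: le_lt_trans (enorm_le _) _; apply: le_lt_trans (_ : 2 * (eta + eta) < _).
    by rewrite ler_wpM2l //; apply: le_trans (ler_normB _ _) _; apply: lerD => //; exact: hsum.
  rewrite /eta; lra.
- split.
  + exact: represents_continuous_closed (rep_sub _ sA).
  + by apply: represents_C2 (rep_sub _ dA); exact: open_disk.
  + move=> z hz; apply: (represents_H _ (rep_sub _ dA) hz); first exact: open_disk.
    by case: (sol _ (dA _ hz)).
  + by [].
apply: hausdorff_le => [_ [z hz <-]|v [i _ hv]].
  have [i [h1 _]] := base z (disk_closed hz).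
  exists (b i z + (Q i *m col3 0 0 1 + c i)).
    by exists i => //; apply: to_sphere; exact: bubble_part_sphere.
  apply: le_trans (enorm_le _) _; rewrite opprD addrA.
  apply: le_trans (_ : 2 * (2 * eta + eta) <= _); last by rewrite /eta; lra.
  rewrite ler_wpM2l //; apply: le_trans (ler_normB _ _) _; apply: lerD => //.
  exact/ltW/close.
(* [t] is [v] moved to the sphere about - Q e3, and [y] the corresponding point of the standard
   sphere. *)
pose t := v - (Q i *m col3 0 0 1 + c i).
pose y := (Q i)^T *m (v - c i).
have [QQ _] := hQ1 i.
have tE : t = Q i *m (y - col3 0 0 1).
  by rewrite mulmxBr /y mulmxA QQ mul1mx /t opprD addrA addrAC.
have y1 : sq3 y = 1.
  rewrite -(sq3_SO3 y (hQ1 i)) /y mulmxA QQ mul1mx.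
  have := hv; rewrite /unit_sphere /= /enorm -/(sq3 _) => h.
  by rewrite -[sq3 _]sqr_sqrtr ?sq3_ge0 // h expr1n.
suff [z hz h] : exists2 z, disk z & `|t - u z| <= 3 * eta.
  exists (u z); first by exists z.
  apply: le_trans (enorm_le _) _.
  have -> : v - u z = (t - u z) + (Q i *m col3 0 0 1 + c i).
    by rewrite /t; apply/matrixP => l m; rewrite !mxE; ring.
  apply: le_trans (_ : 2 * (3 * eta + eta) <= _); last by rewrite /eta; lra.
  rewrite ler_wpM2l //; apply: le_trans (ler_normD _ _) _; apply: lerD => //.
  exact/ltW/close.
have small : `|t| <= eta -> exists2 z, disk z & `|t - u z| <= 3 * eta.
  move=> ht; exists (0, 2^-1); first by rewrite /disk /sqn2 /dot2 /=; lra.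
  apply: le_trans (ler_normB _ _) _; have := hzs; rewrite -/(u _); lra.
have [yE|yn] := eqVneq y (col3 0 0 1).
  by apply: small; rewrite tE yE subrr mulmx0 normr0 ltW.
have [r yr] := stereo_onto y1 yn.
(* The open disk reaches exactly the r with |r| s^2 < 1; beyond that the bubble is within 2 s^2 of
   its value at infinity. *)
have [hr1|hr1] := ltP (nsq r * s i ^+ 4) 1; last first.
  apply: small; have s4 : 0 < s i ^+ 4 by rewrite exprn_gt0.
  have hs : 2 * s i ^+ 2 <= eta.
    rewrite s2; apply: le_trans (hr i) _.
    by rewrite ler_piMr ?(ltW eta0) // invf_le1 // ler1n.
  apply: le_trans hs; apply: norm_le_sq3; first by rewrite mulr_ge0 ?sqr_ge0.
  rewrite tE sq3_SO3 // yr sq3_stereo_sub ler_pdivrMr; last by rewrite ltr_pwDl ?nsq_ge0.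
  have -> : (2 * s i ^+ 2) ^+ 2 * (1 + nsq r) = 4 * (s i ^+ 4 + nsq r * s i ^+ 4) by ring.
  by rewrite -[leLHS]mulr1 ler_wpM2l //; apply: le_trans hr1 _; rewrite lerDr ltW.
have s2n : (s i ^+ 2)%:C != 0 :> C by rewrite -nsq_gt0 nsq_real !exprn_gt0.
(* The bubble factors through the squaring map, so a preimage is found by a complex square root
   followed by the inverse automorphism. *)
pose q := sqrtc (r * (s i ^+ 2)%:C).
have q2 : q ^+ 2 = r * (s i ^+ 2)%:C by exact: sqr_sqrtc.
have q1 : nsq q < 1.
  have : nsq q ^+ 2 < 1 ^+ 2.
    by rewrite expr2 -nsqM -expr2 q2 nsqM nsq_real -exprM expr1n.
  by rewrite ltr_pXn2r ?nnegrE ?nsq_ge0 ?ler01.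
have [z hz zq] := mobius_onto (xi1 i) q1.
have bz : b i z = t.
  by rewrite /b /bubble_part zq q2 mulfK // -yr tE.
have [j [h1 h2]] := base z (disk_closed hz).
(* If another bubble dominates at [z], then [t], being the value of the i-th one, is small. *)
have [ij|ij] := eqVneq i j; last by apply: small; rewrite -bz; exact: h2.
exists z => //; rewrite distrC -bz ij; apply: le_trans h1 _.
by rewrite ler_wpM2r ?(ltW eta0) // ler_nat.
Qed.
End Conclusion.

Theorem theorem1p1 (R : realType) (k : nat) (k_gt0 : (0 < k)%N)
    (c : 'I_k -> 'cV[R]_3) (S0 : forall i : 'I_k, unit_sphere (c i) 0) :
  exists (eps : nat -> R) (g u w : nat -> R * R -> 'cV[R]_3)
    (Q : nat -> 'I_k -> 'M[R]_3) (mu : nat -> 'I_k -> R)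
    (xi a p : nat -> 'I_k -> R * R)
    (PQdelta : nat -> 'I_k -> R * R -> 'cV[R]_3),
    (forall n, 0 < eps n) /\ eps @ \oo --> (0 : R) /\
    (forall n, smooth_on_circle (g n)) /\
    (forall n i, in_SO3 (Q n i) /\ 0 < mu n i) /\
    (forall n i, is_projection
       (fun z => Q n i *m bubble (mu n i) (xi n i) (a n i) (p n i) z)
       (PQdelta n i)) /\
    (forall n z, closed_disk z ->
       u n z = \sum_(i < k) PQdelta n i z + w n z) /\
    (forall e : R, 0 < e ->
       \forall n \near \oo, forall z, closed_disk z -> enorm (w n z) < e) /\
    (forall n, solves_H_system (u n) (fun z => eps n *: g n z)) /\
    hausdorff_dist (u n @` @disk R) (\bigcup_i unit_sphere (c i))
      @[n --> \oo] --> (0 : R)%:E.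
Proof.
(* This [eps n] is the tolerance of the n-th approximation and the prefactor of the boundary datum,
   not the spectral parameter of the soliton. The datum is the trace of [u n] itself, so [g n] is
   [u n] divided by [eps n]. *)
pose eps (n : nat) : R := n.+1%:R^-1.
have eps0 n : 0 < eps n by rewrite invr_gt0.
have epsl : eps @ \oo --> (0 : R) by exact: cvg_harmonic.
have [u /choice[w /choice[Q /choice[mu /choice[xi /choice[a /choice[p
  /choice[PQ H]]]]]]]] := choice (fun n => approximation k_gt0 S0 (eps0 n)).
exists eps, (fun n z => (eps n)^-1 *: u n z), u, w, Q, mu, xi, a, p, PQ.
have gE n : (fun z => eps n *: ((eps n)^-1 *: u n z)) = u n.
  by apply/funext => z; rewrite scalerA mulfV ?scale1r // gt_eqF.
do 2 split => //; split; last split; last split; last split; last split; last split.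
- by move=> n; have [[hs _] _ _ _ _] := H n; exact: hs.
- by move=> n i; have [[_ h] _ _ _ _] := H n.
- by move=> n i; have [_ h _ _ _] := H n.
- by move=> n z; have [_ _ [h _] _ _] := H n; exact: h.
- move=> e e0; move/cvgr0Pnorm_lt: epsl => /(_ _ e0); apply: filterS => n h z hz.
  have [_ _ [_ hw] _ _] := H n; apply: lt_trans (hw z hz) _.
  by rewrite -[ltLHS]gtr0_norm.
- by move=> n; rewrite gE; have [_ _ _ h _] := H n.
apply: (squeeze_cvge (f := fun=> 0%:E) (h := fun n => (eps n)%:E)).
- apply: nearW => n; have [_ _ _ _ ->] := H n; rewrite andbT.
  apply: hausdorff_ge0; exists (u n (0, 0)); exists (0, 0) => //.
  by rewrite /disk /sqn2 /dot2 /= !mul0r addr0.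
- exact: cvg_cst.
- by apply: cvg_EFin => //; exact: nearW.
Qed.
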